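(* Let $\{Z_n\}_{n\in\mathbb{N}_0}$ be a defective Galton-Watson process in a varying environment $v=\{f_n\}_{n\in\mathbb{N}}$. Assume that there exists $c>0$ such that for all $n\in\mathbb{N}$, $$E[X_{n1}^2;X_{n1}\geq 2]\leq c\, E[X_{n1};X_{n1}\geq 2]\,E[X_{n1}\mid X_{n1}\geq 1].$$ If $P[\tau_a=\infty]>0$, then there exists a non-negative random variable $W$ such that, as $n\to\infty$, $$\frac{Z_n}{\mu_n}\to W>0\quad\text{a.s. on } \{\tau_a=\infty\}.$$
   Context: $\mathbb{N}=\{1,2,\dots\}$, $\mathbb{N}_0=\mathbb{N}\cup\{0\}$, $\Delta\notin\mathbb{N}_0$ is an extra ''graveyard'' state, and $\mathbb{N}_\Delta=\mathbb{N}_0\cup\{\Delta\}$. For each $n\in\mathbb{N}$, $f_n$ is a possibly defective distribution on $\mathbb{N}_0$: weights $f_n[k]\ge 0$, $k\in\mathbb{N}_0$, with $\sum_k f_n[k]\le 1$; its generating function is also denoted $f_n(s)=\sum_{k\ge0}f_n[k]s^k$, $s\in[0,1]$; $f_n'(1)=\sum_k kf_n[k]$. Standing assumption: $0<f_n'(1)<\infty$ for all $n\ge1$. A defective Galton-Watson process in a varying environment $v=\{f_n\}_{n\in\mathbb{N}}$ is the process defined by $Z_0=1$, $Z_n=\sum_{j=1}^{Z_{n-1}}X_{nj}$, $n\in\mathbb{N}$, where $\{X_{nj}:n,j\in\mathbb{N}\}$ are independent $\mathbb{N}_\Delta$-valued random variables with $P[X_{nj}=k]=f_n[k]$ for $k\in\mathbb{N}_0$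 and $P[X_{nj}=\Delta]=1-f_n(1)$. Conventions: $\Delta+k=\Delta$ for $k\in\mathbb{N}_\Delta$, and $\sum_{j=1}^{\Delta}k_j=\Delta$; empty sums are $0$. Thus $0$ and $\Delta$ are absorbing. For an $\mathbb{N}_\Delta$-valued $X$, $E[h(X)]$ means $E[h(X);X\ne\Delta]$, and events such as $\{X\ge1\}$, $\{X\ge 2\}$ do not include $X=\Delta$. Notation: $\mu_0=1$, $\mu_n=\prod_{i=1}^n f_i'(1)$; $\tau_0=\min\{n\in\mathbb{N}:Z_n=0\}$, $\tau_\Delta=\min\{n\in\mathbb{N}:Z_n=\Delta\}$ (with $\min\varnothing=\infty$), $\tau_a=\tau_0\wedge\tau_\Delta$. *)

(* Defs.v *)
From HB Require Import structures.
From mathcomp Require Import all_boot all_order all_algebra.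
From mathcomp Require Import finmap.
From mathcomp Require Import all_classical all_reals all_analysis.

Set Implicit Arguments.
Unset Strict Implicit.
Unset Printing Implicit Defensive.

Import Order.TTheory GRing.Theory Num.Theory.
Import numFieldNormedType.Exports.

Local Open Scope classical_set_scope.
Local Open Scope ring_scope.

(* N_0 together with the graveyard state: Some k is k and None is Delta.
   It carries the discrete sigma-algebra. *)
Definition NDelta : Type := option nat.
HB.instance Definition _ := Pointed.on NDelta.
HB.instance Definition _ := @isMeasurable.Build default_measure_display
  NDelta discrete_measurable discrete_measurable0
  discrete_measurableC discrete_measurableU.

Definition Delta : NDelta := None.
Definition state (k : nat) : NDelta := Some k.

Definition addD (x y : NDelta) : NDelta :=
  if x is Some a then if y is Some b then Some (a + b)%N else None else None.

(* sum_{j=1}^{z} x_j, equal to Delta for z = Delta *)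
Definition sumD (z : NDelta) (x : nat -> NDelta) : NDelta :=
  if z is Some k then \big[addD/state 0]_(1 <= j < k.+1) x j else Delta.

(* Only meant for x <> Delta; the value 0 at Delta is a dummy. *)
Definition real_of (R : realType) (x : NDelta) : R :=
  if x is Some k then k%:R else 0.

Definition gen_fun (R : realType) (p : nat -> R) (s : R) : \bar R :=
  (\sum_(0 <= k <oo) (p k * s ^+ k)%:E)%E.

(* the derivative at 1 of the generating function, as the series of k p[k] *)
Definition gen_fun_deriv1 (R : realType) (p : nat -> R) : \bar R :=
  (\sum_(0 <= k <oo) (k%:R * p k)%:E)%E.

Definition defective_distribution (R : realType) (p : nat -> R) : Prop :=
  (forall k, 0 <= p k) /\ (gen_fun p 1 <= 1)%E.

(* The sequence f is only considered at indices n >= 1. *)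
Definition varying_environment (R : realType) (f : nat -> nat -> R) : Prop :=
  forall n, (1 <= n)%N ->
    defective_distribution (f n) /\
    (0 < gen_fun_deriv1 (f n) < +oo)%E.

Definition mu (R : realType) (f : nat -> nat -> R) (n : nat) : R :=
  \prod_(1 <= i < n.+1) fine (gen_fun_deriv1 (f i)).

Definition mutual_independence (d d' : measure_display) (T : measurableType d)
    (T' : measurableType d') (R : realType) (P : probability T R)
    (I : choiceType) (D : set I) (X : I -> {RV P >-> T'}) : Prop :=
  forall (J : {fset I}) (B : I -> set T'),
    [set` J] `<=` D -> (forall i, measurable (B i)) ->
    P (\bigcap_(i in [set` J]) (X i @^-1` B i)) =
    (\prod_(i <- J) P (X i @^-1` B i))%E.

Definition offspring_family (d : measure_display) (T : measurableType d)
    (R : realType) (P : probability T R) (f : nat -> nat -> R)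
    (X : nat -> nat -> {RV P >-> NDelta}) : Prop :=
  mutual_independence [set nj : nat * nat | (1 <= nj.1)%N /\ (1 <= nj.2)%N]
    (fun nj => X nj.1 nj.2) /\
  (forall n j, (1 <= n)%N -> (1 <= j)%N ->
    (forall k, P (X n j @^-1` [set state k]) = (f n k)%:E) /\
    P (X n j @^-1` [set Delta]) = (1 - gen_fun (f n) 1)%E).

Fixpoint GW (d : measure_display) (T : measurableType d) (R : realType)
    (P : probability T R) (X : nat -> nat -> {RV P >-> NDelta}) (n : nat)
    (w : T) : NDelta :=
  if n is m.+1 then sumD (GW X m w) (fun j => X m.+1 j w) else state 1.

(* min {n >= 1 : Z_n = z}, which is +oo when there is no such n *)
Definition hitting_time (R : realType) (T : Type) (Z : nat -> T -> NDelta)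
    (z : NDelta) (w : T) : \bar R :=
  ereal_inf [set (n%:R)%:E | n in [set n | (1 <= n)%N /\ Z n w = z]].

Definition absorption_time (R : realType) (T : Type) (Z : nat -> T -> NDelta)
    (w : T) : \bar R :=
  Order.min (hitting_time R Z (state 0) w) (hitting_time R Z Delta w).

(* the event {X \in B}, which excludes X = Delta *)
Definition event_in (T : Type) (X : T -> NDelta) (B : set nat) : set T :=
  X @^-1` (state @` B).

(* E[h(X); X \in B] *)
Definition expect_on (d : measure_display) (T : measurableType d)
    (R : realType) (P : probability T R) (X : T -> NDelta) (h : R -> R)
    (B : set nat) : \bar R :=
  (\int[P]_(w in event_in X B) (h (real_of R (X w)))%:E)%E.

(* E[h(X) | X \in B], for an event of positive probability *)
Definition cond_expect (d : measure_display) (T : measurableType d)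
    (R : realType) (P : probability T R) (X : T -> NDelta) (h : R -> R)
    (B : set nat) : \bar R :=
  (expect_on P X h B / P (event_in X B))%E.

(* Main.v *)
(* A backward orbit s_(n-1) = f_n(s_n) in [0, 1] makes s_n^Z_n (0 at Delta) a
   bounded martingale of mean s_0, so it converges almost surely.  The extremal
   orbits a_n = P(never Delta | Z_n = 1) and b_n = P(extinction | Z_n = 1) give
   limits 1 and 0 on survival.  For b < s < a the key deterministic fact is that
   mu_n * (- ln (s_n / a_n)) has a limit theta in (0, oo); then Z_n / mu_n tends
   to - ln (lim s_n^Z_n) / theta.  Letting s_0 increase to a_0 (resp. decrease to
   b_0) shows that on survival lim s_n^Z_n is positive (resp. smaller than 1) for
   some orbit, so that the limit of Z_n / mu_n is finite (resp. positive).

   For the key fact put nu_n = prod_i f_i'(a_i), x_n = nu_n (a_n - s_n) and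
   y_n = nu_n (a_n - b_n); both are nondecreasing by convexity.  The increments of
   1/x and 1/y are values of the shape function 1/(f(a) - f(t)) - 1/(f'(a) (a - t)),
   which the moment condition makes comparable at t = s and t = b up to a
   constant C.  Hence x is bounded as soon as y_k > C x_k for some large k;
   otherwise y/x is bounded, which forces b_n -> 0 and a summable probability
   of having at least two children, and again x is bounded.  The ratio mu_n / nu_n
   is controlled by the telescoping sum of (1 - a_n) / (a_n - b_n). *)

Require Import Defs.
From HB Require Import structures.
From mathcomp Require Import all_boot all_order all_algebra.
From mathcomp Require Import finmap.
From mathcomp Require Import all_classical all_reals all_analysis.
From mathcomp Require Import measurable_realfun.
From mathcomp Require Import zify ring lra.

Set Implicit Arguments.
Unset Strict Implicit.
Unset Printing Implicit Defensive.

Import Order.TTheory GRing.Theory Num.Theory.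
Import numFieldNormedType.Exports.

Local Open Scope classical_set_scope.
Local Open Scope ring_scope.

(** * Weighted sums *)

(** The moment condition lives at the point 1, whereas the convexity estimates are needed at a_n,
    which may lie below 1. Moving from 1 to a_n costs only constant factors once 1 - a_n is small
    compared with a_n - b_n, but no assumption on the environment says so directly. It is read off a
    single surviving path: along its sizes z_n the powers a_n^z_n tend to 1 and b_n^z_n to 0, hence
    (1 - a_n) / (a_n - b_n) tends to 0. This is why the deterministic part takes a sequence z as a
    hypothesis, together with a positive limit of s_n^z_n.

    The comparability of the shape values rests on two size-bias inequalities: an upper bound by a
    second moment and a lower bound by a first moment over k >= 2, neither depending on the second
    point. The moment condition links these two moments. Damping the weights to w_k a^k and
    rescaling the second point to s / a reduces any base point a to the base point 1.

    Conditional expectations never appear: the martingale property is an equality of integrals over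
    past events. *)

Section WeightedSums.
Variables (R : realType) (w : nat -> R).

(** The limit operator gives a meaningless value for a divergent series, so sums are handled through
    the relation [wsums] and only then read as values of [wsum]. *)
Definition wsum (h : nat -> R) : R := limn (series (fun k => w k * h k)).
Definition wsums (h : nat -> R) (x : R) : Prop :=
  series (fun k => w k * h k) @ \oo --> x.
Definition wcvg (h : nat -> R) : Prop := cvgn (series (fun k => w k * h k)).

Lemma wcvgP h : wcvg h -> wsums h (wsum h).
Proof. by []. Qed.

Lemma wsums_wcvg h x : wsums h x -> wcvg h.
Proof. by move=> hx; apply/cvg_ex; exists x. Qed.

Lemma wsumsE h x : wsums h x -> wsum h = x.
Proof. by move=> hx; apply/cvg_lim. Qed.

Lemma wsumsZ c h x : wsums h x -> wsums (fun k => c * h k) (c * x).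
Proof.
move=> hx; rewrite /wsums (_ : (fun _ => _) = c *: (fun k => w k * h k)).
  by rewrite seriesZ; exact: cvgZl_tmp.
by apply/funext => k /=; rewrite mulrCA.
Qed.

Lemma wsumsD h g x y : wsums h x -> wsums g y ->
  wsums (fun k => h k + g k) (x + y).
Proof.
move=> hx gy; rewrite /wsums (_ : (fun _ => _) =
  (fun k => w k * h k) + (fun k => w k * g k)); first by rewrite seriesD; apply: cvgD.
by apply/funext => k /=; rewrite mulrDr.
Qed.

Lemma wsumsB h g x y : wsums h x -> wsums g y ->
  wsums (fun k => h k - g k) (x - y).
Proof.
move=> hx gy; rewrite /wsums (_ : (fun _ => _) =
    (fun k => w k * h k) - (fun k => w k * g k)).
  by rewrite seriesD seriesN; apply: cvgB.
by apply/funext => k /=; rewrite mulrBr.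
Qed.

(** A test function concentrated at n isolates one weight: it splits off a single term or bounds a
    sum below by one of its terms. *)
Lemma wsums_pick x n : wsums (fun k => x * (k == n)%:R) (w n * x).
Proof.
apply: cvg_near_cst; near=> N.
rewrite /series /= (bigD1_seq n) ?iota_uniq//=; last first.
  by rewrite mem_index_iota/=; near: N; exact: nbhs_infty_gt.
by rewrite eqxx mulr1 big1 ?addr0// => i /negbTE ->; rewrite !mulr0.
Unshelve. all: by end_near. Qed.

Hypothesis w_ge0 : forall k, 0 <= w k.

Lemma wsums_ge0 h x : wsums h x -> (forall k, 0 <= h k) -> 0 <= x.
Proof.
move=> hx h0; rewrite -(wsumsE hx); apply: limr_ge; first exact: wsums_wcvg hx.
by apply: nearW => n; apply: sumr_ge0 => k _; rewrite mulr_ge0.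
Qed.

Lemma wsums_le h g x y : wsums h x -> wsums g y -> (forall k, h k <= g k) ->
  x <= y.
Proof.
move=> hx gy hg; rewrite -subr_ge0; apply: (wsums_ge0 (wsumsB gy hx)) => k.
by rewrite subr_ge0.
Qed.

Lemma wcvg_dom h g : wcvg g -> (forall k, 0 <= h k <= g k) -> wcvg h.
Proof.
move=> cg hg; apply: (series_le_cvg _ _ _ cg) => k.
- by have /andP[h0 _] := hg k; rewrite mulr_ge0.
- by have /andP[h0 hgk] := hg k; rewrite mulr_ge0// (le_trans h0).
- by have /andP[_ hgk] := hg k; rewrite ler_wpM2l.
Qed.

End WeightedSums.
Arguments wsumsZ {R w} c {h x}.
Arguments wsums_pick {R} w x n.

Lemma wsum_damp (R : realType) (w : nat -> R) (x : R) h :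
  wsum (fun k => w k * x ^+ k) h = wsum w (fun k => x ^+ k * h k).
Proof. by congr (limn (series _)); apply/funext => k; rewrite mulrA. Qed.

Lemma wcvg_damp (R : realType) (w : nat -> R) (x : R) h :
  wcvg w (fun k => x ^+ k * h k) -> wcvg (fun k => w k * x ^+ k) h.
Proof.
by congr (cvgn (series _)); apply/funext => k; rewrite mulrA.
Qed.

(** * Convexity inequalities for powers *)

Section PowerInequalities.
Variable R : realFieldType.
Implicit Types (x y t : R) (k : nat).

(** [1 - x ^+ k] is [1 - x] times the sum of the k powers of x with exponent below k, each between
    [x ^+ k] and 1; this bound and the next one are the two extremes. *)
Lemma onem_expr_ge x k : 0 <= x <= 1 -> k%:R * x ^+ k * (1 - x) <= 1 - x ^+ k.
Proof.
move=> /andP[x0 x1]; elim: k => [|k IH]; first by rewrite !mul0r expr0 subrr.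
have h : 0 <= x ^+ k <= 1 by rewrite exprn_ge0//= exprn_ile1.
have h2 : k%:R * x ^+ k.+1 * (1 - x) <= k%:R * x ^+ k * (1 - x).
  rewrite ler_wpM2r ?subr_ge0// ler_wpM2l// exprS ler_piMl//.
  by case/andP: h.
have : 0 <= x ^+ k * (1 - x) ^+ 2.
  by rewrite mulr_ge0 ?sqr_ge0//; case/andP: h.
rewrite -natr1 mulrDl mulrDl; move: IH h2; rewrite exprS; lra.
Qed.

Lemma onem_expr_le x k : 0 <= x <= 1 -> 1 - x ^+ k <= k%:R * (1 - x).
Proof.
move=> /andP[x0 x1]; elim: k => [|k IH]; first by rewrite !mul0r expr0 subrr.
have h : 0 <= x ^+ k <= 1 by rewrite exprn_ge0//= exprn_ile1.
rewrite -natr1 mulrDl exprS; move: IH h; nra.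
Qed.

(** From k to k + 1 the right side minus the left side grows by (1 - x) (1 - x^k - k x^k (1 - x)),
    which is nonnegative by [onem_expr_ge]. *)
Lemma onem_expr_quad x k : 0 <= x <= 1 ->
  (k%:R - 1) * ((1 - x) * (1 - x ^+ k)) <= 2 * (k%:R * (1 - x) - (1 - x ^+ k)).
Proof.
move=> x01; elim: k => [|k IH]; first by rewrite mul0r expr0 subrr !mulr0 subrr mulr0.
have /andP[x0 x1] := x01; have h := onem_expr_ge k x01.
rewrite -natr1 -[_ + 1 - 1]addrA subrr addr0 exprS.
set y := x ^+ k in h IH *; set n : R := k%:R in h IH *.
suff : 0 <= (1 - x) * ((1 - y) - n * y * (1 - x)) by move: IH; lra.
by rewrite mulr_ge0// subr_ge0.
Qed.

Lemma expr_chord x y t k : 0 <= x -> x <= y -> y <= t ->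
  (t ^+ k - x ^+ k) * (t - y) <= (t ^+ k - y ^+ k) * (t - x).
Proof.
move=> x0 xy yt; have y0 : 0 <= y by exact: le_trans xy.
have t0 : 0 <= t by exact: le_trans yt.
rewrite !subrXX.
rewrite (mulrC (t - x)) (mulrC (t - y)) -!mulrA (mulrC (t - x)).
apply: ler_wpM2r; first by rewrite mulr_ge0 ?subr_ge0// (le_trans xy).
apply: ler_sum => i _; apply: ler_wpM2l; first exact: exprn_ge0.
by apply: lerXn2r.
Qed.

(** The slopes of the two chords ending at t differ by the sum of t^(k-1-i) (y^i - x^i). The term i
    = 1, present since k >= 2, is already at least t^k (y - x) because t <= 1. *)
Lemma expr_chord_gap x y t k : 0 <= x -> x <= y -> y <= t -> t <= 1 ->
  (2 <= k)%N ->
  t ^+ k * ((y - x) * ((t - x) * (t - y))) <=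
  (t ^+ k - y ^+ k) * (t - x) - (t ^+ k - x ^+ k) * (t - y).
Proof.
move=> x0 xy yt t1 k2; have y0 : 0 <= y by exact: le_trans xy.
have t0 : 0 <= t by exact: le_trans yt.
rewrite !subrXX.
set A := \sum_(i < k) _; set B := \sum_(i < k) _.
suff : t ^+ k * (y - x) <= A - B.
  move=> h; rewrite [X in _ <= X](_ : _ = (A - B) * ((t - x) * (t - y))); last by ring.
  by rewrite mulrA ler_wpM2r// mulr_ge0 ?subr_ge0// (le_trans xy).
rewrite /A /B -sumrB.
pose i1 := Ordinal k2.
rewrite (bigD1 i1)//= !expr1 -[leLHS]addr0 lerD//.
  rewrite -mulrBr ler_wpM2r ?subr_ge0//.
  by rewrite ler_wiXn2l//; lia.
apply: sumr_ge0 => i _; rewrite -mulrBr mulr_ge0 ?exprn_ge0// subr_ge0.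
exact: lerXn2r.
Qed.

(** The factor t on the left avoids the exponent k - 1 of the derivative. *)
Lemma expr_tangent x t k : 0 <= x <= t ->
  t * (t ^+ k - x ^+ k) <= k%:R * t ^+ k * (t - x).
Proof.
move=> /andP[x0 xt]; have t0 := le_trans x0 xt.
case: k => [|k]; first by rewrite !expr0 subrr mulr0 !mul0r.
rewrite subrXX mulrCA mulrC ler_wpM2r ?subr_ge0//.
rewrite mulr_natl -[k.+1 in leRHS]card_ord -sumr_const mulr_sumr.
apply: ler_sum => i _.
rewrite /= mulrA -exprS card_ord.
have -> : t ^+ k.+1 = t ^+ (k - i).+1 * t ^+ i.
  by rewrite -exprD; congr (_ ^+ _); have := ltn_ord i; lia.
by rewrite ler_wpM2l ?exprn_ge0// lerXn2r.
Qed.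

End PowerInequalities.

(** * Size-bias inequalities *)

Section SizeBias.
Variables (R : realType) (v : nat -> R).
Hypothesis v_ge0 : forall k, 0 <= v k.
Hypothesis v_sq : wcvg v (fun k => (k%:R + 1) ^+ 2).

Lemma wcvg_poly h : (forall k, 0 <= h k <= (k%:R + 1) ^+ 2) -> wcvg v h.
Proof. exact: wcvg_dom. Qed.

Lemma wcvg_nat : wcvg v (fun k => k%:R).
Proof.
apply: wcvg_poly => k; have : 0 <= k%:R :> R by []. 
by move: (k%:R) => x; nra.
Qed.

Lemma wcvg_pos : wcvg v (fun k => (0 < k)%N%:R).
Proof.
apply: wcvg_poly => k; have : 0 <= k%:R :> R by [].
move: (k%:R) => x; case: (0 < k)%N => x0; apply/andP; split=> //=; nra.
Qed.

Lemma wcvg_onemX x : 0 <= x <= 1 -> wcvg v (fun k => 1 - x ^+ k).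
Proof.
move=> /andP[x0 x1]; apply: wcvg_poly => k; have : 0 <= k%:R :> R by [].
have : 0 <= x ^+ k <= 1 by rewrite exprn_ge0//= exprn_ile1.
move: (k%:R) (x ^+ k) => y z /andP[? ?] ?; apply/andP; split; nra.
Qed.

Lemma wcvg_natM_onemX x : 0 <= x <= 1 -> wcvg v (fun k => k%:R * (1 - x ^+ k)).
Proof.
move=> /andP[x0 x1]; apply: wcvg_poly => k; have : 0 <= k%:R :> R by [].
have : 0 <= x ^+ k <= 1 by rewrite exprn_ge0//= exprn_ile1.
move: (k%:R) (x ^+ k) => y z /andP[? ?] ?; apply/andP; split; nra.
Qed.

Lemma wcvg_fact2 : wcvg v (fun k => k%:R * (k%:R - 1)).
Proof.
apply: wcvg_poly => k; case: k => [|k]; first by rewrite mul0r; lra.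
rewrite -natr1; have : 0 <= k%:R :> R by [].
by move: (k%:R) => x; nra.
Qed.

(* The pivot of this Chebyshev sum inequality is just above the mean of k. *)
Lemma chebyshev_onemX x : 0 <= x <= 1 -> 0 < wsum v (fun k => (0 < k)%N%:R) ->
  wsum v (fun k => k%:R) * wsum v (fun k => 1 - x ^+ k) <=
  wsum v (fun k => (0 < k)%N%:R) * wsum v (fun k => k%:R * (1 - x ^+ k)).
Proof.
move=> x01; have /andP[x0 x1] := x01.
set P := wsum v _; set m := wsum v _; set D := wsum v _; set Q := wsum v _ => P0.
pose c := m / P.
have m0 : 0 <= m by exact: (wsums_ge0 v_ge0 wcvg_nat).
have c0 : 0 <= c by rewrite divr_ge0// ltW.
pose K := (Num.truncn c).+1; pose y := 1 - x ^+ K.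
have h (k : nat) : 0 <= (k%:R * (1 - x ^+ k) - c * (1 - x ^+ k)) - (y * k%:R - y * c * (0 < k)%N%:R).
  case: k => [|k]; first by rewrite expr0 subrr !mulr0 !subrr.
  rewrite mulr1 (_ : _ - _ = (k.+1%:R - c) * (1 - x ^+ k.+1 - y)); last by ring.
  rewrite /y.
  have [Kk|kK] := leqP K k.+1.
    have h1 : c < k.+1%:R.
      by apply: (lt_le_trans (truncnS_gt c)); rewrite ler_nat.
    rewrite mulr_ge0//; first by rewrite subr_ge0 ltW.
    have : x ^+ k.+1 <= x ^+ K by rewrite ler_wiXn2l.
    lra.
  have h1 : k.+1%:R <= c.
    apply: (@le_trans _ _ (Num.truncn c)%:R); first by rewrite ler_nat.
    by rewrite truncn_le.
  rewrite mulr_le0//; first by rewrite subr_le0.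
  have : x ^+ K <= x ^+ k.+1 by rewrite ler_wiXn2l// ltnW.
  lra.
have cn := wcvgP (wcvg_nat); have cp := wcvgP (wcvg_pos).
have co := wcvgP (wcvg_onemX x01); have cno := wcvgP (wcvg_natM_onemX x01).
have := wsums_ge0 v_ge0 (wsumsB (wsumsB cno (wsumsZ c co)) (wsumsB (wsumsZ y cn) (wsumsZ (y * c) cp))) h.
rewrite -/P -/m -/D -/Q => H.
have cP : c * P = m by rewrite /c divfK// gt_eqF.
have : 0 <= Q - c * D by move: H; rewrite -[y * c * P]mulrA cP; lra.
by move=> H2; rewrite -cP; nra.
Qed.

(** Summing [onem_expr_quad] bounds the gap below by a multiple of (1 - x) times the sum of (k - 1)
    (1 - x^k). The Chebyshev inequality separates the two factors, so that only first moments
    remain. *)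
Lemma sizebias_lower x : 0 <= x <= 1 -> 0 < wsum v (fun k => (0 < k)%N%:R) ->
  wsum v (fun k => 1 - x ^+ k) * (1 - x) *
    (wsum v (fun k => k%:R) - wsum v (fun k => (0 < k)%N%:R)) <=
  2 * wsum v (fun k => (0 < k)%N%:R) *
    (wsum v (fun k => k%:R) * (1 - x) - wsum v (fun k => 1 - x ^+ k)).
Proof.
move=> x01 P0; have := chebyshev_onemX x01 P0; move: P0.
have /andP[x0 x1] := x01.
have cn := wcvgP (wcvg_nat); have co := wcvgP (wcvg_onemX x01); have cno := wcvgP (wcvg_natM_onemX x01).
have h (k : nat) : (1 - x) * (k%:R * (1 - x ^+ k) - (1 - x ^+ k)) <=
    2 * ((1 - x) * k%:R - (1 - x ^+ k)).
  by have := onem_expr_quad k x01; lra.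
have := wsums_le v_ge0 (wsumsZ (1 - x) (wsumsB cno co)) (wsumsZ 2 (wsumsB (wsumsZ (1 - x) cn) co)) h.
set P := wsum v (fun k => (0 < k)%N%:R); set m := wsum v (fun k => k%:R).
set D := wsum v (fun k => 1 - _); set Q := wsum v _.
move=> H1 P0 H2.
have : (1 - x) * (m * D) <= (1 - x) * (P * Q) by rewrite ler_wpM2l// subr_ge0.
have : P * ((1 - x) * (Q - D)) <= P * (2 * ((1 - x) * m - D)) by rewrite ler_wpM2l// ltW.
lra.
Qed.

(* Cauchy-Schwarz for k = sqrt(1 - x^k) * (k / sqrt(1 - x^k)), obtained by summing
   the arithmetic-geometric mean inequality with the optimal multiplier l. *)
Lemma sizebias_upper x : 0 <= x < 1 -> 0 < wsum v (fun k => 1 - x ^+ k) ->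
  wsum v (fun k => k%:R) ^+ 2 * (1 - x) <=
  wsum v (fun k => 1 - x ^+ k) *
    (wsum v (fun k => k%:R) + (1 - x) * wsum v (fun k => k%:R * (k%:R - 1))).
Proof.
move=> /andP[x0 x1] D0; have x01 : 0 <= x <= 1 by rewrite x0 ltW.
have cn := wcvgP (wcvg_nat); have co := wcvgP (wcvg_onemX x01); have cf := wcvgP (wcvg_fact2).
set m := wsum v _; set D := wsum v _ in D0 *; set G := wsum v (fun k => _ * _).
pose l := m / D.
have m0 : 0 <= m by exact: (wsums_ge0 v_ge0 cn).
have l0 : 0 <= l by rewrite divr_ge0// ltW.
have h (k : nat) : 0 <= k%:R + (1 - x) * (k%:R * (k%:R - 1))
    + (l ^+ 2 * (1 - x) * (1 - x ^+ k) - 2 * l * (1 - x) * k%:R).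
  case: k => [|k]; first by rewrite expr0 subrr !mulr0 !mul0r !mulr0 subrr !addr0.
  set n : R := k.+1%:R; set u := 1 - x ^+ k.+1.
  have n1 : 1 <= n by rewrite ler1n.
  have u0 : 0 < u by rewrite subr_gt0 exprn_ilt1.
  set g := n + _.
  have g0 : 0 <= g by rewrite /g addr_ge0 ?mulr_ge0//; lra.
  (* This is the pointwise bound k^2 (1 - x) / (1 - x^k) <= k + (1 - x) k (k - 1); multiplied by u,
     its excess is n (x u - n (1 - u) (1 - x)). *)
  have ug : n ^+ 2 * (1 - x) <= u * g.
    have h1 : n * (1 - u) * (1 - x) <= x * u.
      rewrite /u subKr exprS /n -natr1.
      have := ler_wpM2l x0 (onem_expr_ge k x01).
      by move: (k%:R) (x ^+ k) => y z; lra.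
    suff : 0 <= n * (x * u - n * (1 - u) * (1 - x)) by rewrite /g; lra.
    by rewrite mulr_ge0 ?subr_ge0//; lra.
  suff : 0 <= u * (g + (l ^+ 2 * (1 - x) * u - 2 * l * (1 - x) * n)).
    by rewrite pmulr_rge0.
  have : 0 <= (1 - x) * (n - l * u) ^+ 2 by rewrite mulr_ge0 ?sqr_ge0// subr_ge0 ltW.
  lra.
have := wsums_ge0 v_ge0 (wsumsD (wsumsD cn (wsumsZ (1 - x) cf))
  (wsumsB (wsumsZ (l ^+ 2 * (1 - x)) co) (wsumsZ (2 * l * (1 - x)) cn))) h.
rewrite -/m -/D -/G => H.
have lD : l * D = m by rewrite /l divfK// gt_eqF.
have : 0 <= D * (m + (1 - x) * G + (l ^+ 2 * (1 - x) * D - 2 * l * (1 - x) * m)).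
  by rewrite mulr_ge0// ltW.
have -> : D * (m + (1 - x) * G + (l ^+ 2 * (1 - x) * D - 2 * l * (1 - x) * m)) =
  D * (m + (1 - x) * G) + ((l * D) ^+ 2 * (1 - x) - 2 * (l * D) * (1 - x) * m) by ring.
rewrite lD; lra.
Qed.

End SizeBias.

(** * Generating functions of one environment *)

Section Environment.
Variables (R : realType) (w : nat -> R).

Definition pgf t := wsum w (fun k => t ^+ k).
(** For the generating function f of [w], [dmean w t] is t f'(t), so that f'(t) is [dmean w t / t],
    and [dpos w t] is f(t) - f(0). Only [tail2] is undamped, being the second moment of the moment
    condition. *)
Definition dmean t := wsum w (fun k => t ^+ k * k%:R).
Definition dpos t := wsum w (fun k => t ^+ k * (0 < k)%N%:R).
Definition dtail t := wsum w (fun k => t ^+ k * (1 < k)%N%:R).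
Definition dtail1 t := wsum w (fun k => t ^+ k * ((1 < k)%N%:R * k%:R)).
Definition tail2 := wsum w (fun k => (1 < k)%N%:R * k%:R ^+ 2).

Hypothesis w_ge0 : forall k, 0 <= w k.
Hypothesis w_sq : wcvg w (fun k => (k%:R + 1) ^+ 2).

Lemma wcvg_damped t h : 0 <= t <= 1 ->
  (forall k, 0 <= h k <= (k%:R + 1) ^+ 2) -> wcvg w (fun k => t ^+ k * h k).
Proof.
move=> /andP[t0 t1] hh; apply: (wcvg_dom w_ge0 w_sq) => k.
have /andP[h0 h1] := hh k; rewrite mulr_ge0 ?exprn_ge0//=.
by apply: le_trans h1; rewrite ler_piMl// exprn_ile1.
Qed.

Lemma pgf_cvg t : 0 <= t <= 1 -> wsums w (fun k => t ^+ k) (pgf t).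
Proof.
move=> /andP[t0 t1]; apply: wcvgP; apply: (wcvg_dom w_ge0 w_sq) => k.
rewrite exprn_ge0//= (@le_trans _ _ 1) ?exprn_ile1//.
have : 0 <= k%:R :> R by []. 
by move: (k%:R) => x; nra.
Qed.

Lemma dmean_cvg t : 0 <= t <= 1 -> wsums w (fun k => t ^+ k * k%:R) (dmean t).
Proof.
move=> t01; apply: wcvgP; apply: wcvg_damped => // k.
have : 0 <= k%:R :> R by [].
by move: (k%:R) => x; nra.
Qed.

Lemma dpos_cvg t : 0 <= t <= 1 ->
  wsums w (fun k => t ^+ k * (0 < k)%N%:R) (dpos t).
Proof.
move=> t01; apply: wcvgP; apply: wcvg_damped => // k.
have : 0 <= k%:R :> R by [].
by move: (k%:R) => x; case: (0 < k)%N => /= x0; apply/andP; split=> //; nra.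
Qed.

Lemma dtail_cvg t : 0 <= t <= 1 ->
  wsums w (fun k => t ^+ k * (1 < k)%N%:R) (dtail t).
Proof.
move=> t01; apply: wcvgP; apply: wcvg_damped => // k.
have : 0 <= k%:R :> R by [].
by move: (k%:R) => x; case: (1 < k)%N => /= x0; apply/andP; split=> //; nra.
Qed.

Lemma dtail1_cvg t : 0 <= t <= 1 ->
  wsums w (fun k => t ^+ k * ((1 < k)%N%:R * k%:R)) (dtail1 t).
Proof.
move=> t01; apply: wcvgP; apply: wcvg_damped => // k.
have : 0 <= k%:R :> R by [].
by move: (k%:R) => x; case: (1 < k)%N => /= x0; apply/andP; split=> //; nra.
Qed.

Lemma tail2_cvg : wsums w (fun k => (1 < k)%N%:R * k%:R ^+ 2) tail2.
Proof.
apply: wcvgP; apply: (wcvg_dom w_ge0 w_sq) => k.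
have : 0 <= k%:R :> R by [].
by move: (k%:R) => x; case: (1 < k)%N => /= x0; apply/andP; split=> //; nra.
Qed.

Let wle := wsums_le w_ge0.
Let i01 : 0 <= (1 : R) <= 1. Proof. by rewrite ler01 lexx. Qed.

Lemma dtail_ge0 t : 0 <= t <= 1 -> 0 <= dtail t.
Proof.
move=> t01; apply: (wsums_ge0 w_ge0 (dtail_cvg t01)) => k.
by rewrite mulr_ge0// exprn_ge0//; case/andP: t01.
Qed.

Lemma dtail1_ge0 t : 0 <= t <= 1 -> 0 <= dtail1 t.
Proof.
move=> t01; apply: (wsums_ge0 w_ge0 (dtail1_cvg t01)) => k.
by rewrite !mulr_ge0// exprn_ge0//; case/andP: t01.
Qed.

(** The moment condition controls only k >= 2, so the term k = 1 is kept apart. *)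
Lemma dmean_split t : 0 <= t <= 1 -> dmean t = t * w 1%N + dtail1 t.
Proof.
move=> t01; apply: wsumsE; rewrite [t * _]mulrC.
have := wsumsD (wsums_pick w t 1%N) (dtail1_cvg t01).
congr wsums; apply/funext => -[|[|k]] /=; rewrite ?(mulr0, mul0r, mulr1, mul1r)//.
  by rewrite addr0.
by rewrite addr0.
by rewrite add0r.
Qed.

Lemma dpos_le t : 0 <= t <= 1 -> dpos t <= dpos 1.
Proof.
move=> t01; apply: (wle (dpos_cvg t01) (dpos_cvg i01)) => k.
by rewrite expr1n ler_wpM2r// exprn_ile1//; case/andP: t01.
Qed.

(** From k = 2 on, k <= 2 (k - 1). This converts the difference of mean and positive mass, as it
    comes out of the size-bias bound, into the tail mean. *)
Lemma dmean_le_dpos t : 0 <= t <= 1 ->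
  dtail1 t <= 2 * (dmean t - dpos t).
Proof.
move=> t01; have /andP[t0 t1] := t01.
apply: (wle (dtail1_cvg t01) (wsumsZ 2 (wsumsB (dmean_cvg t01) (dpos_cvg t01)))) => k.
rewrite -mulrBr [leRHS]mulrCA ler_wpM2l ?exprn_ge0//.
case: k => [|[|k]] /=; rewrite ?mulr0 ?mul0r ?subrr ?mulr0//.
rewrite mul1r -natr1 -natr1; have : 0 <= k%:R :> R by [].
by move: (k%:R) => x; rewrite mulr1n; lra.
Qed.

Lemma pgf_le x t : 0 <= x -> x <= t -> t <= 1 -> pgf x <= pgf t.
Proof.
move=> x0 xt t1; have t0 := le_trans x0 xt; have x1 := le_trans xt t1.
have tI : 0 <= t <= 1 by rewrite t0.
have xI : 0 <= x <= 1 by rewrite x0.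
by apply: (wle (pgf_cvg xI) (pgf_cvg tI)) => k; rewrite lerXn2r.
Qed.

Lemma pgf_itv t : pgf 1 <= 1 -> 0 <= t <= 1 -> 0 <= pgf t <= 1.
Proof.
move=> p1 tI; have /andP[t0 t1] := tI; apply/andP; split.
  by apply: (wsums_ge0 w_ge0 (pgf_cvg tI)) => i; exact: exprn_ge0.
by apply: le_trans p1; exact: pgf_le.
Qed.

Lemma pgf_lt x t : 0 < dmean 1 -> 0 <= x -> x < t -> t <= 1 -> pgf x < pgf t.
Proof.
move=> m0 x0 xt t1; have t0 := le_trans x0 (ltW xt); have x1 := le_trans (ltW xt) t1.
have tI : 0 <= t <= 1 by rewrite t0.
have xI : 0 <= x <= 1 by rewrite x0.
(* A positive mean forces a positive weight at some k >= 1, and this single term makes the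
   inequality strict. *)
have [k k0 wk0] : exists2 k, (0 < k)%N & 0 < w k.
  apply: contrapT => h; move: m0; rewrite lt_neqAle => /andP[/eqP + _]; apply.
  apply/esym/wsumsE; have := wsums_pick w 0 0.
  rewrite mulr0 {2}/wsums (_ : (fun k => w k * (1 ^+ k * k%:R)) =
    fun k => w k * (0 * (k == 0)%:R))//.
  apply/funext => -[|k]; first by rewrite !(mulr0, mul0r).
  rewrite mul0r mulr0; apply/eqP; rewrite mulf_eq0; apply/orP; left.
  rewrite eq_le w_ge0 andbT leNgt; apply/negP => wk; apply: h; by exists k.+1.
have h : 0 < w k * (t ^+ k - x ^+ k).
  by rewrite mulr_gt0// subr_gt0 ltrXn2r// -lt0n.
rewrite -subr_gt0; apply: lt_le_trans h _.
apply: (wle (wsums_pick w _ k) (wsumsB (pgf_cvg tI) (pgf_cvg xI))) => i.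
case: eqVneq => [->|_] /=; last by rewrite mulr0 subr_ge0 lerXn2r ?ltW.
by rewrite mulr1.
Qed.

Lemma pgf_chord x y t : 0 <= x -> x <= y -> y <= t -> t <= 1 ->
  (pgf t - pgf x) * (t - y) <= (pgf t - pgf y) * (t - x).
Proof.
move=> x0 xy yt t1.
have xI : 0 <= x <= 1 by apply/andP; split; lra.
have yI : 0 <= y <= 1 by apply/andP; split; lra.
have tI : 0 <= t <= 1 by apply/andP; split; lra.
rewrite mulrC [leRHS]mulrC.
apply: (wle (wsumsZ (t - y) (wsumsB (pgf_cvg tI) (pgf_cvg xI)))
  (wsumsZ (t - x) (wsumsB (pgf_cvg tI) (pgf_cvg yI)))) => k.
by rewrite mulrC [leRHS]mulrC; exact: expr_chord.
Qed.

Lemma pgf_chord_gap x y t : 0 <= x -> x <= y -> y <= t -> t <= 1 ->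
  dtail t * ((y - x) * ((t - x) * (t - y))) <=
  (pgf t - pgf y) * (t - x) - (pgf t - pgf x) * (t - y).
Proof.
move=> x0 xy yt t1.
have xI : 0 <= x <= 1 by apply/andP; split; lra.
have yI : 0 <= y <= 1 by apply/andP; split; lra.
have tI : 0 <= t <= 1 by apply/andP; split; lra.
rewrite [leLHS]mulrC [(_ - pgf y) * _]mulrC [(_ - pgf x) * _]mulrC.
apply: (wle (wsumsZ ((y - x) * ((t - x) * (t - y))) (dtail_cvg tI)) (wsumsB
  (wsumsZ (t - x) (wsumsB (pgf_cvg tI) (pgf_cvg yI)))
  (wsumsZ (t - y) (wsumsB (pgf_cvg tI) (pgf_cvg xI))))) => k.
have [k1|k1] := ltnP 1 k.
  have := expr_chord_gap x0 xy yt t1 k1; rewrite /= mulr1.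
  by move: (t ^+ k) (x ^+ k) (y ^+ k) => p q r; lra.
rewrite mulr0 mulr0 subr_ge0 mulrC [leRHS]mulrC.
exact: expr_chord.
Qed.

Lemma pgf_tangent x t : 0 <= x -> x <= t -> t <= 1 ->
  t * (pgf t - pgf x) <= dmean t * (t - x).
Proof.
move=> x0 xt t1.
have xI : 0 <= x <= 1 by apply/andP; split; lra.
have tI : 0 <= t <= 1 by apply/andP; split; lra.
rewrite [leRHS]mulrC.
apply: (wle (wsumsZ t (wsumsB (pgf_cvg tI) (pgf_cvg xI)))
  (wsumsZ (t - x) (dmean_cvg tI))) => k.
have := @expr_tangent _ x t k; rewrite x0 xt => /(_ isT).
by move: (t ^+ k) (x ^+ k) => p q; lra.
Qed.

Lemma pgf_lipschitz x t : 0 <= x -> x <= t -> t <= 1 ->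
  pgf t - pgf x <= dmean 1 * (t - x).
Proof.
move=> x0 xt t1.
have xI : 0 <= x <= 1 by apply/andP; split; lra.
have tI : 0 <= t <= 1 by apply/andP; split; lra.
rewrite [leRHS]mulrC.
apply: (wle (wsumsB (pgf_cvg tI) (pgf_cvg xI)) (wsumsZ (t - x) (dmean_cvg i01))) => k.
rewrite expr1n mul1r subrXX ler_wpM2l ?subr_ge0//.
rewrite -[k in leRHS]card_ord -sumr_const; apply: ler_sum => i _.
by rewrite mulr_ile1 ?exprn_ge0 ?exprn_ile1//; lra.
Qed.

Lemma pgf_tangent1 t : 0 <= t <= 1 -> dmean t * (1 - t) <= t * (pgf 1 - pgf t).
Proof.
move=> tI; have /andP[t0 t1] := tI; rewrite mulrC.
apply: (wle (wsumsZ (1 - t) (dmean_cvg tI))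
  (wsumsZ t (wsumsB (pgf_cvg i01) (pgf_cvg tI)))) => k.
rewrite expr1n; case: k => [|k]; first by rewrite expr0 subrr !mulr0.
have := ler_wpM2l t0 (onem_expr_ge k tI); rewrite -natr1 exprS.
by move: (t ^+ k) => p; lra.
Qed.

(** The k-th term of t (f'(1) - f'(t)) is at most w_k t (1 - t) k (k - 1). The term k = 1 vanishes,
    so the tail second moment suffices. *)
Lemma dmean_damp t : 0 <= t <= 1 ->
  t * dmean 1 - dmean t <= t * (1 - t) * tail2.
Proof.
move=> tI; have /andP[t0 t1] := tI.
apply: (wle (wsumsB (wsumsZ t (dmean_cvg i01)) (dmean_cvg tI))
  (wsumsZ (t * (1 - t)) tail2_cvg)) => k.
rewrite expr1n mul1r.
case: k => [|[|k]]; rewrite ?mulr0 ?mul0r ?subr0 ?mulr0 ?expr1 ?subrr ?mulr0//.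
rewrite mul1r -[(t * (1 - t) * _)]mulrA exprS -mulrA -mulrBr ler_wpM2l//.
have := @onem_expr_le _ t k.+1 tI.
have n0 : 0 <= k.+1%:R :> R by [].
have tk : 0 <= (1 - t) * k.+1%:R by rewrite mulr_ge0// subr_ge0.
rewrite -[k.+2%:R]natr1; move: tk n0; move: (k.+1%:R) (t ^+ k.+1) => n p; nra.
Qed.

Lemma dtail1_damp t : 0 <= t <= 1 -> dtail1 1 - dtail1 t <= (1 - t) * tail2.
Proof.
move=> tI; have /andP[t0 t1] := tI.
apply: (wle (wsumsB (dtail1_cvg i01) (dtail1_cvg tI)) (wsumsZ (1 - t) tail2_cvg)) => k.
rewrite expr1n; case: (1 < k)%N; last by rewrite !(mul0r, mulr0, subrr).
rewrite !mul1r /=.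
have := @onem_expr_le _ t k tI; have : 0 <= k%:R :> R by [].
by move: (k%:R) (t ^+ k) => n p; nra.
Qed.

Lemma w1_le_pgf : w 1%N <= pgf 1.
Proof.
rewrite -[w 1%N]mulr1; apply: (wle (wsums_pick w 1 1%N) (pgf_cvg i01)) => k.
by rewrite expr1n mul1r lern1 leq_b1.
Qed.

Lemma pgf_sub_le_dpos x t : 0 <= x -> x <= t -> t <= 1 ->
  pgf t - pgf x <= dpos t.
Proof.
move=> x0 xt t1.
have xI : 0 <= x <= 1 by apply/andP; split; lra.
have tI : 0 <= t <= 1 by apply/andP; split; lra.
apply: (wle (wsumsB (pgf_cvg tI) (pgf_cvg xI)) (dpos_cvg tI)) => k.
case: k => [|k]; first by rewrite !expr0 subrr mulr0.
by rewrite mulr1 gerBl exprn_ge0.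
Qed.

End Environment.

(** * The shape function of one environment *)

Section Convexity.
Variables (R : realType) (w : nat -> R).
Hypothesis w_ge0 : forall k, 0 <= w k.
Hypothesis w_sq : wcvg w (fun k => (k%:R + 1) ^+ 2).
Hypothesis w_mean : 0 < dmean w 1.

Let damp_ge0 a : 0 <= a -> forall k, 0 <= w k * a ^+ k.
Proof. by move=> a0 k; rewrite mulr_ge0// exprn_ge0. Qed.

Let damp_sq a : 0 <= a <= 1 ->
  wcvg (fun k => w k * a ^+ k) (fun k => (k%:R + 1) ^+ 2).
Proof.
move=> aI; apply: wcvg_damp; apply: wcvg_damped => // k.
by rewrite lexx andbT sqr_ge0.
Qed.

(** This identity carries both size-bias inequalities, applied to the damped weight at the point x /
    a, back to increments of the generating function below a. *)
Lemma wsum_damp_onemX a x : 0 < a <= 1 -> 0 <= x <= a ->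
  wsum (fun k => w k * a ^+ k) (fun k => 1 - (x / a) ^+ k) = pgf w a - pgf w x.
Proof.
move=> /andP[a0 a1] /andP[x0 xa]; rewrite wsum_damp.
have aI : 0 <= a <= 1 by rewrite ltW.
have xI : 0 <= x <= 1 by rewrite x0 (le_trans xa).
apply: wsumsE; have := wsumsB (pgf_cvg w_ge0 w_sq aI) (pgf_cvg w_ge0 w_sq xI).
rewrite /wsums (_ : (fun k => w k * (a ^+ k - x ^+ k)) =
  fun k => w k * (a ^+ k * (1 - (x / a) ^+ k)))//.
apply/funext => k; congr (_ * _); rewrite expr_div_n mulrBr mulr1.
by rewrite mulrCA divff ?mulr1// expf_neq0// gt_eqF.
Qed.

Lemma wsum_fact2_le a : 0 <= a <= 1 ->
  wsum (fun k => w k * a ^+ k) (fun k => k%:R * (k%:R - 1)) <= tail2 w.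
Proof.
move=> aI; have /andP[a0 a1] := aI; rewrite wsum_damp.
have cf := wcvg_fact2 (damp_ge0 a0) (damp_sq aI).
have cf' : wsums w (fun k => a ^+ k * (k%:R * (k%:R - 1)))
    (wsum w (fun k => a ^+ k * (k%:R * (k%:R - 1)))).
  move: cf; rewrite /wcvg /wsums /wsum.
  by under eq_fun do rewrite -mulrA.
apply: (wsums_le w_ge0 cf' (tail2_cvg w_ge0 w_sq)) => k.
case: k => [|[|k]]; rewrite ?mul0r ?mulr0 ?subrr ?mulr0//.
have : 0 <= a ^+ k.+2 <= 1 by rewrite exprn_ge0//= exprn_ile1.
have : 1 <= k.+2%:R :> R by rewrite ler1n.
by rewrite /= mul1r; move: (a ^+ _) k.+2%:R => p n n1 /andP[p0 p1]; nra.
Qed.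

Lemma pgf_second_moment_bound a s : 0 <= s -> s < a -> a <= 1 ->
  dmean w a ^+ 2 * (a - s) <=
  (pgf w a - pgf w s) * (a * dmean w a + (a - s) * tail2 w).
Proof.
move=> s0 sa a1; have a0 : 0 < a by exact: le_lt_trans sa.
have aI : 0 <= a <= 1 by rewrite ltW.
have aI' : 0 < a <= 1 by rewrite a0.
have sI : 0 <= s <= a by rewrite s0 ltW.
have x01 : 0 <= s / a < 1 by rewrite divr_ge0 ?(ltW a0)//= ltr_pdivrMr// mul1r.
have D0 : 0 < pgf w a - pgf w s by rewrite subr_gt0 pgf_lt.
have := sizebias_upper (damp_ge0 (ltW a0)) (damp_sq aI) x01.
rewrite wsum_damp_onemX// wsum_damp -/(dmean w a) => /(_ D0).
have := wsum_fact2_le aI; set G := wsum _ _ => G2 H.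
have x1 : 0 <= 1 - s / a by rewrite subr_ge0 ltW//; case/andP: x01.
have H2 : dmean w a ^+ 2 * (1 - s / a) <=
    (pgf w a - pgf w s) * (dmean w a + (1 - s / a) * tail2 w).
  by apply: (le_trans H); rewrite ler_wpM2l ?(ltW D0)// lerD2l// ler_wpM2l.
have := ler_wpM2l (ltW a0) H2.
have -> : a * (dmean w a ^+ 2 * (1 - s / a)) = dmean w a ^+ 2 * (a - s).
  by field; rewrite gt_eqF.
congr (_ <= _); field; by rewrite gt_eqF.
Qed.

Lemma pgf_convexity_gap a b : 0 <= b -> b <= a -> 0 < a -> a <= 1 ->
  0 < dpos w a ->
  (pgf w a - pgf w b) * (a - b) * (dmean w a - dpos w a) <=
  2 * dpos w a * (dmean w a * (a - b) - a * (pgf w a - pgf w b)).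
Proof.
move=> b0 ba a0 a1 P0.
have aI : 0 <= a <= 1 by rewrite ltW.
have aI' : 0 < a <= 1 by rewrite a0.
have bI : 0 <= b <= a by rewrite b0.
have x01 : 0 <= b / a <= 1 by rewrite divr_ge0 ?(ltW a0)//= ler_pdivrMr// mul1r.
have := sizebias_lower (damp_ge0 (ltW a0)) (damp_sq aI) x01.
rewrite wsum_damp_onemX// !wsum_damp -/(dmean w a) -/(dpos w a) => /(_ P0) H.
have := ler_wpM2l (ltW a0) H.
set D := pgf w a - pgf w b; set m := dmean w a; set p := dpos w a.
have -> : a * (D * (1 - b / a) * (m - p)) = D * (a - b) * (m - p).
  by field; rewrite gt_eqF.
congr (_ <= _); field; by rewrite gt_eqF.
Qed.

Lemma dmean_gt0 a : 0 < a <= 1 -> 0 < dmean w a.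
Proof.
move=> /andP[a0 a1]; have := @pgf_lt _ _ w_ge0 w_sq 0 a w_mean (lexx _) a0 a1.
rewrite -subr_gt0 => h.
have := pgf_tangent w_ge0 w_sq (lexx _) (ltW a0) a1.
rewrite subr0 [leRHS]mulrC ler_pM2l//; exact: lt_le_trans.
Qed.

Lemma dpos_gt0 a : 0 < a <= 1 -> 0 < dpos w a.
Proof.
move=> /andP[a0 a1]; have := @pgf_lt _ _ w_ge0 w_sq 0 a w_mean (lexx _) a0 a1.
rewrite -subr_gt0 => /lt_le_trans; apply.
exact: (pgf_sub_le_dpos w_ge0 w_sq (lexx _) (ltW a0) a1).
Qed.

Variable c : R.
Hypothesis c_gt0 : 0 < c.
(** The moment condition cleared of its denominator: the conditional mean is
    [dmean w 1 / dpos w 1]. *)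
Hypothesis w_tail : tail2 w * dpos w 1 <= c * dtail1 w 1 * dmean w 1.

Let i01 : 0 <= (1 : R) <= 1. Proof. by rewrite ler01 lexx. Qed.

Lemma dtail1_le_dmean a : 0 <= a <= 1 -> dtail1 w a <= dmean w a.
Proof.
by move=> aI; rewrite (dmean_split w_ge0 w_sq aI) lerDr mulr_ge0//; case/andP: aI.
Qed.

(** The second moment bound at the base point 1 and the moment condition give (1 - a) m <= h P + c h
    (1 - a) m, with m the mean and P the positive mass; since c h <= 1/2 the last term is
    absorbed. *)
Lemma defect_small a h : 0 <= a <= 1 -> 0 <= h -> 2 * (c * h) <= 1 ->
  pgf w 1 - pgf w a <= h * dpos w 1 -> (1 - a) * dmean w 1 <= 2 * h * dpos w 1.
Proof.
move=> /andP[a0]; rewrite le_eqVlt => /orP[/eqP ->|a1] h0 ch Dh.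
  by rewrite subrr mul0r !mulr_ge0// ltW// dpos_gt0// ltr01 lexx.
have P0 : 0 < dpos w 1 by apply: dpos_gt0; rewrite ltr01 lexx.
have H := pgf_second_moment_bound a0 a1 (lexx 1).
have D0 : 0 < pgf w 1 - pgf w a by rewrite subr_gt0 pgf_lt.
have a1' : 0 < 1 - a by rewrite subr_gt0.
have al := dtail1_le_dmean i01.
have H1 : (pgf w 1 - pgf w a) * (dpos w 1 * dmean w 1 + (1 - a) * (tail2 w * dpos w 1))
    <= h * dpos w 1 * (dpos w 1 * dmean w 1 + (1 - a) * (c * dmean w 1 * dmean w 1)).
  apply: ler_pM => //; first exact: ltW.
    rewrite addr_ge0 ?mulr_ge0 ?(ltW P0) ?(ltW w_mean) ?(ltW a1')//.
    apply: (wsums_ge0 w_ge0 (tail2_cvg w_ge0 w_sq)) => k; by rewrite mulr_ge0 ?sqr_ge0.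
  rewrite lerD2l// ler_wpM2l ?(ltW a1')//; apply: (le_trans w_tail).
  by rewrite ler_wpM2r ?(ltW w_mean)// ler_wpM2l// ltW.
have H2 : dpos w 1 * (dmean w 1 ^+ 2 * (1 - a)) <=
   h * dpos w 1 * (dpos w 1 * dmean w 1 + (1 - a) * (c * dmean w 1 * dmean w 1)).
  apply: le_trans H1; have := ler_wpM2l (ltW P0) H; congr (_ <= _); ring.
have m0 := w_mean; set m := dmean w 1 in m0 H1 H2 *; set P := dpos w 1 in P0 H1 H2 *.
have H3 : (1 - a) * m <= h * P + c * h * ((1 - a) * m).
  rewrite -(ler_pM2l (mulr_gt0 P0 m0)).
  apply: le_trans (le_trans H2 _); last by rewrite le_eqVlt; apply/orP; left; apply/eqP; ring.
  by rewrite le_eqVlt; apply/orP; left; apply/eqP; ring.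
have : 2 * (c * h) * ((1 - a) * m) <= 1 * ((1 - a) * m).
  by rewrite ler_wpM2r// mulr_ge0// ltW.
lra.
Qed.

(** Damping lowers the tail mean by at most (1 - a) [tail2 w], which the moment condition bounds by
    c e times the tail mean itself. *)
Lemma dtail1_half a e : 0 <= a <= 1 -> 2 * (c * e) <= 1 ->
  (1 - a) * dmean w 1 <= e * dpos w 1 -> dtail1 w 1 <= 2 * dtail1 w a.
Proof.
move=> aI ce He; have /andP[a0 a1] := aI.
have P0 : 0 < dpos w 1 by apply: dpos_gt0; rewrite ltr01 lexx.
have H := dtail1_damp w_ge0 w_sq aI.
have al0 := dtail1_ge0 w_ge0 w_sq i01.
have H1 : (1 - a) * (tail2 w * dpos w 1) <= (1 - a) * (c * dtail1 w 1 * dmean w 1).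
  by rewrite ler_wpM2l// subr_ge0.
have H2 : c * dtail1 w 1 * ((1 - a) * dmean w 1) <= c * dtail1 w 1 * (e * dpos w 1).
  by rewrite ler_wpM2l// mulr_ge0// ltW.
have H3 : 2 * (c * e) * (dtail1 w 1 * dpos w 1) <= 1 * (dtail1 w 1 * dpos w 1).
  by rewrite ler_wpM2r// mulr_ge0// ltW.
have H4 : dpos w 1 * (dtail1 w 1 - dtail1 w a) <= dpos w 1 * ((1 - a) * tail2 w).
  by rewrite ler_wpM2l// ltW.
rewrite -(ler_pM2l P0); lra.
Qed.

Lemma dmean_half a : 1 <= 2 * a -> a <= 1 -> dtail1 w 1 <= 2 * dtail1 w a ->
  dmean w 1 <= 2 * dmean w a.
Proof.
move=> a2 a1 Hal; have aI : 0 <= a <= 1 by apply/andP; split; lra.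
rewrite !(dmean_split w_ge0 w_sq)//; move: (w_ge0 1) => w1; nra.
Qed.

(** The left side is the shape function at the base point a, as [dmean w a / a] is f'(a). The bound
    is [pgf_second_moment_bound] after division and is free of s. *)
Lemma shape_upper a s : 0 <= s -> s < a -> a <= 1 ->
  (pgf w a - pgf w s)^-1 - (dmean w a / a * (a - s))^-1 <=
  tail2 w / dmean w a ^+ 2.
Proof.
move=> s0 sa a1; have a0 : 0 < a by exact: le_lt_trans sa.
have D0 : 0 < pgf w a - pgf w s by rewrite subr_gt0 pgf_lt.
have G0 : 0 < dmean w a by apply: dmean_gt0; rewrite a0.
have d0 : 0 < a - s by rewrite subr_gt0.
have := pgf_second_moment_bound s0 sa a1.
set D := pgf w a - pgf w s in D0 *; set G := dmean w a in G0 *.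
set B := tail2 w; set d := a - s in d0 * => H.
have -> : D^-1 - (G / a * d)^-1 = (G ^+ 2 * d - D * (a * G)) / (D * d) / G ^+ 2.
  by field; rewrite !gt_eqF.
rewrite ler_pM2r ?invr_gt0 ?exprn_gt0//.
by rewrite ler_pdivrMr ?mulr_gt0//; lra.
Qed.

Lemma shape_lower a b : 0 <= b -> b < a -> a <= 1 ->
  (dmean w a - dpos w a) / (2 * dpos w a * dmean w a) <=
  (pgf w a - pgf w b)^-1 - (dmean w a / a * (a - b))^-1.
Proof.
move=> b0 ba a1; have a0 : 0 < a by exact: le_lt_trans ba.
have D0 : 0 < pgf w a - pgf w b by rewrite subr_gt0 pgf_lt.
have G0 : 0 < dmean w a by apply: dmean_gt0; rewrite a0.
have P0 : 0 < dpos w a by apply: dpos_gt0; rewrite a0.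
have d0 : 0 < a - b by rewrite subr_gt0.
have := pgf_convexity_gap b0 (ltW ba) a0 a1 P0.
set D := pgf w a - pgf w b in D0 *; set G := dmean w a in G0 *.
set P := dpos w a in P0 *; set d := a - b in d0 * => H.
have -> : D^-1 - (G / a * d)^-1 =
    (2 * P * (G * d - a * D)) / (D * d) / (2 * P * G).
  by field; rewrite !gt_eqF.
rewrite ler_pM2r ?invr_gt0 ?mulr_gt0//.
by rewrite ler_pdivlMr ?mulr_gt0//; lra.
Qed.

Lemma shape_lower_tail a b : 0 <= b -> b < a -> a <= 1 ->
  dtail1 w a / (4 * dpos w a * dmean w a) <=
  (pgf w a - pgf w b)^-1 - (dmean w a / a * (a - b))^-1.
Proof.
move=> b0 ba a1; have a0 : 0 < a by exact: le_lt_trans ba.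
apply: le_trans (shape_lower b0 ba a1).
have G0 : 0 < dmean w a by apply: dmean_gt0; rewrite a0.
have P0 : 0 < dpos w a by apply: dpos_gt0; rewrite a0.
have aI : 0 <= a <= 1 by rewrite ltW.
have := dmean_le_dpos w_ge0 w_sq aI.
set G := dmean w a in G0 *; set P := dpos w a in P0 * => H.
have -> : dtail1 w a / (4 * P * G) = dtail1 w a / 2 / (2 * P * G).
  by field; rewrite !gt_eqF.
by rewrite ler_pM2r ?invr_gt0 ?mulr_gt0//; lra.
Qed.

(** * Base points close to 1 *)

Section Undamped.
Variable a : R.
Hypotheses (a2 : 1 <= 2 * a) (a1 : a <= 1).
Hypothesis a_tail : dtail1 w 1 <= 2 * dtail1 w a.

Let a0 : 0 < a. Proof. by move: a2; lra. Qed.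
Let aI : 0 <= a <= 1. Proof. by rewrite ltW. Qed.
Let G0 : 0 < dmean w a. Proof. by apply: dmean_gt0; rewrite a0. Qed.
Let P0 : 0 < dpos w a. Proof. by apply: dpos_gt0; rewrite a0. Qed.
Let P1 : 0 < dpos w 1. Proof. by apply: dpos_gt0; rewrite ltr01 lexx. Qed.

Lemma tail2_le : tail2 w * dpos w 1 <= 4 * c * dtail1 w a * dmean w a.
Proof.
apply: (le_trans w_tail).
have h1 := dmean_half a2 a1 a_tail.
have h2 : c * dtail1 w 1 <= 2 * (c * dtail1 w a) by move: a_tail c_gt0; nra.
have al0 := dtail1_ge0 w_ge0 w_sq i01.
have : c * dtail1 w 1 * dmean w 1 <= 2 * (c * dtail1 w a) * (2 * dmean w a).
  by apply: ler_pM => //; rewrite ?mulr_ge0// ltW.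
lra.
Qed.

(** The upper bound does not involve s and the lower bound does not involve b, so no relation
    between s and b is required. The 16 is 4 from [tail2_le] times 4 from [shape_lower_tail]. *)
Lemma shape_ratio s b : 0 <= s -> s < a -> 0 <= b -> b < a ->
  (pgf w a - pgf w s)^-1 - (dmean w a / a * (a - s))^-1 <=
  16 * c * ((pgf w a - pgf w b)^-1 - (dmean w a / a * (a - b))^-1).
Proof.
move=> s0 sa b0 ba; apply: (le_trans (shape_upper s0 sa a1)).
have c16 : 0 <= 16 * c by rewrite mulr_ge0// ltW.
apply: le_trans (ler_wpM2l c16 (shape_lower_tail b0 ba a1)).
have h := tail2_le; have hP := dpos_le w_ge0 w_sq aI.
have t0 : 0 <= tail2 w.
  by apply: (wsums_ge0 w_ge0 (tail2_cvg w_ge0 w_sq)) => k; rewrite mulr_ge0 ?sqr_ge0.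
have h2 : tail2 w * dpos w a <= 4 * c * dtail1 w a * dmean w a.
  by apply: le_trans h; rewrite ler_wpM2l.
have G0' := G0; have P0' := P0.
set G := dmean w a in G0' h2 *; set P := dpos w a in P0' h2 *.
have -> : 16 * c * (dtail1 w a / (4 * P * G)) = 4 * c * dtail1 w a * G / P / G ^+ 2.
  by field; rewrite !gt_eqF.
by rewrite ler_pM2r ?invr_gt0 ?exprn_gt0// ler_pdivlMr.
Qed.

(** On orbits the bracket is at most a decrement of (1 - a) / (a - b), so these bounds telescope. It
    dominates (1 - a) f'(a) times the shape function at b, hence a multiple of (1 - a) times the
    tail mean, and the loss of slope from 1 to a is at most such a multiple. The 8 is 4 from
    [shape_lower_tail] times 2 from [a_tail]. *)
Lemma mean_ratio b : 0 <= b -> b < a ->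
  1 - dmean w a / a / dmean w 1 <=
  8 * c * ((pgf w 1 - pgf w a) / (pgf w a - pgf w b) - (1 - a) / (a - b)).
Proof.
move=> b0 ba.
have D0 : 0 < pgf w a - pgf w b by rewrite subr_gt0 pgf_lt.
have d0 : 0 < a - b by rewrite subr_gt0.
set g := dmean w a / a.
have g0 : 0 < g by rewrite divr_gt0.
have gG : dmean w a <= g by rewrite ler_pdivlMr// ler_piMr// ltW.
have t0 : 0 <= tail2 w.
  by apply: (wsums_ge0 w_ge0 (tail2_cvg w_ge0 w_sq)) => k; rewrite mulr_ge0 ?sqr_ge0.
have al0 := dtail1_ge0 w_ge0 w_sq i01.
have ala0 := dtail1_ge0 w_ge0 w_sq aI.
have oa : 0 <= 1 - a by rewrite subr_ge0.
have hP := dpos_le w_ge0 w_sq aI.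
have step1 : 1 - g / dmean w 1 <= (1 - a) * (c * dtail1 w 1 / dpos w 1).
  apply: (@le_trans _ _ ((1 - a) * (tail2 w / dmean w 1))).
    have -> : 1 - g / dmean w 1 = (a * dmean w 1 - dmean w a) / (a * dmean w 1).
      by rewrite /g; field; rewrite !gt_eqF.
    rewrite ler_pdivrMr ?mulr_gt0//.
    have := dmean_damp w_ge0 w_sq aI; congr (_ <= _).
    by field; rewrite gt_eqF.
  by rewrite ler_wpM2l// ler_pdivrMr// mulrAC ler_pdivlMr.
have step2 : (1 - a) * g * ((pgf w a - pgf w b)^-1 - (g * (a - b))^-1) <=
    (pgf w 1 - pgf w a) / (pgf w a - pgf w b) - (1 - a) / (a - b).
  rewrite mulrBr lerB//.
    rewrite ler_pM2r ?invr_gt0//.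
    by rewrite mulrC /g mulrAC ler_pdivrMr// [leRHS]mulrC; exact: pgf_tangent1.
  by rewrite le_eqVlt; apply/orP; left; apply/eqP; field; rewrite !gt_eqF.
have step3 : (1 - a) * dtail1 w a / (4 * dpos w 1) <=
    (1 - a) * g * ((pgf w a - pgf w b)^-1 - (g * (a - b))^-1).
  rewrite -[X in X <= _]mulrA -[X in _ <= X]mulrA ler_wpM2l//.
  apply: le_trans (ler_wpM2l (ltW g0) (shape_lower_tail b0 ba a1)).
  have -> : g * (dtail1 w a / (4 * dpos w a * dmean w a)) =
      (g / dmean w a) * (dtail1 w a / (4 * dpos w a)).
    by rewrite /g; field; rewrite !gt_eqF.
  apply: (@le_trans _ _ (1 * (dtail1 w a / (4 * dpos w a)))).
    rewrite mul1r ler_wpM2l// lef_pV2 ?posrE ?mulr_gt0//.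
    by rewrite ler_pM2l.
  rewrite ler_wpM2r ?divr_ge0// ?mulr_ge0// ?(ltW P0)//.
  by rewrite ler_pdivlMr// mul1r.
apply: (le_trans step1).
have c8 : 0 <= 8 * c by rewrite mulr_ge0// ltW.
apply: le_trans (ler_wpM2l c8 (le_trans step3 step2)).
have -> : 8 * c * ((1 - a) * dtail1 w a / (4 * dpos w 1)) =
  (1 - a) * (c * (2 * dtail1 w a) / dpos w 1) by field; rewrite gt_eqF.
by rewrite ler_wpM2l// ler_wpM2r ?invr_ge0 ?(ltW P1)// ler_wpM2l// ltW.
Qed.

(** With q = [dtail w a], the tail mean T satisfies T <= 8 c q (1 + T), and the smallness of q
    absorbs the T on the right. The slope exceeds [w 1] by T / a, at most 2 T. *)
Lemma mean_tail : w 1%N <= 1 -> 1 <= 2 * dpos w 1 -> 16 * c * dtail w a <= 1 ->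
  dmean w a / a <= 1 + 32 * c * dtail w a.
Proof.
move=> w1 p1 small; have /andP[_ _] := aI.
(* For this multiplier, and positive mass at least 1/2, the moment condition becomes
   [tail2 w <= l * dtail1 w a]; the tail second moment then cancels and leaves T <= l q. *)
pose l := 8 * c * dmean w a.
have l0 : 0 < l by rewrite !mulr_gt0.
have ala0 := dtail1_ge0 w_ge0 w_sq aI; have q0 := dtail_ge0 w_ge0 w_sq aI.
have t0 : 0 <= tail2 w.
  by apply: (wsums_ge0 w_ge0 (tail2_cvg w_ge0 w_sq)) => k; rewrite mulr_ge0 ?sqr_ge0.
(* 2 l k <= k^2 + l^2 on k >= 2, with the weight a^k dropped in front of k^2 *)
have H1 : 2 * l * dtail1 w a <= tail2 w + l ^+ 2 * dtail w a.
  apply: (wsums_le w_ge0 (wsumsZ (2 * l) (dtail1_cvg w_ge0 w_sq aI))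
    (wsumsD (tail2_cvg w_ge0 w_sq) (wsumsZ (l ^+ 2) (dtail_cvg w_ge0 w_sq aI)))) => k.
  case: (1 < k)%N; last by rewrite !(mul0r, mulr0) addr0.
  rewrite /= mulr1 !mul1r.
  have : 0 <= a ^+ k <= 1 by rewrite exprn_ge0 ?(ltW a0)//= exprn_ile1// ltW.
  move: (a ^+ k) k%:R => x n /andP[x0 x1].
  have : 0 <= x * (n - l) ^+ 2 by rewrite mulr_ge0 ?sqr_ge0.
  have : 0 <= (1 - x) * n ^+ 2 by rewrite mulr_ge0 ?sqr_ge0// subr_ge0.
  lra.
have H2 : tail2 w <= l * dtail1 w a.
  have h := tail2_le; have h3 : tail2 w * 1 <= tail2 w * (2 * dpos w 1) by rewrite ler_wpM2l.
  rewrite /l; lra.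
have H3 : dtail1 w a <= l * dtail w a.
  by rewrite -(ler_pM2l l0); lra.
have Gs := dmean_split w_ge0 w_sq aI.
have H4 : dmean w a <= 1 + dtail1 w a.
  rewrite Gs lerD2r; move: (w_ge0 1) w1 a0 a1; nra.
have H5 : dtail1 w a <= 8 * c * dtail w a * (1 + dtail1 w a).
  apply: (le_trans H3); rewrite /l; have : 0 <= 8 * c * dtail w a by rewrite !mulr_ge0// ltW.
  by move=> h; have := ler_wpM2l h H4; lra.
have H6 : dtail1 w a <= 16 * c * dtail w a.
  have := ler_wpM2r ala0 small; lra.
rewrite ler_pdivrMr// Gs.
have : a * w 1%N <= a by rewrite ler_piMr// ltW.
have : 0 <= 16 * c * dtail w a by rewrite !mulr_ge0// ltW.
move: a2; set x := 16 * c * dtail w a in H6 *; move=> ? ?.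
have -> : 32 * c * dtail w a = 2 * x by rewrite /x; ring.
nra.
Qed.

End Undamped.
End Convexity.

(** * Backward orbits of generating functions *)

Section RealSequences.
Variable R : realType.
Implicit Types u v t : nat -> R.

Lemma near_inftyP (Q : nat -> Prop) : (\forall n \near \oo, Q n) ->
  exists N, forall n, (N <= n)%N -> Q n.
Proof. by case=> N _ h; exists N => n Nn; apply: h. Qed.

Lemma homo_from (u : nat -> R) N : (forall n, (N <= n)%N -> u n <= u n.+1) ->
  forall m n, (N <= m <= n)%N -> u m <= u n.
Proof.
move=> h m n /andP[Nm]; elim: n => [|n IH]; first by rewrite leqn0 => /eqP ->.
rewrite leq_eqVlt => /predU1P[->//|]; rewrite ltnS => mn.
by apply: (le_trans (IH mn)); apply: h; exact: leq_trans mn.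
Qed.

Lemma nondecreasing_bounded_cvg_gt0 u (K : R) : 0 < u 0 -> nondecreasing_seq u ->
  (forall n, u n <= K) -> exists2 l : R, u 0 <= l & u @ \oo --> l.
Proof.
move=> u0 ndu uK; have cu : cvgn u.
  by apply: nondecreasing_is_cvgn => //; exists K => _ [n _ <-].
by exists (limn u) => //; exact: nondecreasing_cvgn_le.
Qed.

Lemma ln_onem_bounds (x : R) : 0 <= x -> x < 1 -> x <= - ln (1 - x) <= x / (1 - x).
Proof.
move=> x0 x1; have y0 : 0 < 1 - x by rewrite subr_gt0.
apply/andP; split.
  by rewrite lerNr; apply: (@le_ln1Dx _ (- x)); rewrite ltrN2.
rewrite -lnV ?posrE//.
rewrite [X in ln X](_ : _ = 1 + x / (1 - x)); last by field; rewrite gt_eqF.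
by apply: le_ln1Dx; apply: (@lt_le_trans _ _ 0); rewrite ?ltrN10 ?divr_ge0// ltW.
Qed.

(** If dl = 0 the factor v may be unbounded, and the equivalence of - ln (1 - t) with t is used; if
    dl > 0 then v itself converges, to x / dl. *)
Lemma ln_onem_scaled_cvg v t (dl x : R) : (forall n, 0 <= v n) ->
  (forall n, 0 < t n < 1) -> 0 <= dl < 1 -> t @ \oo --> dl ->
  0 < x -> (fun n => v n * t n) @ \oo --> x ->
  exists2 th : R, 0 < th & (fun n => v n * - ln (1 - t n)) @ \oo --> th.
Proof.
move=> v0 t01 /andP[dl0 dl1] tdl x0 vt.
have tn0 n : t n != 0 by have /andP[/gt_eqF->] := t01 n.
have c1t : (fun n => 1 - t n) @ \oo --> 1 - dl by apply: cvgB => //; exact: cvg_cst.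
move: dl0; rewrite le_eqVlt => /predU1P[dl0|dl0].
  exists x => //.
  have c2 : (fun n => v n * t n / (1 - t n)) @ \oo --> x.
    rewrite -[x in _ --> x]divr1; apply: cvgM => //; apply: cvgV => //.
    by move: c1t; rewrite -dl0 subr0.
  apply: (squeeze_cvgr _ vt c2); apply: nearW => n.
  have /andP[tn tn1] := t01 n.
  have /andP[h1 h2] := ln_onem_bounds (ltW tn) tn1.
  by rewrite ler_wpM2l// -mulrA ler_wpM2l.
exists (x / dl * - ln (1 - dl)).
  rewrite mulr_gt0 ?divr_gt0// oppr_gt0; apply: ln_lt0; lra.
rewrite (_ : (fun _ => _) = fun n => v n * t n / t n * - ln (1 - t n)); last first.
  by apply/funext => n; rewrite mulfK.
apply: cvgM; first by apply: cvgM => //; apply: cvgV => //; rewrite gt_eqF.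
apply: cvgN; apply: (cvg_comp _ _ c1t); apply: continuous_ln.
by rewrite subr_gt0.
Qed.

End RealSequences.

(** * The rate of an intermediate orbit *)

Section Orbits.
Variables (R : realType) (f : nat -> nat -> R) (c : R).
Hypothesis f_ge0 : forall n k, 0 <= f n.+1 k.
Hypothesis f_sq : forall n, wcvg (f n.+1) (fun k => (k%:R + 1) ^+ 2).
Hypothesis f_mean : forall n, 0 < dmean (f n.+1) 1.
Hypothesis f_mass : forall n, pgf (f n.+1) 1 <= 1.
Hypothesis c_gt0 : 0 < c.
Hypothesis f_tail : forall n,
  tail2 (f n.+1) * dpos (f n.+1) 1 <= c * dtail1 (f n.+1) 1 * dmean (f n.+1) 1.

Variables a b s : nat -> R.
Hypothesis b_ge0 : forall n, 0 <= b n.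
Hypothesis bs : forall n, b n < s n.
Hypothesis sa : forall n, s n < a n.
Hypothesis a_le1 : forall n, a n <= 1.
Hypothesis a_orbit : forall n, pgf (f n.+1) (a n.+1) = a n.
Hypothesis b_orbit : forall n, pgf (f n.+1) (b n.+1) = b n.
Hypothesis s_orbit : forall n, pgf (f n.+1) (s n.+1) = s n.

Variables (z : nat -> nat) (M : R).
Hypothesis z_gt0 : forall n, (0 < z n)%N.
Hypothesis M_gt0 : 0 < M.
Hypothesis a_z : (fun n => a n ^+ z n) @ \oo --> (1 : R).
Hypothesis b_z : (fun n => b n ^+ z n) @ \oo --> (0 : R).
Hypothesis s_z : (fun n => s n ^+ z n) @ \oo --> M.

Let ba n : b n < a n. Proof. exact: lt_trans (bs n) (sa n). Qed.
Let a_gt0 n : 0 < a n. Proof. exact: le_lt_trans (b_ge0 n) (ba n). Qed.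
Let aI n : 0 <= a n <= 1. Proof. by rewrite ltW ?a_le1. Qed.
Let s_ge0 n : 0 <= s n. Proof. by apply/ltW; exact: le_lt_trans (bs n). Qed.
Let bI n : 0 <= b n <= 1.
Proof. by rewrite b_ge0 (le_trans (ltW (ba n))). Qed.
Let sI n : 0 <= s n <= 1.
Proof. by rewrite s_ge0 (le_trans (ltW (sa n))). Qed.

(** In the notation of the overview x is [nu n * d n], y is [nu n * e n], and y / x is [rho n];
    [g n] is the derivative of the next generating function at [a n.+1]. *)
Let d n := a n - s n.
Let e n := a n - b n.
Let rho n := e n / d n.
Let eta n := (1 - a n) / e n.
Let g n := dmean (f n.+1) (a n.+1) / a n.+1.
Let m n := dmean (f n.+1) 1.
Let nu n := \prod_(i < n) g i.
Let mean n := \prod_(i < n) m i.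

Let d_gt0 n : 0 < d n. Proof. by rewrite subr_gt0. Qed.
Let e_gt0 n : 0 < e n. Proof. by rewrite subr_gt0. Qed.
Let ed n : d n < e n. Proof. by rewrite /d /e; move: (bs n); lra. Qed.
Let rho_gt0 n : 0 < rho n. Proof. exact: divr_gt0. Qed.
Let g_gt0 n : 0 < g n.
Proof. by apply: divr_gt0 => //; apply: dmean_gt0 => //; rewrite a_gt0 a_le1. Qed.
Let nu_gt0 n : 0 < nu n. Proof. by apply: prodr_gt0. Qed.
Let mean_gt0 n : 0 < mean n. Proof. by apply: prodr_gt0 => i _; exact: f_mean. Qed.
Let nuS n : nu n.+1 = nu n * g n. Proof. by rewrite /nu big_ord_recr. Qed.
Let meanS n : mean n.+1 = mean n * m n. Proof. by rewrite /mean big_ord_recr. Qed.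

Let rho_gt1 n : 1 < rho n.
Proof. by rewrite /rho ltr_pdivlMr// mul1r. Qed.

Let e_step n : e n * d n.+1 <= d n * e n.+1.
Proof.
rewrite /e /d -(a_orbit n) -(b_orbit n) -(s_orbit n).
by apply: pgf_chord => //; apply: ltW.
Qed.

Let rho_nd : nondecreasing_seq rho.
Proof.
apply/nondecreasing_seqP => n.
by rewrite /rho ler_pdivrMr// mulrAC ler_pdivlMr// [leRHS]mulrC.
Qed.

Let d_step n : d n <= g n * d n.+1.
Proof.
have := pgf_tangent (f_ge0 n) (@f_sq n) (s_ge0 n.+1) (ltW (sa n.+1)) (a_le1 n.+1).
rewrite a_orbit s_orbit -/(d n) -/(d n.+1) => h.
by rewrite /g mulrAC ler_pdivlMr// mulrC.
Qed.

Let x_nd : nondecreasing_seq (fun n => nu n * d n).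
Proof.
apply/nondecreasing_seqP => n.
by rewrite nuS -mulrA ler_pM2l.
Qed.

Lemma orbit_cvg1 : a @ \oo --> (1 : R).
Proof.
apply: (squeeze_cvgr _ a_z (@cvg_cst _ _ _ _ _)); apply: nearW => n.
rewrite a_le1 andbT -[leRHS]expr1 ler_wiXn2l//.
by case/andP: (aI n).
Qed.

(* The bounds z x^z (1 - x) <= 1 - x^z <= z (1 - x) compare z_n (1 - a_n) and
   z_n (1 - b_n) with the limits of a_n^z_n and b_n^z_n. *)
Let eta_small (h : R) : 0 < h -> \forall n \near \oo, eta n <= h.
Proof.
(* The cap at 1 keeps the power of [a n] above 1/2, and at the end it lets 1 - q be replaced by p -
   q at the cost of h' (1 - p) <= 1 - p. *)
move=> h0; pose h' := Num.min h 1.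
have h'0 : 0 < h' by rewrite lt_min h0 ltr01.
have h'h : h' <= h by rewrite ge_min lexx.
have h'1 : h' <= 1 by rewrite ge_min lexx orbT.
have h81 : 1 - h' / 8 < 1 by rewrite gtrBl divr_gt0.
have a1 : \forall n \near \oo, 1 - h' / 8 < a n ^+ z n by exact: (cvgr_gt _ a_z).
have b1 : \forall n \near \oo, b n ^+ z n < 1 / 2.
  by apply: (cvgr_lt _ b_z); rewrite divr_gt0.
near=> n.
have A : 1 - h' / 8 < a n ^+ z n by near: n.
have B : b n ^+ z n < 1 / 2 by near: n.
have ha := onem_expr_ge (z n) (aI n); have hb := onem_expr_le (z n) (bI n).
rewrite /eta ler_pdivrMr//; apply: (@le_trans _ _ (h' * e n)); last first.
  by rewrite ler_wpM2r// ltW.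
rewrite /e; set p := a n in A ha *; set q := b n in B hb *.
set zn : R := (z n)%:R in ha hb.
have zn1 : 1 <= zn by rewrite ler1n.
have p1 : 0 <= 1 - p by rewrite subr_ge0 a_le1.
have h1 : zn * (1 - p) <= h' / 4.
  have : 0 <= (p ^+ z n - 1 / 2) * (zn * (1 - p)).
    by rewrite mulr_ge0 ?mulr_ge0//; lra.
  lra.
have h2 : 1 / 2 <= zn * (1 - q) by lra.
have h3 : zn * (1 - p) <= h' / 2 * (zn * (1 - q)).
  by apply: (le_trans h1); have := ler_wpM2l (ltW h'0) h2; lra.
have h4 : 1 - p <= h' / 2 * (1 - q).
  by rewrite -(ler_pM2l (lt_le_trans ltr01 zn1)) mulrCA.
suff : (1 - p) * h' <= (1 - p) * 1 by move: h4; nra.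
by rewrite ler_wpM2l.
Unshelve. all: by end_near. Qed.

(** The mass lost between [a n.+1] and 1 is at most 1 - a_n, and e_n is at most the positive mass.
    So a small [eta n] is the hypothesis of [defect_small], whose conclusion feeds [dtail1_half]. *)
Let a_tail : exists N, forall n, (N <= n)%N ->
  1 <= 2 * a n.+1 /\ dtail1 (f n.+1) 1 <= 2 * dtail1 (f n.+1) (a n.+1).
Proof.
(* [dtail1_half] is applied with 2 h and requires 4 c h <= 1, which holds here with equality; the
   condition 2 c h <= 1 of [defect_small] follows. *)
pose h : R := 1 / (4 * c).
have h0 : 0 < h by rewrite divr_gt0 ?mulr_gt0.
have ch : c * h = 1 / 4 by rewrite /h; field; rewrite gt_eqF.
have [N1 HN1] := near_inftyP (eta_small h0).
have a2 : \forall n \near \oo, 1 / 2 < a n.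
  by apply: (cvgr_gt _ orbit_cvg1); lra.
have [N2 HN2] := near_inftyP a2.
exists (N1 + N2)%N => n Nn; split.
  by have := HN2 n.+1 ltac:(lia); lra.
apply: (@dtail1_half _ _ (f_ge0 n) (@f_sq n) (f_mean n) c c_gt0 (f_tail n) _ (2 * h)) => //.
  by rewrite (_ : 2 * _ = 4 * (c * h)); [rewrite ch; lra|ring].
apply: (@defect_small _ _ (f_ge0 n) (@f_sq n) (f_mean n) c c_gt0 (f_tail n)) => //.
- exact: ltW.
- by rewrite ch; lra.
- rewrite a_orbit; apply: (@le_trans _ _ (1 - a n)); first by rewrite lerB.
  have := HN1 n ltac:(lia); rewrite /eta ler_pdivrMr// => /le_trans; apply.
  rewrite ler_wpM2l ?(ltW h0)//.
  apply: (@le_trans _ _ (dpos (f n.+1) (a n.+1))); last exact: dpos_le.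
  rewrite /e -(a_orbit n) -(b_orbit n); apply: pgf_sub_le_dpos => //; exact: ltW.
Qed.

Let g_le_m n : g n <= m n.
Proof.
rewrite /g ler_pdivrMr// mulrC.
have i01 : 0 <= (1 : R) <= 1 by rewrite ler01 lexx.
apply: (wsums_le (f_ge0 n) (dmean_cvg (f_ge0 n) (@f_sq n) (aI n.+1))
  (wsumsZ (a n.+1) (dmean_cvg (f_ge0 n) (@f_sq n) i01))) => k.
rewrite expr1n mul1r; case: k => [|k]; first by rewrite !mulr0.
rewrite ler_wpM2r// exprS ler_piMr//; first exact: ltW.
by rewrite exprn_ile1// ltW.
Qed.

Let mean_nu_nd : nondecreasing_seq (fun n => mean n / nu n).
Proof.
apply/nondecreasing_seqP => n; rewrite meanS nuS.
rewrite invfM mulrACA ler_peMr//; first by rewrite divr_ge0 ?ltW.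
by rewrite ler_pdivlMr// mul1r.
Qed.

(** Each factor m / g is at most exp (16 c (eta_n - eta_(n+1))): [mean_ratio] supplies 8 c, doubled
    by m <= 2 g. So exp (16 c eta) mean / nu is eventually nonincreasing. *)
Lemma mean_nu_bounded : exists K, forall n, mean n / nu n <= K.
Proof.
have [N HN] := a_tail.
pose K := expR (16 * c * eta N) * (mean N / nu N).
have c16 : 0 <= 16 * c by rewrite mulr_ge0// ltW.
have eta0 n : 0 <= eta n by rewrite divr_ge0 ?subr_ge0// ltW.
(* The sign is reversed because [homo_from] concerns nondecreasing sequences. *)
pose u n := - (expR (16 * c * eta n) * (mean n / nu n)).
have hom : forall n, (N <= n)%N -> u n <= u n.+1.
  move=> n Nn; rewrite lerN2.
  have [a2 at2] := HN n Nn.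
  have hm := mean_ratio (f_ge0 n) (@f_sq n) (f_mean n) c_gt0 (f_tail n) a2 (a_le1 n.+1) at2
    (b_ge0 n.+1) (ba n.+1).
  have mg : m n <= 2 * g n.
    apply: (le_trans (dmean_half (f_ge0 n) (@f_sq n) a2 (a_le1 n.+1) at2)).
    rewrite ler_wpM2l// ler_pdivlMr// ler_piMr//; apply: ltW; apply: dmean_gt0 => //.
    by rewrite a_gt0 a_le1.
  rewrite a_orbit b_orbit -/(g n) -/(m n) -/(e n) -/(e n.+1) -/(eta n.+1) in hm.
  have hm2 : 1 - g n / m n <= 8 * c * (eta n - eta n.+1).
    apply: (le_trans hm); rewrite ler_wpM2l ?mulr_ge0 ?(ltW c_gt0)//.
    by rewrite lerB// ler_pM2r ?invr_gt0// lerB.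
  have hm3 : m n / g n <= expR (16 * c * (eta n - eta n.+1)).
    apply: le_trans (expR_ge1Dx _).
    rewrite ler_pdivrMr//.
    have m0 := f_mean n; rewrite -/(m n) in m0.
    have : (1 - g n / m n) * m n <= 8 * c * (eta n - eta n.+1) * m n.
      by rewrite ler_pM2r.
    rewrite mulrBl divfK ?gt_eqF// mul1r => h1.
    have dge : 0 <= 8 * c * (eta n - eta n.+1).
      apply: le_trans hm2; rewrite subr_ge0 ler_pdivrMr// mul1r.
      exact: g_le_m.
    have := ler_wpM2l dge mg; lra.
  have -> : expR (16 * c * eta n.+1) * (mean n.+1 / nu n.+1) =
      mean n / nu n * (m n / g n * expR (16 * c * eta n.+1)).
    by rewrite meanS nuS; field; rewrite !gt_eqF.
  rewrite [X in _ <= X]mulrC ler_pM2l ?divr_gt0//.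
  have -> : 16 * c * eta n = 16 * c * (eta n - eta n.+1) + 16 * c * eta n.+1 by ring.
  by rewrite expRD ler_pM2r// expR_gt0.
exists K => n; have [nN|Nn] := leqP n N.
  apply: (le_trans (mean_nu_nd nN)); rewrite /K ler_peMl//; last first.
    by apply: le_trans (expR_ge1Dx _); rewrite lerDl mulr_ge0.
  by rewrite divr_ge0 ?ltW.
have := homo_from hom (m := N) (n := n); rewrite leqnn (ltnW Nn) => /(_ isT).
rewrite lerN2; apply: le_trans; rewrite ler_peMl//; first by rewrite divr_ge0 ?ltW.
by apply: le_trans (expR_ge1Dx _); rewrite lerDl mulr_ge0.
Qed.

(** The positive limit M keeps z_n (1 - s_n) below 2 / M, hence z_n (1 - b_n) below 2 r / M. If b_n
    stayed above h, then b_n^z_n would be at least exp (- 2 r / (M h)), against its limit 0. *)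
Let b_small r : (forall n, rho n <= r) -> forall h, 0 < h ->
  \forall n \near \oo, b n < h.
Proof.
move=> rhoR h h0.
have r0 : 0 < r by apply: lt_le_trans (rhoR 0).
pose k := expR (- (r * (2 / M) / h)).
have k0 : 0 < k by exact: expR_gt0.
have s1 : \forall n \near \oo, M / 2 < s n ^+ z n.
  by apply: (cvgr_gt _ s_z); move: M_gt0; lra.
have b1 : \forall n \near \oo, b n ^+ z n < k by exact: (cvgr_lt _ b_z).
near=> n; rewrite ltNge; apply/negP => hb.
have S : M / 2 < s n ^+ z n by near: n.
have : b n ^+ z n < k by near: n.
apply/negP; rewrite -leNgt.
have bn0 : 0 < b n by exact: lt_le_trans hb.
have zs : (z n)%:R * (1 - s n) <= 2 / M.
  have := onem_expr_ge (z n) (sI n).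
  have zs0 : 0 <= (z n)%:R * (1 - s n).
    by rewrite mulr_ge0// subr_ge0; case/andP: (sI n).
  have := ler_wpM2r zs0 (ltW S).
  have sz0 : 0 <= s n ^+ z n by rewrite exprn_ge0.
  rewrite ler_pdivlMr//; lra.
have zb : (z n)%:R * (1 - b n) <= r * (2 / M).
  apply: (@le_trans _ _ (r * ((z n)%:R * (1 - s n)))); last by rewrite ler_wpM2l// ltW.
  rewrite mulrCA ler_wpM2l//.
  (* Moving the upper end from a to 1 can only lower (a - b) / (a - s), so [rho n] also bounds (1 -
     b) / (1 - s). *)
  have h1 : (1 - b n) * d n <= e n * (1 - s n).
    rewrite /d /e; have := a_le1 n; have := bs n; nra.
  apply: (@le_trans _ _ (rho n * (1 - s n))).
    by rewrite /rho mulrAC ler_pdivlMr.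
  rewrite ler_wpM2r//; rewrite subr_ge0; by case/andP: (sI n).
have bV : (b n)^-1 ^+ z n <= expR ((z n)%:R * ((1 - b n) / b n)).
  rewrite expRM_natl lerXn2r ?nnegrE ?invr_ge0 ?expR_ge0//.
  apply: le_trans (expR_ge1Dx _).
  by rewrite le_eqVlt; apply/orP; left; apply/eqP; field; rewrite gt_eqF.
rewrite exprVn in bV.
rewrite -lef_pV2 ?posrE ?exprn_gt0// (le_trans bV)// /k -expRN opprK ler_expR.
rewrite mulrA ler_pdivrMr//; apply: (le_trans zb).
rewrite mulrAC ler_pdivlMr// ler_wpM2l// mulr_ge0 ?divr_ge0// ?(ltW M_gt0)//.
exact: ltW.
Unshelve. all: by end_near. Qed.

Let e_cvg1 r : (forall n, rho n <= r) -> e @ \oo --> (1 : R).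
Proof.
move=> rhoR; rewrite (_ : (1 : R) = 1 - 0); last by rewrite subr0.
apply: cvgB; first exact: orbit_cvg1.
apply/cvgr0Pnorm_lt => h h0; have := b_small rhoR h0.
by apply: filterS => n; rewrite ger0_norm.
Qed.

(** By [shape_ratio], 1/x decreases at most 16 c times as much as 1/y, so T = 1/x - 16 c / y is
    nondecreasing. Its sign at k is that of [rho k - 16 * c], and 1/x >= T then stays away from
    0. *)
Let x_bounded_of_large_rho N k : (forall n, (N <= n)%N ->
    1 <= 2 * a n.+1 /\ dtail1 (f n.+1) 1 <= 2 * dtail1 (f n.+1) (a n.+1)) ->
  (N <= k)%N -> 16 * c < rho k -> exists K, forall n, nu n * d n <= K.
Proof.
move=> HN Nk rk.
pose T n := (nu n * d n)^-1 - 16 * c * (nu n * e n)^-1.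
have hom : forall n, (N <= n)%N -> T n <= T n.+1.
  move=> n Nn; have [a2 at2] := HN n Nn.
  have := shape_ratio (f_ge0 n) (@f_sq n) (f_mean n) c_gt0 (f_tail n) a2 (a_le1 n.+1) at2
    (s_ge0 n.+1) (sa n.+1) (b_ge0 n.+1) (ba n.+1).
  rewrite a_orbit b_orbit s_orbit -/(g n) -/(d n) -/(e n) -/(d n.+1) -/(e n.+1) => h.
  rewrite -subr_ge0 (_ : T n.+1 - T n = (nu n)^-1 *
      (16 * c * ((e n)^-1 - (g n * e n.+1)^-1) - ((d n)^-1 - (g n * d n.+1)^-1))).
    by rewrite mulr_ge0 ?invr_ge0 ?(ltW (nu_gt0 n))// subr_ge0.
  by rewrite /T nuS; field; rewrite !gt_eqF.
have Tk : 0 < T k.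
  have -> : T k = (rho k - 16 * c) / (nu k * e k).
    by rewrite /T /rho; field; rewrite !gt_eqF.
  by rewrite divr_gt0 ?mulr_gt0// subr_gt0.
exists (T k)^-1 => n; apply: (le_trans (x_nd (leq_maxl n k))).
have kM : (N <= k <= maxn n k)%N by rewrite Nk leq_maxr.
have := homo_from hom kM; set i := maxn n k => Ti.
rewrite -[leLHS]invrK lef_pV2 ?posrE ?invr_gt0 ?mulr_gt0//.
apply: (le_trans Ti); rewrite /T gerBl mulr_ge0 ?mulr_ge0 ?(ltW c_gt0)//.
by rewrite invr_ge0 mulr_ge0 ?ltW.
Qed.

(** Since d <= 1, it is enough to bound [nu]. Each factor g is at most the exponential of a multiple
    of an increment of [rho], and these increments have a bounded sum. *)
Let x_bounded_of_bounded_rho r : (forall n, rho n <= r) ->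
  exists K, forall n, nu n * d n <= K.
Proof.
move=> rhoR; have [N0 HN0] := a_tail.
have crho : cvgn rho.
  by apply: nondecreasing_is_cvgn => //; exists r => _ [n _ <-].
have cinc : (fun n => rho n.+1 - rho n) @ \oo --> (0 : R).
  rewrite (_ : (0 : R) = limn rho - limn rho); last by rewrite subrr.
  apply: cvgB => //.
  by rewrite (cvg_shiftS rho).
(* As s - b = e (1 - 1 / rho) with [rho] nondecreasing, s - b is at least kap / 2 once e > 1/2. K
   undoes this factor and another 1/2 coming from e. *)
pose kap := 1 - (rho 0)^-1.
have kap0 : 0 < kap by rewrite subr_gt0 invf_lt1.
pose K := 4 / kap; have K0 : 0 < K by rewrite divr_gt0.
have e2 : \forall n \near \oo, 1 / 2 < e n.
  by apply: (cvgr_gt _ (e_cvg1 rhoR)); lra.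
(* Below this threshold 16 c K times the increment is at most 1, the smallness that [mean_tail] asks
   of [dtail]. *)
have inc2 : \forall n \near \oo, rho n.+1 - rho n < 1 / (16 * c * K).
  by apply: (cvgr_lt _ cinc); rewrite divr_gt0// mulr_gt0// mulr_gt0.
have [N1 HN1] := near_inftyP e2; have [N2 HN2] := near_inftyP inc2.
pose N := (N0 + N1 + N2)%N.
have step n : (N <= n)%N -> g n <= expR (32 * c * K * (rho n.+1 - rho n)).
  move=> Nn; have [a2 at2] := HN0 n ltac:(lia).
  have en := HN1 n ltac:(lia); have en1 := HN1 n.+1 ltac:(lia).
  have incn := HN2 n ltac:(lia).
  have q0 := dtail_ge0 (f_ge0 n) (@f_sq n) (aI n.+1).
  have gap := pgf_chord_gap (f_ge0 n) (@f_sq n) (b_ge0 n.+1) (ltW (bs n.+1)) (ltW (sa n.+1)) (a_le1 n.+1).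
  rewrite a_orbit b_orbit s_orbit -/(d n) -/(e n) -/(d n.+1) -/(e n.+1) in gap.
  have sb : kap / 2 <= s n.+1 - b n.+1.
    have -> : s n.+1 - b n.+1 = e n.+1 * (1 - (rho n.+1)^-1).
      rewrite /rho invf_div mulrBr mulrCA divff ?gt_eqF// !mulr1 /e /d; ring.
    have : kap <= 1 - (rho n.+1)^-1 by rewrite lerB// lef_pV2 ?posrE// rho_nd.
    move: kap0 en1; nra.
  (* The convexity gap of f over b < s < a is an increment of [rho] up to the factor d_n d_(n+1), so
     it pays for the mass of k >= 2. *)
  have qK : dtail (f n.+1) (a n.+1) <= K * (rho n.+1 - rho n).
    have dd : d n * e n.+1 - e n * d n.+1 = (d n * (rho n.+1 - rho n)) * d n.+1.
      by rewrite /rho; field; rewrite !gt_eqF.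
    have h1 : dtail (f n.+1) (a n.+1) * (s n.+1 - b n.+1) * e n.+1 <= rho n.+1 - rho n.
      rewrite -(ler_pM2r (d_gt0 n.+1)); move: gap; rewrite dd -!mulrA => h.
      apply: (le_trans h).
      have : d n <= 1 by rewrite /d; have := a_le1 n; have := s_ge0 n; lra.
      have : 0 <= (rho n.+1 - rho n) * d n.+1.
        by rewrite mulr_ge0 ?subr_ge0 ?rho_nd// ltW.
      nra.
    have h2 : dtail (f n.+1) (a n.+1) * (kap / 4) <= rho n.+1 - rho n.
      apply: le_trans h1; rewrite -mulrA ler_wpM2l//.
      by move: sb en1 kap0; nra.
    by rewrite /K mulrAC ler_pdivlMr// mulrC; lra.
  have g1 : g n <= 1 + 32 * c * dtail (f n.+1) (a n.+1).
    apply: (mean_tail (f_ge0 n) (@f_sq n) (f_mean n) c_gt0 (f_tail n) a2 (a_le1 n.+1) at2).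
    - exact: le_trans (w1_le_pgf (f_ge0 n) (@f_sq n)) (f_mass n).
    - have : e n <= dpos (f n.+1) 1.
        apply: (@le_trans _ _ (dpos (f n.+1) (a n.+1))); last exact: dpos_le.
        rewrite /e -(a_orbit n) -(b_orbit n); apply: pgf_sub_le_dpos => //; exact: ltW.
      lra.
    - have c16 : 0 <= 16 * c by rewrite mulr_ge0// ltW.
      apply: (le_trans (ler_wpM2l c16 qK)).
      move: incn; rewrite ltr_pdivlMr; first by lra.
      by rewrite mulr_gt0// mulr_gt0.
  apply: (le_trans g1); apply: le_trans (expR_ge1Dx _); rewrite lerD2l.
  rewrite -[leRHS]mulrA; apply: ler_wpM2l qK.
  by rewrite mulr_ge0// ltW.
have c32 : 0 <= 32 * c * K by rewrite mulr_ge0 ?(ltW K0)// mulr_ge0// ltW.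
pose u n := - (nu n * expR (- (32 * c * K * rho n))).
have hom n : (N <= n)%N -> u n <= u n.+1.
  move=> Nn; rewrite lerN2 nuS -mulrA ler_pM2l//.
  have -> : - (32 * c * K * rho n) = 32 * c * K * (rho n.+1 - rho n) + - (32 * c * K * rho n.+1).
    by ring.
  by rewrite expRD ler_pM2r ?expR_gt0// step.
exists (nu N * expR (- (32 * c * K * rho N)) * expR (32 * c * K * r)) => n.
apply: (le_trans (x_nd (leq_maxl n N))).
have kM : (N <= N <= maxn n N)%N by rewrite leqnn leq_maxr.
have := homo_from hom kM; rewrite lerN2; set i := maxn n N => ui.
apply: (@le_trans _ _ (nu i)).
  rewrite ler_piMr ?(ltW (nu_gt0 _))// /d; have := a_le1 i; have := s_ge0 i; lra.
rewrite -ler_pdivrMr ?expR_gt0//; apply: le_trans ui.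
by rewrite ler_wpM2l ?(ltW (nu_gt0 _))// -expRN ler_expR lerN2 ler_wpM2l.
Qed.

Let x_bounded : exists K, forall n, nu n * d n <= K.
Proof.
have [N HN] := a_tail.
have [[k Nk rk]|small] := pselect (exists2 k, (N <= k)%N & 16 * c < rho k).
  exact: (x_bounded_of_large_rho HN Nk rk).
apply: (@x_bounded_of_bounded_rho (16 * c)) => n.
rewrite leNgt; apply/negP => rn; apply: small; exists (maxn n N).
  exact: leq_maxr.
by apply: (lt_le_trans rn); apply: rho_nd; exact: leq_maxl.
Qed.

(** A limit below 1 keeps the logarithm finite. Since d = e / rho, either [rho] is bounded and d
    tends to the inverse of a limit above 1, or [rho] is unbounded and d tends to 0. *)
Let d_cvg : exists2 dl : R, 0 <= dl < 1 & d @ \oo --> dl.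
Proof.
have [[r rhoR]|unb] := pselect (exists r, forall n, rho n <= r).
  have [l l0 rl] := nondecreasing_bounded_cvg_gt0 (rho_gt0 0) rho_nd rhoR.
  have l1 : 1 < l := lt_le_trans (rho_gt1 0) l0.
  have l00 : 0 < l by apply: lt_trans l1.
  exists l^-1; first by rewrite invr_ge0 ltW//= invf_lt1.
  rewrite -[l^-1]mul1r (_ : d = fun n => e n / rho n).
    by apply: cvgM; [exact: (e_cvg1 rhoR)|apply: cvgV => //; rewrite gt_eqF].
  by apply/funext => n; rewrite /rho; field; rewrite !gt_eqF.
exists 0; first by rewrite lexx ltr01.
apply/cvgr0Pnorm_le => h h0.
have [k rk] : exists k, h^-1 < rho k.
  apply: contrapT => nk; apply: unb; exists h^-1 => n.
  by rewrite leNgt; apply/negP => rn; apply: nk; exists n.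
exists k => // n /= kn; rewrite ger0_norm ?(ltW (d_gt0 n))//.
have h1 : h^-1 * d n <= e n.
  rewrite -ler_pdivlMr//; exact: le_trans (ltW rk) (rho_nd kn).
move: h1; rewrite ler_pdivrMl// => /le_trans; apply.
by rewrite ler_piMr ?(ltW h0)// /e; have := a_le1 n; have := b_ge0 n; lra.
Qed.

Theorem orbit_log_mean_cvg : exists2 th : R, 0 < th &
  (fun n => mean n * - ln (s n / a n)) @ \oo --> th.
Proof.
have [K HK] := x_bounded; have [K' HK'] := mean_nu_bounded.
have [x x0 cx] : exists2 l : R, nu 0 * d 0 <= l & (fun n => nu n * d n) @ \oo --> l.
  by apply: (nondecreasing_bounded_cvg_gt0 _ x_nd HK); rewrite mulr_gt0.
have [q q0 cq] : exists2 l : R, mean 0 / nu 0 <= l & (fun n => mean n / nu n) @ \oo --> l.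
  by apply: (nondecreasing_bounded_cvg_gt0 _ mean_nu_nd HK'); rewrite divr_gt0.
have {}x0 : 0 < x by apply: lt_le_trans x0; rewrite mulr_gt0.
have {}q0 : 0 < q by apply: lt_le_trans q0; rewrite divr_gt0.
have [dl dl01 cd] := d_cvg.
have ca := orbit_cvg1.
have -> : (fun n => mean n * - ln (s n / a n)) =
    (fun n => mean n * - ln (1 - d n / a n)).
  apply/funext => n; congr (_ * - ln _); rewrite /d; field; by rewrite gt_eqF.
apply: (@ln_onem_scaled_cvg R mean (fun n => d n / a n) dl (q * x)).
- by move=> n; exact: ltW.
- move=> n; rewrite divr_gt0//= ltr_pdivrMr// mul1r /d.
  by rewrite gtrBl; exact: le_lt_trans (bs n).
- by [].
- rewrite -[dl]divr1; apply: cvgM => //; exact: cvgV.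
- exact: mulr_gt0.
- have -> : (fun n => mean n * (d n / a n)) =
      (fun n => mean n / nu n * (nu n * d n) / a n).
    by apply/funext => n; field; rewrite !gt_eqF.
  rewrite -[q * x]divr1; apply: cvgM; first exact: cvgM.
  exact: cvgV.
Qed.

End Orbits.

(** * Independence *)

Section Independence.
Context (d : measure_display) (T : measurableType d) (R : realType).
Variables (P : probability T R) (X : nat -> nat -> {RV P >-> NDelta}).

Lemma measurable_preimage (Y : {RV P >-> NDelta}) (B : set NDelta) :
  measurable (Y @^-1` B).
Proof. by rewrite -[_ @^-1` _]setTI; apply: measurable_funP. Qed.
Hint Resolve measurable_preimage : core.

Definition cylinder (D : set (nat * nat)) : set (set T) :=
  [set A | exists (J : {fset nat * nat}) (B : nat * nat -> set NDelta),
    [set` J] `<=` D /\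
    A = \bigcap_(i in [set` J]) (X i.1 i.2 @^-1` B i)].

Definition sigma_of (D : set (nat * nat)) : set (set T) := <<s cylinder D >>.

Lemma measurable_cylinder D A : cylinder D A -> measurable A.
Proof.
move=> [J [B [_ ->]]]; apply: fin_bigcap_measurable => //.
Qed.

Lemma measurable_sigma_of D A : sigma_of D A -> measurable A.
Proof.
move: A; apply: smallest_sub; last exact: measurable_cylinder.
by split => [|A mA|F mF]; [exact: measurable0|exact: measurableD|exact: bigcupT_measurable].
Qed.

Lemma setI_closed_cylinder D : setI_closed (cylinder D).
Proof.
move=> A A' [J [B [JD ->]]] [J' [B' [J'D ->]]].
exists (J `|` J')%fset, (fun i => [set x | (i \in J -> B i x) /\ (i \in J' -> B' i x)]).
split; first by move=> i /=; rewrite in_fsetU => /orP[/JD|/J'D].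
apply/seteqP; split => w /=.
  by move=> [h h'] i /= _; split=> iJ; [exact: h|exact: h'].
move=> h; split=> i /= iJ.
  by have [+ _] := h i ltac:(by rewrite /= in_fsetU iJ); apply.
by have [_ +] := h i ltac:(by rewrite /= in_fsetU iJ orbT); apply.
Qed.

Lemma sigma_of_sub D D' : D `<=` D' -> sigma_of D `<=` sigma_of D'.
Proof.
move=> DD'; apply: sub_sigma_algebra2 => A [J [B [JD ->]]].
by exists J, B; split => //; exact: subset_trans DD'.
Qed.

Lemma sigma_of_preimage (D : set (nat * nat)) i B : D i ->
  sigma_of D (X i.1 i.2 @^-1` B).
Proof.
move=> Di; apply: sub_sigma_algebra; exists [fset i]%fset, (fun _ => B); split.
  by move=> j /=; rewrite in_fset1 => /eqP ->.
by rewrite set_fset1 bigcap_set1.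
Qed.

Let D0 := [set nj : nat * nat | (1 <= nj.1)%N /\ (1 <= nj.2)%N].
Hypothesis X_indep : mutual_independence D0 (fun nj => X nj.1 nj.2).

(** Dynkin's argument: the events independent of the coordinate i0 form a lambda-system, and it
    contains the cylinders, since adjoining i0 to the index set J of a cylinder gives another
    instance of mutual independence. *)
Lemma sigma_of_indep (D : set (nat * nat)) i0 A (C : set NDelta) :
  D `<=` D0 -> D0 i0 -> ~ D i0 -> sigma_of D A ->
  P (A `&` X i0.1 i0.2 @^-1` C) = (P A * P (X i0.1 i0.2 @^-1` C))%E.
Proof.
move=> DD0 Di0 nDi0; set E := _ @^-1` C.
have mE : measurable E by exact: measurable_preimage.
pose H := [set A | measurable A /\ P (A `&` E) = (P A * P E)%E].
suff : sigma_of D `<=` H by move=> h /h[].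
rewrite /sigma_of -setI_closed_g_dynkin_g_sigma_algebra; last exact: setI_closed_cylinder.
apply: smallest_sub.
  split.
  - by split => //; rewrite setTI probability_setT mul1e.
  - move=> B [mB hB]; split; first exact: measurableC.
    rewrite setIC -setDE measureD// ?ltey_eq ?fin_num_measure//.
    rewrite [X in (_ - X)%E](_ : _ = P (B `&` E)); last by rewrite setIC.
    rewrite hB probability_setC//.
    have aux (x y : \bar R) : x \is a fin_num -> y \is a fin_num ->
        (y - x * y = (1 - x) * y)%E.
      by case: x => // x; case: y => // y _ _; rewrite -!EFinM -EFinB mulrBl mul1r.
    exact: (aux _ _ (fin_num_measure P B mB) (fin_num_measure P E mE)).
  - move=> F tF hF; split; first by apply: bigcupT_measurable => n; case: (hF n).
    have mF n : measurable (F n) by case: (hF n).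
    rewrite setI_bigcupl measure_semi_bigcup//; last 3 first.
      + by move=> n; exact: measurableI.
      + exact: trivIset_setIr.
      + by apply: bigcupT_measurable => n; exact: measurableI.
    rewrite [X in (X * _)%E]measure_semi_bigcup//; last exact: bigcupT_measurable.
    rewrite muleC -(fineK (fin_num_measure P E mE)) -nneseriesZl; last by move=> n _; exact: measure_ge0.
    by apply: eq_eseriesr => n _; rewrite (fineK (fin_num_measure P E mE)) muleC; case: (hF n).
move=> B [J [U [JD BE]]]; split; first by apply: (@measurable_cylinder D); exists J, U.
have i0J : i0 \notin J by apply/negP => /JD.
pose U' i := if i == i0 then C else U i.
have UU' i : i \in J -> U' i = U i.
  by move=> iJ; rewrite /U'; case: eqP => // ii0; move: i0J; rewrite -ii0 iJ.
have hJ' : [set` (i0 |` J)%fset] `<=` D0.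
  by move=> i /=; rewrite in_fset1U => /predU1P[->//|/JD/DD0].
have := X_indep hJ' (B := U') ltac:(by []).
have U'0 : U' i0 = C by rewrite /U' eqxx.
rewrite big_fsetU1//= U'0 -/E.
have -> : \bigcap_(i in [set` (i0 |` J)%fset]) (X i.1 i.2 @^-1` U' i) = B `&` E.
  rewrite BE; apply/seteqP; split => w /=.
    move=> h; split.
      by move=> i /= iJ; have := h i ltac:(by rewrite /= in_fset1U iJ orbT); rewrite /= UU'.
    by have := h i0 ltac:(by rewrite /= fset1U1); rewrite /= U'0.
  move=> [h hE] i /=; rewrite in_fset1U => /predU1P[->|iJ]; first by rewrite U'0.
  by rewrite UU'//; exact: h.
move=> ->; rewrite muleC; congr (_ * _)%E.
rewrite BE X_indep//; last exact: subset_trans DD0.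
by rewrite big_seq [RHS]big_seq; apply: eq_bigr => i iJ; rewrite UU'.
Qed.

End Independence.

(** * Arithmetic and measurability of states *)

Lemma addDA : associative addD.
Proof. by move=> [x|] [y|] [z|] //=; rewrite addnA. Qed.

Lemma add0D : left_id (state 0) addD.
Proof. by case. Qed.

Lemma addD0 : right_id (state 0) addD.
Proof. by case=> //= x; rewrite addn0. Qed.

HB.instance Definition _ := Monoid.isLaw.Build NDelta (state 0) addD
  addDA add0D addD0.

Section DiscreteMeasurability.
Context (T : Type) (G : set (set T)).

(** Membership of all preimages in a generated family of sets: the family can vary with the
    generation while T keeps a single measurable structure. *)
Definition dmeas (Y : T -> NDelta) := forall B, <<s G >> (Y @^-1` B).

Lemma sigma_setI A B : <<s G >> A -> <<s G >> B -> <<s G >> (A `&` B).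
Proof.
have [] := (@sigma_algebraP _ setT <<s G >> (fun _ _ _ _ => I)).1
  (smallest_sigma_algebra setT G).
by move=> _ _ _; apply.
Qed.

Lemma sigma_setT : <<s G >> setT.
Proof.
have [s0 sD _] := smallest_sigma_algebra setT G.
by have := sD _ s0; rewrite setD0.
Qed.

Lemma sigma_cst (p : Prop) : <<s G >> [set _ | p].
Proof.
have [hp|hp] := pselect p.
  by rewrite (_ : [set _ | p] = setT); [exact: sigma_setT|apply/seteqP; split].
by rewrite (_ : [set _ | p] = set0); [exact: (@sigma_algebra0 _ setT G)|apply/seteqP; split].
Qed.

(** Y has countably many values, and on each of them h is taken at a fixed state. This deals with
    the random number of summands in [GW]. *)
Lemma dmeas_bind (Y : T -> NDelta) (h : NDelta -> T -> NDelta) :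
  dmeas Y -> (forall x, dmeas (h x)) -> dmeas (fun w => h (Y w) w).
Proof.
move=> mY mh B; pose e k : NDelta := if k is k'.+1 then Some k' else None.
rewrite (_ : _ @^-1` B = \bigcup_k (Y @^-1` [set e k] `&` h (e k) @^-1` B)).
  by apply: sigma_algebra_bigcup => k; apply: sigma_setI; [exact: mY|exact: mh].
apply/seteqP; split => w /=; last by move=> [k _ [/= -> ]].
move=> hB; exists (if Y w is Some k then k.+1 else 0%N) => //=.
by case: (Y w) hB.
Qed.

Lemma dmeas_cst x : dmeas (fun _ => x).
Proof. by move=> B; exact: sigma_cst. Qed.

Lemma dmeas_comp (Y : T -> NDelta) (h : NDelta -> NDelta) :
  dmeas Y -> dmeas (h \o Y).
Proof. by move=> mY B; rewrite comp_preimage; exact: mY. Qed.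

End DiscreteMeasurability.

(** The value 0 at Delta makes the power multiplicative for [addD]. As 0^0 = 1, t = 0 gives the
    indicator of the state 0 and t = 1 that of not being Delta. *)
Definition pow_state (R : realType) (t : R) (x : NDelta) : R :=
  if x is Some k then t ^+ k else 0.

Lemma pow_stateD (R : realType) (t : R) x y :
  pow_state t (addD x y) = pow_state t x * pow_state t y.
Proof. by case: x y => [x|] [y|] //=; rewrite ?mul0r ?mulr0// exprD. Qed.

Lemma pow_state_ge0 (R : realType) (t : R) x : 0 <= t -> 0 <= pow_state t x.
Proof. by case: x => //= k t0; rewrite exprn_ge0. Qed.

Lemma pow_state_le1 (R : realType) (t : R) x : 0 <= t <= 1 -> pow_state t x <= 1.
Proof. by case: x => //= k /andP[t0 t1]; rewrite exprn_ile1. Qed.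

Lemma wsums_eseries (R : realType) (w h : nat -> R) x : wsums w h x ->
  (\sum_(0 <= k <oo) (w k * h k)%:E)%E = x%:E.
Proof.
move=> hx; apply/cvg_lim => //.
rewrite (_ : (fun n => _) = EFin \o series (fun k => w k * h k)).
  by apply: cvg_EFin; [exact: nearW|exact: hx].
by apply/funext => n; rewrite /= /series sumEFin.
Qed.

Section DiscreteIntegral.
Context (d : measure_display) (T : measurableType d) (R : realType).
Variable P : probability T R.
Variable Y : T -> NDelta.
Hypothesis mY : forall B, measurable (Y @^-1` B).

Lemma measurable_comp_state (D : set T) (g : NDelta -> R) :
  measurable_fun D (g \o Y).
Proof.
move=> mD B mB; rewrite comp_preimage; apply: measurableI => //; exact: mY.
Qed.

Lemma integral_split (A : set T) (h : T -> \bar R) : measurable A ->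
  measurable_fun A h -> (forall w, A w -> 0 <= h w)%E ->
  (forall w, A w -> Y w = None -> h w = 0)%E ->
  (\int[P]_(w in A) h w =
   \sum_(0 <= k <oo) \int[P]_(w in A `&` Y @^-1` [set Some k]) h w)%E.
Proof.
move=> mA mh h0 hN.
pose F k := A `&` Y @^-1` [set Some k].
have mF k : measurable (F k) by exact: measurableI.
have FA : \bigcup_k F k `<=` A by move=> w [k _ []].
rewrite -(@ge0_integral_bigcup _ _ _ P F h)//.
- rewrite (integral_mkcond A h) [RHS]integral_mkcond; apply: eq_integral => w _.
  rewrite /patch; case: ifPn => [/set_mem Aw|nA]; last first.
    by rewrite ifF//; apply/negbTE; apply: contra nA => /set_mem/FA/mem_set.
  case: ifPn => [//|nF]; apply: hN => //.
  case E : (Y w) => [k|//]; move: nF; rewrite notin_setE => nF.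
  by exfalso; apply: nF; exists k.
- exact: measurable_funS mh.
- by move=> w /FA; exact: h0.
- move=> i j _ _ [w [[_ /= Yi] [_ /= Yj]]].
  by move: Yi; rewrite Yj => -[].
Qed.

Lemma integral_comp_state (A : set T) (g : NDelta -> R) : measurable A ->
  (forall x, 0 <= g x) -> g None = 0 ->
  (\int[P]_(w in A) (g (Y w))%:E =
   \sum_(0 <= k <oo) (g (Some k))%:E * P (A `&` Y @^-1` [set Some k]))%E.
Proof.
move=> mA g0 gN; rewrite integral_split//.
- apply: eq_eseriesr => k _.
  under eq_integral => w.
    rewrite inE => -[_ /= ->]; over.
  by rewrite integral_cst//; exact: measurableI.
- by apply/measurable_EFinP; exact: measurable_comp_state.
- by move=> w _; rewrite lee_fin.
- by move=> w _ ->; rewrite gN.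
Qed.

End DiscreteIntegral.

(** * The martingale identity of the process *)

Section Process.
Context (d : measure_display) (T : measurableType d) (R : realType).
Variables (P : probability T R) (f : nat -> nat -> R).
Variable X : nat -> nat -> {RV P >-> NDelta}.
Hypothesis f_ge0 : forall n k, 0 <= f n.+1 k.
Hypothesis f_sq : forall n, wcvg (f n.+1) (fun k => (k%:R + 1) ^+ 2).
Hypothesis X_family : offspring_family f X.

Let X_indep := X_family.1.
Let X_law n k l : P (X n.+1 k.+1 @^-1` [set Some l]) = (f n.+1 l)%:E.
Proof. by have [_ /(_ n.+1 k.+1 isT isT)[h _]] := X_family; exact: h. Qed.

(** Exploration order: the first n generations, then the first k variables of generation n + 1. The
    next variable [X n.+1 k.+1] is thus independent of everything revealed; for k = 0 only whole
    generations remain. *)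
Definition revealed (n k : nat) : set (nat * nat) :=
  [set i | (0 < i.1)%N /\ (0 < i.2)%N /\
           ((i.1 <= n)%N \/ i.1 = n.+1 /\ (i.2 <= k)%N)].

Definition past n : set (set T) := sigma_of X (revealed n 0).

Definition brood (n k : nat) (w : T) : NDelta := sumD (Some k) (fun j => X n.+1 j w).

Lemma broodS n k w : brood n k.+1 w = addD (brood n k w) (X n.+1 k.+1 w).
Proof. by rewrite /brood /= big_nat_recr. Qed.

Lemma brood0 n w : brood n 0 w = state 0.
Proof. by rewrite /brood /= big_geq. Qed.

Lemma past_revealed n k : past n `<=` sigma_of X (revealed n k).
Proof.
apply: sigma_of_sub => i [? [? [?|[_ ?]]]]; split => //; split => //; first by left.
lia.
Qed.

Lemma revealed_past n k : sigma_of X (revealed n k) `<=` past n.+1.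
Proof.
apply: sigma_of_sub => i [? [? [?|[? _]]]]; split => //; split => //; left; lia.
Qed.

Lemma pastS n : past n `<=` past n.+1.
Proof. exact: subset_trans (@past_revealed n 0) (@revealed_past n 0). Qed.

Lemma past_le m n : (m <= n)%N -> past m `<=` past n.
Proof.
elim: n => [|n IH]; first by rewrite leqn0 => /eqP ->.
rewrite leq_eqVlt => /predU1P[->//|]; rewrite ltnS => /IH h.
exact: subset_trans h (@pastS n).
Qed.

Lemma past_measurable n A : past n A -> measurable A.
Proof. exact: measurable_sigma_of. Qed.

Lemma brood_meas n k : dmeas (cylinder X (revealed n k)) (brood n k).
Proof.
elim: k => [|k IH].
  by rewrite (_ : brood n 0 = fun _ => state 0); [exact: dmeas_cst|apply/funext => w; rewrite brood0].
have IH' : dmeas (cylinder X (revealed n k.+1)) (brood n k).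
  move=> B; apply: (@sigma_of_sub _ _ _ _ X (revealed n k)) (IH B).
  by move=> i [? [? h]]; split => //; split => //; lia.
have Xk : dmeas (cylinder X (revealed n k.+1)) (X n.+1 k.+1).
  move=> B; apply: (@sigma_of_preimage _ _ _ _ X _ (n.+1, k.+1)).
  by rewrite /revealed /=; lia.
rewrite (_ : brood n k.+1 = fun w => addD (brood n k w) (X n.+1 k.+1 w)).
  apply: (dmeas_bind IH' (h := fun x w => addD x (X n.+1 k.+1 w))) => x.
  exact: (dmeas_comp _ Xk).
by apply/funext => w; rewrite broodS.
Qed.

Lemma GW_meas n : dmeas (cylinder X (revealed n 0)) (GW X n).
Proof.
elim: n => [|n IH]; first exact: dmeas_cst.
apply: (dmeas_bind _ (h := fun x w => sumD x (fun j => X n.+1 j w))).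
  by move=> B; exact: pastS (IH B).
case=> [k|]; last exact: dmeas_cst.
by move=> B; apply: revealed_past; exact: (@brood_meas n k B).
Qed.

Lemma GW_past n m B : (n <= m)%N -> past m (GW X n @^-1` B).
Proof. by move=> nm; apply: past_le nm _ _; exact: GW_meas. Qed.

Lemma measurable_GW n B : measurable (GW X n @^-1` B).
Proof. exact: past_measurable (@GW_past n n B (leqnn n)). Qed.

Lemma measurable_brood n k B : measurable (brood n k @^-1` B).
Proof. by apply: measurable_sigma_of; exact: (@brood_meas n k B). Qed.

Lemma integral_offspring n k C t : 0 <= t <= 1 -> sigma_of X (revealed n k) C ->
  (\int[P]_(w in C) (pow_state t (X n.+1 k.+1 w))%:E =
   P C * (pgf (f n.+1) t)%:E)%E.
Proof.
move=> tI mC; have /andP[t0 t1] := tI.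
have mC' := measurable_sigma_of mC.
rewrite (@integral_comp_state _ _ _ P (X n.+1 k.+1) _ C (pow_state t))//; last 2 first.
- by move=> B; exact: measurable_preimage.
- by move=> x; exact: pow_state_ge0.
rewrite -(wsums_eseries (pgf_cvg (f_ge0 n) (@f_sq n) tI)).
rewrite -(fineK (fin_num_measure P C mC')) -nneseriesZl; last first.
  by move=> k' _; rewrite lee_fin mulr_ge0 ?exprn_ge0.
apply: eq_eseriesr => l _; rewrite (fineK (fin_num_measure P C mC')).
have -> : P (C `&` X n.+1 k.+1 @^-1` [set Some l]) = (P C * (f n.+1 l)%:E)%E.
  rewrite -(X_law n k l).
  have := @sigma_of_indep _ _ _ P X X_indep (revealed n k) (n.+1, k.+1) C [set Some l].
  apply => //=.
  - by move=> i [? [? _]].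
  - by rewrite /revealed /=; lia.
by rewrite muleCA -EFinM mulrC.
Qed.

(** Induction on k: the event that the first k terms sum to l is revealed before [X n.+1 k.+1],
    whose independent factor integrates to the generating function at t. *)
Lemma integral_brood n k A t : 0 <= t <= 1 -> past n A ->
  (\int[P]_(w in A) (pow_state t (brood n k w))%:E =
   P A * (pgf (f n.+1) t ^+ k)%:E)%E.
Proof.
move=> tI mA; have /andP[t0 t1] := tI; have mA' := past_measurable mA.
elim: k => [|k IH].
  rewrite (eq_integral (cst 1%E)); last by move=> w _; rewrite brood0.
  by rewrite integral_cst// mul1e mule1.
have pg0 : 0 <= pgf (f n.+1) t.
  apply: (wsums_ge0 (f_ge0 n) (pgf_cvg (f_ge0 n) (@f_sq n) tI)) => i.
  exact: exprn_ge0.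
rewrite (@integral_split _ _ _ P (brood n k))//; last 4 first.
- by move=> B; exact: measurable_brood.
- apply/measurable_EFinP; apply: (@measurable_comp_state _ _ _ (brood n k.+1)) => B.
  exact: measurable_brood.
- by move=> w _; rewrite lee_fin pow_state_ge0.
- by move=> w _ wN; rewrite broodS wN.
move: IH; rewrite (@integral_comp_state _ _ _ P (brood n k) _ A (pow_state t))//; last 2 first.
- by move=> B; exact: measurable_brood.
- by move=> x; exact: pow_state_ge0.
move=> IH; rewrite exprSr EFinM muleA -IH muleC -nneseriesZl; last first.
  by move=> i _; rewrite mule_ge0// lee_fin pow_state_ge0.
apply: eq_eseriesr => l _.
have mB : sigma_of X (revealed n k) (A `&` brood n k @^-1` [set Some l]).
  by apply: sigma_setI; [exact: past_revealed|exact: brood_meas].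
rewrite (eq_integral (fun w => (t ^+ l)%:E * (pow_state t (X n.+1 k.+1 w))%:E)%E); last first.
  by move=> w; rewrite inE => -[_ /= wl]; rewrite broodS wl pow_stateD EFinM.
rewrite ge0_integralZl//; last 4 first.
- exact: measurable_sigma_of mB.
- apply/measurable_EFinP; apply: measurable_comp_state => B; exact: measurable_preimage.
- by move=> w _; rewrite lee_fin pow_state_ge0.
- by rewrite lee_fin exprn_ge0.
by rewrite (integral_offspring tI mB) /= muleA muleC.
Qed.

(** The branching property. On the event that Z_n = k, the next generation is a sum with a fixed
    number of terms, to which [integral_brood] applies. *)
Lemma integral_GWS n A t : 0 <= t <= 1 -> past n A ->
  (\int[P]_(w in A) (pow_state t (GW X n.+1 w))%:E =
   \int[P]_(w in A) (pow_state (pgf (f n.+1) t) (GW X n w))%:E)%E.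
Proof.
move=> tI mA; have /andP[t0 t1] := tI; have mA' := past_measurable mA.
have pg0 : 0 <= pgf (f n.+1) t.
  apply: (wsums_ge0 (f_ge0 n) (pgf_cvg (f_ge0 n) (@f_sq n) tI)) => i.
  exact: exprn_ge0.
have mGW m B : measurable (GW X m @^-1` B) by exact: measurable_GW.
rewrite (@integral_split _ _ _ P (GW X n))//; last 3 first.
- by apply/measurable_EFinP; exact: (@measurable_comp_state _ _ _ (GW X n.+1)).
- by move=> w _; rewrite lee_fin pow_state_ge0.
- by move=> w _ /= ->.
rewrite [RHS](@integral_comp_state _ _ _ P (GW X n) _ A (pow_state (pgf (f n.+1) t)))//; last first.
  by move=> x; exact: pow_state_ge0.
apply: eq_eseriesr => k _ /=.
rewrite (eq_integral (fun w => (pow_state t (brood n k w))%:E)); last first.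
  by move=> w; rewrite inE => -[_ /= ->].
rewrite (integral_brood k tI) 1?muleC//.
by apply: sigma_setI => //; exact: GW_past.
Qed.

End Process.

(** * Almost sure convergence of bounded martingales *)

Lemma integrable_bounded (d : measure_display) (T : measurableType d)
    (R : realType) (P : probability T R) (A : set T) (g : T -> R) (K : R) :
  measurable A -> measurable_fun setT g -> (forall w, `|g w| <= K) ->
  P.-integrable A (EFin \o g).
Proof.
move=> mA mg gK; apply: measurable_bounded_integrable => //.
- by rewrite ltey_eq fin_num_measure.
- exact: measurable_funS mg.
- by exists K; split; [exact: num_real|move=> x Kx w _; exact: le_trans (gK w) (ltW Kx)].
Qed.

Section BoundedMartingale.
Context (d : measure_display) (T : measurableType d) (R : realType).
Variables (P : probability T R) (M : nat -> T -> R) (F : nat -> set (set T)).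
Hypothesis mM : forall n, measurable_fun setT (M n).
Hypothesis M01 : forall n w, 0 <= M n w <= 1.
Hypothesis F_meas : forall n A, F n A -> measurable A.
Hypothesis F_T : forall n, F n setT.
Hypothesis F_D : forall n A B, F n A -> F n B -> F n (A `\` B).
Hypothesis F_I : forall n A B, F n A -> F n B -> F n (A `&` B).
Hypothesis F_le : forall m n, (m <= n)%N -> F m `<=` F n.
Hypothesis F_near : forall i j k (e : R), (i <= k)%N -> (j <= k)%N ->
  F k [set w | `|M i w - M j w| < e].
(** Testing against M i as well as against past events builds the orthogonality of increments into
    the hypothesis. *)
Hypothesis M_martingale : forall i k m A, (i <= k)%N -> (k <= m)%N -> F k A ->
  \int[P]_(w in A) (M i w * M m w) = \int[P]_(w in A) (M i w * M k w).

Let q (A : set T) i j := \int[P]_(w in A) (M i w * M j w).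

Let qint A i j : measurable A -> P.-integrable A (EFin \o (fun w => M i w * M j w)).
Proof.
move=> mA; apply: (@integrable_bounded _ _ _ _ _ _ 1) => //.
  exact: measurable_funM.
move=> w; have /andP[a0 a1] := M01 i w; have /andP[b0 b1] := M01 j w.
by rewrite ger0_norm ?mulr_ge0// mulr_ile1.
Qed.

Let mdist i j : measurable_fun setT (fun w => (M i w - M j w) ^+ 2).
Proof. by apply: measurable_funX; exact: measurable_funB. Qed.

Let dint A i j : measurable A ->
  P.-integrable A (EFin \o (fun w => (M i w - M j w) ^+ 2)).
Proof.
move=> mA; apply: (@integrable_bounded _ _ _ _ _ _ 1) => //.
move=> w; have /andP[a0 a1] := M01 i w; have /andP[b0 b1] := M01 j w.
rewrite ger0_norm ?sqr_ge0//; nra.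
Qed.

Let dist_sq A i j : measurable A ->
  \int[P]_(w in A) ((M i w - M j w) ^+ 2) = q A i i - 2 * q A i j + q A j j.
Proof.
move=> mA; have h : P.-integrable A (EFin \o (fun w => 2 * (M i w * M j w))).
  apply: (@integrable_bounded _ _ _ _ _ _ 2) => //.
    by apply: measurable_funM => //; exact: measurable_funM.
  move=> w; have /andP[a0 a1] := M01 i w; have /andP[b0 b1] := M01 j w.
  rewrite ger0_norm; first by nra.
  by rewrite !mulr_ge0.
rewrite -(RintegralZl _ mA (qint i j mA)) -(RintegralB mA (qint i i mA) h) -RintegralD//.
- by apply: eq_Rintegral => w _; ring.
- apply: (@integrable_bounded _ _ _ _ _ _ 3) => //.
    apply: measurable_funB; first exact: measurable_funM.
    by apply: measurable_funM => //; exact: measurable_funM.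
  move=> w; have /andP[a0 a1] := M01 i w; have /andP[b0 b1] := M01 j w.
  rewrite ler_norml; apply/andP; split; nra.
- exact: qint.
Qed.

Let qC A i j : q A i j = q A j i.
Proof. by apply: eq_Rintegral => w _; rewrite mulrC. Qed.

Let q_stop i k m A : (i <= k)%N -> (k <= m)%N -> F k A -> q A i m = q A i k.
Proof. exact: M_martingale. Qed.

Let energy_le A k m : (k <= m)%N -> F k A -> q A k k <= q A m m.
Proof.
move=> km FA; have mA := F_meas FA.
have : 0 <= \int[P]_(w in A) ((M m w - M k w) ^+ 2).
  by apply: Rintegral_ge0 => w _; exact: sqr_ge0.
rewrite dist_sq// qC (q_stop (leqnn k) km FA); lra.
Qed.

Let dist_le A N k m : (N <= k)%N -> (k <= m)%N -> F k A ->
  \int[P]_(w in A) ((M k w - M N w) ^+ 2) <=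
  \int[P]_(w in A) ((M m w - M N w) ^+ 2).
Proof.
move=> Nk km FA; have mA := F_meas FA.
rewrite !dist_sq// (qC A k N) (qC A m N) (q_stop Nk km FA).
have := energy_le km FA; lra.
Qed.

Let quiet N (e : R) j := [set w | forall i, (N <= i < N + j)%N -> `|M i w - M N w| < e].

Let quietS N (e : R) j :
  quiet N e j.+1 = quiet N e j `&` [set w | `|M (N + j)%N w - M N w| < e].
Proof.
apply/seteqP; split => w /=.
  move=> h; split; last by apply: h; lia.
  by move=> i /andP[Ni iN]; apply: h; lia.
move=> [h1 h2] i iN; have [->//|ne] := eqVneq i (N + j)%N.
by apply: h1; lia.
Qed.

Let F_quiet N (e : R) j : F (N + j) (quiet N e j.+1).
Proof.
elim: j => [|j IH].
  rewrite (_ : quiet N e 1 = [set w | `|M N w - M N w| < e]).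
    by apply: F_near; rewrite addn0.
  apply/seteqP; split => w /=; first by move=> /(_ N); apply; lia.
  by move=> h i iN; have -> : i = N by lia.
rewrite quietS; apply: F_I; first by apply: F_le IH; lia.
by apply: F_near; lia.
Qed.

Let measurable_quiet N (e : R) j : measurable (quiet N e j).
Proof.
case: j => [|j]; last exact: F_meas (F_quiet N e j).
rewrite (_ : quiet N e 0 = setT) //; apply/seteqP; split => // w _ i /=; lia.
Qed.

(** Kolmogorov's maximal inequality: on A the path is at distance at least e from M_N for the first
    time at N + j. A belongs to F (N + j), the squared distance there is at least e^2, and [dist_le]
    carries its integral to the later time m. *)
Let maximal_step N (e : R) j m : 0 < e -> (N + j <= m.+1)%N ->
  e ^+ 2 * fine (P (~` quiet N e j)) <=
  \int[P]_(w in ~` quiet N e j) ((M m w - M N w) ^+ 2).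
Proof.
move=> e0; elim: j => [|j IH] Njm.
  rewrite (_ : quiet N e 0 = setT); last first.
    by apply/seteqP; split => // w _ i /=; lia.
  by rewrite setCT measure0 mulr0 Rintegral_set0.
pose A := quiet N e j `\` [set w | `|M (N + j)%N w - M N w| < e].
have FA : F (N + j) A.
  apply: F_D; last by apply: F_near; lia.
  case: j {IH Njm A} => [|j].
    rewrite (_ : quiet N e 0 = setT); first exact: F_T.
    by apply/seteqP; split => // w _ i /=; lia.
  by apply: F_le (F_quiet N e j); lia.
have mA := F_meas FA; have mq := measurableC (measurable_quiet N e j).
have dA : [disjoint ~` quiet N e j & A].
  apply/disj_setPS => w [/= h1 [h2 _]]; exact: h1.
have -> : ~` quiet N e j.+1 = ~` quiet N e j `|` A.
  rewrite quietS setCI; apply/seteqP; split => w /=.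
    by move=> [h|h]; [left|have [hq|hq] := pselect (quiet N e j w); [right|left]].
  by move=> [h|[_ h]]; [left|right].
rewrite measureU//; last by apply/eqP; rewrite -disj_set2E.
rewrite fineD ?fin_num_measure// mulrDr.
rewrite Rintegral_setU//; last by apply: dint; exact: measurableU.
apply: lerD; first by apply: IH; lia.
apply: le_trans (dist_le (N := N) (k := N + j) (m := m) _ _ FA); [|lia|lia].
rewrite -Rintegral_cst//; apply: le_Rintegral => //.
- apply: (@integrable_bounded _ _ _ _ _ _ (e ^+ 2)) => // w.
  by rewrite ger0_norm// sqr_ge0.
- exact: dint.
- move=> w [_ /= /negP]; rewrite -leNgt => h.
  by rewrite -[leRHS]real_normK ?num_real// lerXn2r ?nnegrE// ltW.
Qed.

Let maximal N (e : R) j : 0 < e ->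
  e ^+ 2 * fine (P (~` quiet N e j.+1)) <= q setT (N + j) (N + j) - q setT N N.
Proof.
move=> e0; apply: (le_trans (@maximal_step N e j.+1 (N + j) e0 _)); first by rewrite addnS.
have mq := measurableC (measurable_quiet N e j.+1).
apply: (@le_trans _ _ (\int[P]_(w in setT) ((M (N + j)%N w - M N w) ^+ 2))).
  have mq' := measurable_quiet N e j.+1.
  rewrite -(setvU (quiet N e j.+1)) Rintegral_setU//.
  - by rewrite lerDl; apply: Rintegral_ge0 => w _; exact: sqr_ge0.
  - by apply: dint; exact: measurableU.
  - by apply/disj_setPS => w [/= h1 h2]; exact: h1.
rewrite dist_sq// (qC _ (N + j) N) (q_stop (leqnn N) (leq_addr j N) (F_T N)).
lra.
Qed.

Let energy_cvg : cvgn (fun n => q setT n n).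
Proof.
apply: nondecreasing_is_cvgn; first by move=> m n mn; exact: energy_le (F_T m).
exists 1 => _ [n _ <-].
have -> : (1 : R) = \int[P]_(w in setT) 1.
  transitivity (1 * fine (P setT)); first by rewrite probability_setT mul1r.
  by rewrite Rintegral_cst.
apply: le_Rintegral => //; first exact: qint.
  by apply: (@integrable_bounded _ _ _ _ _ _ 1) => // w; rewrite normr1.
move=> w _; have /andP[a0 a1] := M01 n w; by rewrite mulr_ile1.
Qed.

Let noisy N (e : R) := \bigcup_j ~` quiet N e j.+1.

Let measurable_noisy N (e : R) : measurable (noisy N e).
Proof. by apply: bigcupT_measurable => j; apply: measurableC. Qed.

(** Continuity from below extends [maximal] to the union over j; the bound is the energy still to
    come after N, which tends to 0. *)
Let noisy_le N (e : R) : 0 < e ->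
  (P (noisy N e) <= ((limn (fun n => q setT n n) - q setT N N) / e ^+ 2)%:E)%E.
Proof.
move=> e0; have nd : nondecreasing_seq (fun j => ~` quiet N e j.+1).
  apply/nondecreasing_seqP => j; apply/subsetPset; rewrite [in X in _ `<=` X]quietS setCI.
  exact: subsetUl.
have cP := nondecreasing_cvg_mu (mu := P)
  (fun j => measurableC (measurable_quiet N e j.+1)) (measurable_noisy N e) nd.
rewrite -(cvg_lim _ cP)//; apply: lime_le; first by apply/cvg_ex; eexists; exact: cP.
apply: nearW => j /=.
rewrite -(fineK (fin_num_measure P _ (measurableC (measurable_quiet N e j.+1)))) lee_fin.
rewrite ler_pdivlMr ?exprn_gt0// mulrC; apply: (le_trans (maximal N j e0)).
rewrite lerD2r; apply: (nondecreasing_cvgn_le _ energy_cvg).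
by move=> m n mn; exact: energy_le (F_T m).
Qed.

Let noisy_negligible (e : R) : 0 < e -> P (\bigcap_N noisy N e) = 0%E.
Proof.
move=> e0; have mc : measurable (\bigcap_N noisy N e).
  by apply: bigcapT_measurable => N.
apply/eqP; rewrite eq_le measure_ge0 andbT.
apply/lee_addgt0Pr => h h0; rewrite add0e.
have : (fun N => (limn (fun n => q setT n n) - q setT N N) / e ^+ 2) @ \oo --> (0 : R).
  rewrite (_ : (0 : R) = (limn (fun n => q setT n n) - limn (fun n => q setT n n)) / e ^+ 2).
    by apply: cvgMr_tmp; apply: cvgB; [exact: cvg_cst|exact: energy_cvg].
  by rewrite subrr mul0r.
move=> /(cvgr_le 0)/(_ _ h0) /near_inftyP[N /(_ N (leqnn N)) HN].
apply: (@le_trans _ _ (P (noisy N e))).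
  by apply: le_measure; rewrite ?inE//; exact: bigcap_inf.
by apply: (le_trans (noisy_le N e0)); rewrite lee_fin.
Qed.

Theorem bounded_martingale_cvg : {ae P, forall w, cvgn (M ^~ w)}.
Proof.
pose e (k : nat) : R := k.+1%:R^-1.
have e0 k : 0 < e k by rewrite invr_gt0.
apply: (@negligibleS _ _ _ P (\bigcup_k \bigcap_N noisy N (e k))); last first.
  apply: negligible_bigcup => k; apply/negligibleP; last exact: noisy_negligible.
  by apply: bigcapT_measurable => N.
move=> w /= nc; apply: contrapT => nb; apply: nc.
apply/cauchy_cvgP/cauchy_exP => h h0.
have [k ek] : exists k, e k < h / 2.
  have h2 : 0 < h / 2 by rewrite divr_gt0.
  exists (Num.truncn (h / 2)^-1).
  by rewrite /e invf_plt ?posrE//; exact: truncnS_gt.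
have [N HN] : exists N, forall i, (N <= i)%N -> `|M i w - M N w| < e k.
  apply: contrapT => nN; apply: nb; exists k => // N _.
  apply: contrapT => nn; apply: nN; exists N => i Ni.
  apply: contrapT => hi; apply: nn; exists (i - N)%N => //= hq; apply: hi; apply: hq; lia.
exists (M N w), N => // i /= Ni.
by rewrite /ball/= distrC; have := HN _ Ni; lra.
Qed.

End BoundedMartingale.

(** * Existence of backward orbits *)

Section Iterates.
Variables (R : realType) (f : nat -> nat -> R).
Hypothesis f_ge0 : forall n k, 0 <= f n.+1 k.
Hypothesis f_sq : forall n, wcvg (f n.+1) (fun k => (k%:R + 1) ^+ 2).
Hypothesis f_mean : forall n, 0 < dmean (f n.+1) 1.
Hypothesis f_mass : forall n, pgf (f n.+1) 1 <= 1.

Let pgfI n t : 0 <= t <= 1 -> 0 <= pgf (f n.+1) t <= 1.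
Proof. exact: pgf_itv. Qed.

(* Nothing is known about the series outside [0, 1]; clamping its argument gives
   a function continuous on the whole line, to which IVT applies. *)
Let clamp (t : R) : R := Num.max 0 (Num.min t 1).

Let clampI t : 0 <= clamp t <= 1.
Proof. by rewrite le_max lexx/= ge_max ler01 ge_min lexx orbT. Qed.

Let clamp_id t : 0 <= t <= 1 -> clamp t = t.
Proof. by move=> /andP[t0 t1]; rewrite /clamp (min_idPl t1) (max_idPr t0). Qed.

Let clamp_dist s t : `|clamp s - clamp t| <= `|s - t|.
Proof.
have cP x : [\/ x <= 0 /\ clamp x = 0, 0 <= x <= 1 /\ clamp x = x |
    1 <= x /\ clamp x = 1].
  have [x0|/ltW x0] := leP x 0.
    constructor 1; split => //; rewrite /clamp (min_idPl _) ?(le_trans x0)//.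
    exact/max_idPl.
  have [x1|/ltW x1] := leP x 1; first by constructor 2; rewrite clamp_id ?x0 ?x1.
  constructor 3; split => //; rewrite /clamp (min_idPr x1); exact/max_idPr.
have h (x y : R) : x <= y -> 0 <= clamp y - clamp x <= y - x.
  by move=> xy; case: (cP x) => -[hx ->]; case: (cP y) => -[hy ->]; apply/andP; split; lra.
have [st|/ltW ts] := leP s t; last first.
  by have /andP[h1 h2] := h _ _ ts; rewrite !ger0_norm// subr_ge0.
by have /andP[h1 h2] := h _ _ st; rewrite distrC (distrC s) !ger0_norm// subr_ge0.
Qed.

Lemma pgf_clamp_continuous n : continuous (fun t => pgf (f n.+1) (clamp t)).
Proof.
move=> t; apply/cvgrPdist_le => e e0.
have m1 : 0 < dmean (f n.+1) 1 by [].
near=> u.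
have hu : `|t - u| <= e / dmean (f n.+1) 1.
  near: u; apply: (@cvgr_dist_le _ _ _ (nbhs t) _ id t) => //.
  exact: divr_gt0.
have lip x y : 0 <= x -> x <= y -> y <= 1 ->
    `|pgf (f n.+1) y - pgf (f n.+1) x| <= dmean (f n.+1) 1 * `|y - x|.
  move=> x0 xy y1; rewrite !ger0_norm ?subr_ge0//; first exact: pgf_lipschitz.
  exact: pgf_le.
have h : `|pgf (f n.+1) (clamp t) - pgf (f n.+1) (clamp u)| <=
    dmean (f n.+1) 1 * `|clamp t - clamp u|.
  have /andP[a0 a1] := clampI t; have /andP[b0 b1] := clampI u.
  have [tu|/ltW ut] := leP (clamp t) (clamp u); last exact: lip.
  by rewrite distrC (distrC (clamp t)); exact: lip.
apply: (le_trans h); rewrite mulrC -ler_pdivlMr//.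
exact: le_trans (clamp_dist t u) hu.
Unshelve. all: by end_near. Qed.

Lemma pgf_cvg_seq n (u : nat -> R) (l : R) : (forall k, 0 <= u k <= 1) ->
  u @ \oo --> l -> (fun k => pgf (f n.+1) (u k)) @ \oo --> pgf (f n.+1) l.
Proof.
move=> uI ul.
have lI : 0 <= l <= 1.
  rewrite -(cvg_lim _ ul)//; apply/andP; split.
    by apply: limr_ge; [apply/cvg_ex; exists l|apply: nearW => k; case/andP: (uI k)].
  by apply: limr_le; [apply/cvg_ex; exists l|apply: nearW => k; case/andP: (uI k)].
rewrite -(clamp_id lI) (_ : (fun k => _) = (fun t => pgf (f n.+1) (clamp t)) \o u).
  exact: (cvg_comp _ _ ul (@pgf_clamp_continuous n l)).
by apply/funext => k /=; rewrite clamp_id.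
Qed.

Fixpoint pgf_iter (n k : nat) (t : R) : R :=
  if k is k'.+1 then pgf (f n.+1) (pgf_iter n.+1 k' t) else t.

Lemma pgf_iterSr n k t :
  pgf_iter n k.+1 t = pgf_iter n k (pgf (f (n + k).+1) t).
Proof.
elim: k n => [|k IH] n; first by rewrite addn0.
by rewrite /= -addSnnS -IH.
Qed.

Lemma pgf_iterI n k t : 0 <= t <= 1 -> 0 <= pgf_iter n k t <= 1.
Proof. by move=> tI; elim: k n => [|k IH] n //=; exact: pgfI. Qed.

Lemma pgf_iter_le n k s t : 0 <= s -> s <= t -> t <= 1 ->
  pgf_iter n k s <= pgf_iter n k t.
Proof.
move=> s0 st t1; have sI : 0 <= s <= 1 by rewrite s0 (le_trans st).
have tI : 0 <= t <= 1 by rewrite t1 (le_trans s0).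
elim: k n => [//|k IH] n /=; apply: pgf_le => //.
- by case/andP: (pgf_iterI n.+1 k sI).
- by case/andP: (pgf_iterI n.+1 k tI).
Qed.

Let i0 : 0 <= (0 : R) <= 1. Proof. by rewrite lexx ler01. Qed.
Let i1 : 0 <= (1 : R) <= 1. Proof. by rewrite lexx ler01. Qed.

(** The k-fold composition at 1 is the probability that a line founded by one individual at time n
    avoids Delta for k generations, and at 0 that it is extinct by then. The limits are the a_n and
    b_n of the overview. *)
Definition upper_orbit n : R := limn (fun k => pgf_iter n k 1).
Definition lower_orbit n : R := limn (fun k => pgf_iter n k 0).

Lemma upper_orbit_cvg n : (fun k => pgf_iter n k 1) @ \oo --> upper_orbit n.
Proof.
apply: nonincreasing_is_cvgn.
  apply/nonincreasing_seqP => k; rewrite pgf_iterSr; apply: pgf_iter_le => //.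
  by case/andP: (pgfI (n + k) i1).
by exists 0 => _ [k _ <-]; case/andP: (pgf_iterI n k i1).
Qed.

Lemma lower_orbit_cvg n : (fun k => pgf_iter n k 0) @ \oo --> lower_orbit n.
Proof.
apply: nondecreasing_is_cvgn.
  apply/nondecreasing_seqP => k; rewrite pgf_iterSr.
  by have /andP[p0 p1] := pgfI (n + k) i0; exact: pgf_iter_le.
by exists 1 => _ [k _ <-]; case/andP: (pgf_iterI n k i0).
Qed.

Lemma upper_orbitS n : pgf (f n.+1) (upper_orbit n.+1) = upper_orbit n.
Proof.
have h := @pgf_cvg_seq n _ _ (fun k => pgf_iterI n.+1 k i1) (@upper_orbit_cvg n.+1).
have := @upper_orbit_cvg n; rewrite -(cvg_shiftS (fun k => pgf_iter n k 1)) /=.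
by move=> h2; apply: cvg_unique h h2; exact: Rhausdorff.
Qed.

Lemma lower_orbitS n : pgf (f n.+1) (lower_orbit n.+1) = lower_orbit n.
Proof.
have h := @pgf_cvg_seq n _ _ (fun k => pgf_iterI n.+1 k i0) (@lower_orbit_cvg n.+1).
have := @lower_orbit_cvg n; rewrite -(cvg_shiftS (fun k => pgf_iter n k 0)) /=.
by move=> h2; apply: cvg_unique h h2; exact: Rhausdorff.
Qed.

Lemma upper_orbit_le1 n : upper_orbit n <= 1.
Proof.
apply: limr_le; first exact: upper_orbit_cvg.
by apply: nearW => k; case/andP: (pgf_iterI n k i1).
Qed.

Lemma lower_orbit_ge0 n : 0 <= lower_orbit n.
Proof.
apply: limr_ge; first exact: lower_orbit_cvg.
by apply: nearW => k; case/andP: (pgf_iterI n k i0).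
Qed.

(** The intermediate value theorem between the extremal orbits; u is strictly inside because at an
    endpoint the function takes an extremal value, which v is not. *)
Lemma orbit_step n v : lower_orbit n < v < upper_orbit n ->
  exists u, lower_orbit n.+1 < u < upper_orbit n.+1 /\ pgf (f n.+1) u = v.
Proof.
move=> /andP[bv va].
have b0 := lower_orbit_ge0 n.+1; have a1 := upper_orbit_le1 n.+1.
have ba : lower_orbit n.+1 <= upper_orbit n.+1.
  apply: ler_lim; [exact: lower_orbit_cvg|exact: upper_orbit_cvg|].
  by apply: nearW => k; apply: pgf_iter_le.
have bI : 0 <= lower_orbit n.+1 <= 1 by rewrite b0 (le_trans ba).
have aI : 0 <= upper_orbit n.+1 <= 1 by rewrite a1 (le_trans b0).
have [|u] := @IVT R (fun t => pgf (f n.+1) (clamp t)) _ _ v ba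
  (continuous_subspaceT (@pgf_clamp_continuous n)).
  rewrite !clamp_id// upper_orbitS lower_orbitS ge_min le_max.
  by rewrite (ltW bv) (ltW va) orbT.
rewrite in_itv /= => /andP[bu ua]; rewrite clamp_id; last first.
  by apply/andP; split; [exact: le_trans bu|exact: le_trans ua a1].
move=> uv; exists u; split => //; rewrite !lt_neqAle bu ua !andbT; apply/andP; split.
  by apply: contraTN bv => /eqP e; rewrite -uv -e lower_orbitS ltxx.
by apply: contraTN va => /eqP e; rewrite -uv e upper_orbitS ltxx.
Qed.

Lemma orbit_exists v : lower_orbit 0 < v < upper_orbit 0 ->
  exists s : nat -> R, s 0 = v /\ forall n,
    [/\ lower_orbit n < s n, s n < upper_orbit n & pgf (f n.+1) (s n.+1) = s n].
Proof.
move=> v0.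
(* The subtype carries the strict bounds from which [orbit_step] produces the next point. *)
pose S n := {u : R | lower_orbit n < u < upper_orbit n}.
pose next n (u : S n) : S n.+1 :=
  exist (fun x => lower_orbit n.+1 < x < upper_orbit n.+1 : Prop) _
    (projT2 (cid (orbit_step (projT2 u)))).1.
pose s n : S n := nat_rect S
  (exist (fun x => lower_orbit 0 < x < upper_orbit 0 : Prop) v v0) next n.
exists (fun n => projT1 (s n)); split => // n.
have /andP[h1 h2] := projT2 (s n); split => //.
exact: (projT2 (cid (orbit_step (projT2 (s n))))).2.
Qed.

End Iterates.

(** * Limits of orbit martingales *)

Lemma integral_cst_probability (d : measure_display) (T : measurableType d)
    (R : realType) (P : probability T R) (x : R) : (\int[P]_w x%:E = x%:E)%E.
Proof.
transitivity (x%:E * P setT)%E; first exact: integral_cst.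
by rewrite probability_setT mule1.
Qed.

Section Survival.
Context (d : measure_display) (T : measurableType d) (R : realType).
Variables (P : probability T R) (f : nat -> nat -> R).
Variable X : nat -> nat -> {RV P >-> NDelta}.
Hypothesis f_ge0 : forall n k, 0 <= f n.+1 k.
Hypothesis f_sq : forall n, wcvg (f n.+1) (fun k => (k%:R + 1) ^+ 2).
Hypothesis f_mass : forall n, pgf (f n.+1) 1 <= 1.
Hypothesis X_family : offspring_family f X.

Let mGW n B : measurable (GW X n @^-1` B).
Proof. exact: measurable_GW. Qed.

Lemma measurable_pow_GW (t : R) n D :
  measurable_fun D (fun w => pow_state t (GW X n w)).
Proof. exact: (@measurable_comp_state _ _ _ (GW X n)). Qed.

Lemma integral_pow_GW n t : 0 <= t <= 1 ->
  (\int[P]_w (pow_state t (GW X n w))%:E = (pgf_iter f 0 n t)%:E)%E.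
Proof.
elim: n t => [|n IH] t tI.
  by rewrite (eq_integral (cst t%:E))//; exact: integral_cst_probability.
rewrite (integral_GWS f_ge0 f_sq X_family tI); last exact: sigma_setT.
rewrite IH; first by rewrite -(pgf_iterSr f 0 n t).
exact: pgf_itv.
Qed.

Lemma GW_absorbing n m x : (forall y, sumD x y = x) -> (n <= m)%N ->
  forall w, GW X n w = x -> GW X m w = x.
Proof.
move=> hx nm w; elim: m nm => [|m IH]; first by rewrite leqn0 => /eqP ->.
rewrite leq_eqVlt => /predU1P[->//|]; rewrite ltnS => nm Zn /=.
by rewrite (IH nm Zn) hx.
Qed.

Let sumD0 y : sumD (state 0) y = state 0.
Proof. by rewrite /sumD /= big_geq. Qed.

Definition extinction : set T := \bigcup_n (GW X n @^-1` [set Some 0%N]).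
Definition no_defect : set T := \bigcap_n (GW X n @^-1` [set~ None]).
Definition survival : set T := no_defect `\` extinction.

Lemma measurable_extinction : measurable extinction.
Proof. by apply: bigcupT_measurable => n; exact: mGW. Qed.

Lemma measurable_no_defect : measurable no_defect.
Proof. by apply: bigcapT_measurable => n; exact: mGW. Qed.

Lemma measurable_survival : measurable survival.
Proof.
by apply: measurableD; [exact: measurable_no_defect|exact: measurable_extinction].
Qed.

Lemma extinction_no_defect : extinction `<=` no_defect.
Proof.
move=> w [n _ /= Zn] m _ /= Zm.
have := GW_absorbing (x := Some 0%N) sumD0 (leq_maxl n m) Zn.
by rewrite (GW_absorbing (x := None) (fun _ => erefl) (leq_maxr n m) Zm).
Qed.

Lemma survivalP w : survival w -> exists z : nat -> nat,
  forall n, (0 < z n)%N /\ GW X n w = Some (z n).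
Proof.
move=> [wD wE]; exists (fun n => if GW X n w is Some k then k else 0%N) => n.
case E : (GW X n w) => [[|k]|] //; first by exfalso; apply: wE; exists n.
by exfalso; exact: (wD n).
Qed.

(** At t = 0 the integrand is the indicator of the state 0, so P(Z_n = 0) is an iterate at 0; these
    events increase since 0 is absorbing. *)
Lemma extinction_prob : P extinction = (lower_orbit f 0)%:E.
Proof.
have mono : nondecreasing_seq (fun n => GW X n @^-1` [set Some 0%N]).
  move=> m n mn; apply/subsetPset => w /= Zm.
  exact: GW_absorbing mn _ Zm.
have h := nondecreasing_cvg_mu (mu := P) (fun n => mGW n _) measurable_extinction mono.
apply: (cvg_unique _ h) => //.
rewrite (_ : _ \o _ = fun n => (pgf_iter f 0 n 0)%:E).
  apply: cvg_EFin; first exact: nearW.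
  by apply: lower_orbit_cvg.
apply/funext => n /=; rewrite -integral_pow_GW ?lexx ?ler01//.
rewrite -[LHS]/(P (GW X n @^-1` [set Some 0%N])) -[GW X n @^-1` _]setIT.
rewrite -integral_indic//; apply: eq_integral => w _; congr EFin.
rewrite indicE; case E : (GW X n w) => [[|k]|] /=.
- by rewrite expr0 mem_set//= E.
- by rewrite expr0n memNset//= E.
- by rewrite memNset//= E.
Qed.

Lemma no_defect_prob : P no_defect = (upper_orbit f 0)%:E.
Proof.
have mono : nonincreasing_seq (fun n => GW X n @^-1` [set~ None]).
  move=> m n mn; apply/subsetPset => w /= + Zm; apply.
  exact: GW_absorbing mn _ Zm.
have fin : (P (GW X 0 @^-1` [set~ None]) < +oo)%E.
  by rewrite ltey_eq fin_num_measure.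
have h := nonincreasing_cvg_mu (mu := P) fin (fun n => mGW n _) measurable_no_defect mono.
apply: (cvg_unique _ h) => //.
rewrite (_ : _ \o _ = fun n => (pgf_iter f 0 n 1)%:E).
  apply: cvg_EFin; first exact: nearW.
  by apply: upper_orbit_cvg.
apply/funext => n /=; rewrite -integral_pow_GW ?lexx ?ler01//.
rewrite -[LHS]/(P (GW X n @^-1` [set~ None])) -[GW X n @^-1` _]setIT.
rewrite -integral_indic//; apply: eq_integral => w _; congr EFin.
rewrite indicE; case E : (GW X n w) => [k|] /=.
- by rewrite expr1n mem_set//= E.
- by rewrite memNset//= E => /(_ erefl).
Qed.

Lemma survival_prob : P survival = (upper_orbit f 0 - lower_orbit f 0)%:E.
Proof.
have mN := measurable_no_defect; have mE := measurable_extinction.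
rewrite measureD//; last by rewrite ltey_eq fin_num_measure.
rewrite (setIidr extinction_no_defect) EFinB.
by congr (_ - _)%E; [exact: no_defect_prob|exact: extinction_prob].
Qed.

Section Orbit.
Variable s : nat -> R.
Hypothesis sI : forall n, 0 <= s n <= 1.
Hypothesis s_orbit : forall n, pgf (f n.+1) (s n.+1) = s n.

Let M n w := pow_state (s n) (GW X n w).

Let M01 n w : 0 <= M n w <= 1.
Proof.
by rewrite pow_state_ge0 ?pow_state_le1//; case/andP: (sI n).
Qed.

Let mM n : measurable_fun setT (M n).
Proof. exact: measurable_pow_GW. Qed.

Let mME n D : measurable_fun D (EFin \o M n).
Proof. by apply/measurable_EFinP; exact: measurable_pow_GW. Qed.

Let integral_M k m A : (k <= m)%N -> past X k A ->
  (\int[P]_(w in A) (M m w)%:E = \int[P]_(w in A) (M k w)%:E)%E.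
Proof.
move=> km kA; elim: m km => [|m IH]; first by rewrite leqn0 => /eqP ->.
rewrite leq_eqVlt => /predU1P[->//|]; rewrite ltnS => km.
rewrite -(IH km) /M (integral_GWS f_ge0 f_sq X_family (sI m.+1)) ?s_orbit//.
exact: past_le km _ kA.
Qed.

(** Splitting by the value l of Z_i turns M_i into the constant s_i^l and keeps the event in the
    past, where [integral_M] applies. *)
Let integral_MM i k m A : (i <= k)%N -> (k <= m)%N -> past X k A ->
  \int[P]_(w in A) (M i w * M m w) = \int[P]_(w in A) (M i w * M k w).
Proof.
move=> ik km kA; have mA := past_measurable kA; rewrite /Rintegral; congr fine.
have split_i n : (\int[P]_(w in A) (M i w * M n w)%:E = \sum_(0 <= l <oo)
    (s i ^+ l)%:E * \int[P]_(w in A `&` GW X i @^-1` [set Some l]) (M n w)%:E)%E.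
  rewrite (@integral_split _ _ _ P (GW X i))//; last 3 first.
  - by apply/measurable_EFinP; apply: measurable_funM; exact: measurable_pow_GW.
  - move=> w _; rewrite lee_fin mulr_ge0//.
      by case/andP: (M01 i w).
    by case/andP: (M01 n w).
  - by move=> w _ Zi; rewrite /M Zi /= mul0r.
  apply: eq_eseriesr => l _.
  rewrite (eq_integral (fun w => (s i ^+ l)%:E * (M n w)%:E)%E); last first.
    by move=> w; rewrite inE => -[_ /= Zi]; rewrite /M Zi EFinM.
  rewrite ge0_integralZl//.
  - exact: measurableI.
  - exact: mME.
  - by move=> w _; rewrite lee_fin; case/andP: (M01 n w).
  - by rewrite lee_fin exprn_ge0//; case/andP: (sI i).
rewrite !split_i; apply: eq_eseriesr => l _; rewrite (integral_M km)//.
by apply: sigma_setI => //; exact: GW_past.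
Qed.

Lemma orbit_martingale_cvg : {ae P, forall w, cvgn (M ^~ w)}.
Proof.
apply: (@bounded_martingale_cvg _ _ _ P M (past X)) => //.
- by move=> n A; exact: past_measurable.
- by move=> n; exact: sigma_setT.
- move=> n A B nA nB; rewrite setDE; apply: sigma_setI => //.
  rewrite -setTD; have [_ h _] := smallest_sigma_algebra setT (cylinder X (revealed n 0)).
  exact: h.
- by move=> n A B; exact: sigma_setI.
- by move=> m n; exact: past_le.
- move=> i j k e ik jk.
  (* The condition is encoded as a state so that [dmeas_bind] applies to the value of Z_i. *)
  pose h x w : NDelta := if `|pow_state (s i) x - M j w| < e then Some 0%N else None.
  have : dmeas (cylinder X (revealed k 0)) (fun w => h (GW X i w) w).
    apply: dmeas_bind => [B|x]; first exact: GW_past.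
    apply: (@dmeas_comp _ _ (GW X j) (fun y =>
      if `|pow_state (s i) x - pow_state (s j) y| < e then Some 0%N else None)).
    by move=> B; exact: GW_past.
  move=> /(_ [set Some 0%N]); congr (_ _); apply/seteqP; split => w /=; rewrite /h.
    by rewrite -/(M i w); case: ifP.
  by rewrite -/(M i w) => ->.
Qed.

(** The limit has total mean s_0, equals 1 on extinction since s^0 = 1, and 0 once Delta is reached.
    Survival receives what is left after removing the extinction probability b_0. *)
Lemma orbit_limit : exists L : T -> R, [/\ measurable_fun setT L,
  forall w, 0 <= L w <= 1,
  {ae P, forall w, (fun n => pow_state (s n) (GW X n w)) @ \oo --> L w} &
  (\int[P]_(w in survival) (L w)%:E = (s 0 - lower_orbit f 0)%:E)%E].
Proof.
(* The limit superior is measurable without knowing convergence, and the truncation makes the bounds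
   0 and 1 hold at every point. *)
pose L0 w := fine (limn_esup (fun n => (M n w)%:E)).
pose L w := Num.max 0 (Num.min 1 (L0 w)).
have mL0 : measurable_fun setT L0.
  apply: measurableT_comp => //.
  apply: (@measurable_fun_limn_esup _ _ _ setT (fun n w => (M n w)%:E)) => n.
  exact: mME.
have mL : measurable_fun setT L.
  by apply: measurable_maxr => //; exact: measurable_minr.
have LI w : 0 <= L w <= 1.
  by rewrite /L le_max lexx/= ge_max ler01 ge_min lexx.
have cL : {ae P, forall w, M ^~ w @ \oo --> L w}.
  apply: filterS orbit_martingale_cvg => w cw.
  have lI : 0 <= limn (M ^~ w) <= 1.
    apply/andP; split.
      by apply: limr_ge => //; apply: nearW => n; case/andP: (M01 n w).
    by apply: limr_le => //; apply: nearW => n; case/andP: (M01 n w).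
  suff -> : L w = limn (M ^~ w) by [].
  have L0E : L0 w = limn (M ^~ w).
    have ce : (fun n => (M n w)%:E) @ \oo --> (limn (M ^~ w))%:E.
      by apply: cvg_EFin; [exact: nearW|exact: cw].
    rewrite /L0 is_cvg_limn_esupE; last by apply/cvg_ex; eexists; exact: ce.
    by rewrite (cvg_lim _ ce).
  have /andP[l0 l1] := lI.
  by rewrite /L L0E (min_idPr l1) (max_idPr l0).
have mLE D : measurable_fun D (EFin \o L).
  by apply/measurable_EFinP; exact: measurable_funS mL.
have LE0 D w : D w -> (0 <= (L w)%:E)%E by rewrite lee_fin; case/andP: (LI w).
have LT : (\int[P]_w (L w)%:E = (s 0)%:E)%E.
  have [|||||_ _ h] := @dominated_convergence _ _ _ P setT measurableT
    (fun n w => (M n w)%:E) (EFin \o L) (cst 1%E).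
  - by move=> n; exact: mME.
  - exact: mLE.
  - apply: filterS cL => w cw _; apply: cvg_EFin; [exact: nearW|exact: cw].
  - apply: (@integrable_bounded _ _ _ P setT (cst 1) 1) => // w /=.
    by rewrite normr1.
  - apply: aeW => w n _; rewrite /= lee_fin ger0_norm; by case/andP: (M01 n w).
  apply: (cvg_unique _ h) => //.
  rewrite (_ : [sequence _]_n = cst (s 0)%:E); first exact: cvg_cst.
  apply/funext => n /=; rewrite (integral_M (leq0n n)); last exact: sigma_setT.
  by rewrite (eq_integral (cst (s 0)%:E))//; exact: integral_cst_probability.
exists L; split => //.
have mS := measurable_survival; have mE := measurable_extinction.
have mD := measurableC measurable_no_defect.
have L_ext : (\int[P]_(w in extinction) (L w)%:E = (lower_orbit f 0)%:E)%E.
  rewrite -extinction_prob (ae_eq_integral (cst 1%E))//.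
  - by rewrite integral_cst// mul1e.
  - apply: filterS cL => w cw [n _ /= Zn]; congr EFin.
    apply: (cvg_unique _ cw) => //; apply: cvg_near_cst; exists n => // m /= nm.
    by rewrite /M (GW_absorbing (x := Some 0%N) sumD0 nm Zn).
have L_dead : (\int[P]_(w in ~` no_defect) (L w)%:E = 0)%E.
  rewrite (ae_eq_integral (cst 0%E))//.
  - by rewrite integral0.
  - apply: filterS cL => w cw wD; congr EFin.
    have [n Zn] : exists n, GW X n w = None.
      apply: contrapT => nn; apply: wD => n _ /= Zn; apply: nn; by exists n.
    apply: (cvg_unique _ cw) => //; apply: cvg_near_cst; exists n => // m /= nm.
    by rewrite /M (GW_absorbing (x := None) (fun _ => erefl) nm Zn).
have : (\int[P]_w (L w)%:E = \int[P]_(w in survival) (L w)%:E +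
    \int[P]_(w in extinction) (L w)%:E + \int[P]_(w in ~` no_defect) (L w)%:E)%E.
  rewrite -ge0_integral_setU//; last 2 first.
  - by move=> w _; exact: (LE0 setT).
  - by apply/disj_setPS => w [[_ h1] h2]; exact: h1.
  rewrite -ge0_integral_setU//; last 3 first.
  - exact: measurableU.
  - by move=> w _; exact: (LE0 setT).
  - by apply/disj_setPS => w [[[h1 _]|/extinction_no_defect h1] h2]; exact: h2.
  congr (integral _ _ _); apply/seteqP; split => // w _.
  have [wD|] := pselect (no_defect w); last by right.
  by left; have [wE|wE] := pselect (extinction w); [right|left].
rewrite LT L_ext L_dead adde0.
have fS : (\int[P]_(w in survival) (L w)%:E)%E \is a fin_num.
  apply: integrable_fin_num => //; apply: (@integrable_bounded _ _ _ P _ L 1) => // w.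
  by rewrite ger0_norm; case/andP: (LI w).
by rewrite -(fineK fS) -EFinD => -[->]; congr EFin; rewrite addrK.
Qed.

End Orbit.
End Survival.

(** * Moments of the offspring distributions *)

Lemma eseries_wcvg (R : realType) (w h : nat -> R) :
  (forall k, 0 <= w k) -> (forall k, 0 <= h k) ->
  (\sum_(0 <= k <oo) (w k * h k)%:E < +oo)%E -> wcvg w h.
Proof.
by move=> w0 h0 fin; apply: nnseries_is_cvg => // k; rewrite mulr_ge0.
Qed.

Section Moments.
Context (d : measure_display) (T : measurableType d) (R : realType).
Variables (P : probability T R) (f : nat -> nat -> R).
Variable X : nat -> nat -> {RV P >-> NDelta}.
Hypothesis f_env : varying_environment f.
Hypothesis X_family : offspring_family f X.

Lemma environment_ge0 n k : 0 <= f n.+1 k.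
Proof. by have [[+ _] _] := f_env (ltn0Sn n); apply. Qed.

Lemma environment_mass_cvg n : wcvg (f n.+1) (fun k => 1 ^+ k).
Proof.
have [[_ h] _] := f_env (ltn0Sn n).
apply: eseries_wcvg; [exact: environment_ge0|by move=> k; rewrite expr1n|].
exact: le_lt_trans h (ltry _).
Qed.

Lemma environment_mass n : pgf (f n.+1) 1 <= 1.
Proof.
have [[_ h] _] := f_env (ltn0Sn n).
by rewrite -lee_fin -(wsums_eseries (wcvgP (@environment_mass_cvg n))).
Qed.

Let deriv1E n : gen_fun_deriv1 (f n.+1) =
  (\sum_(0 <= k <oo) (f n.+1 k * (1 ^+ k * k%:R))%:E)%E.
Proof. by apply: eq_eseriesr => k _; rewrite expr1n mul1r mulrC. Qed.

Lemma environment_mean_cvg n : wcvg (f n.+1) (fun k => 1 ^+ k * k%:R).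
Proof.
have [_ /andP[_ h]] := f_env (ltn0Sn n).
apply: eseries_wcvg; [exact: environment_ge0|by move=> k; rewrite expr1n mul1r|].
by rewrite -deriv1E.
Qed.

Lemma gen_fun_deriv1_dmean n : gen_fun_deriv1 (f n.+1) = (dmean (f n.+1) 1)%:E.
Proof.
by rewrite deriv1E (wsums_eseries (wcvgP (@environment_mean_cvg n))).
Qed.

Lemma environment_mean n : 0 < dmean (f n.+1) 1.
Proof.
by have [_ /andP[h _]] := f_env (ltn0Sn n); rewrite -lte_fin -gen_fun_deriv1_dmean.
Qed.

Lemma mu_prod n : mu f n = \prod_(i < n) dmean (f i.+1) 1.
Proof.
rewrite /mu big_add1 /= big_mkord; apply: eq_bigr => i _.
by rewrite gen_fun_deriv1_dmean.
Qed.

Lemma expect_onE n (h : R -> R) lo : (forall k : nat, 0 <= h k%:R) ->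
  (expect_on P (X n.+1 1%N) h [set k | (lo <= k)%N] =
   \sum_(0 <= k <oo) (f n.+1 k * ((lo <= k)%N%:R * h k%:R))%:E)%E.
Proof.
move=> h0; rewrite /expect_on; set A := event_in _ _.
have mA : measurable A by exact: measurable_preimage.
pose g x := if x is Some k then h k%:R else 0.
rewrite (eq_integral (fun w => (g (X n.+1 1%N w))%:E)); last first.
  by move=> w /set_mem[k _ /= kX]; rewrite -kX.
rewrite (@integral_comp_state _ _ _ P (X n.+1 1%N) _ A g)//; last 2 first.
- by move=> B; exact: measurable_preimage.
- by case=> //= k.
apply: eq_eseriesr => k _ /=.
have law : P (X n.+1 1%N @^-1` [set Some k]) = (f n.+1 k)%:E.
  by have [_ /(_ n.+1 1%N isT isT)[+ _]] := X_family; apply.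
case: (leqP lo k) => lok /=.
  rewrite (_ : A `&` _ = X n.+1 1%N @^-1` [set Some k]).
    by rewrite law -EFinM mul1r mulrC.
  apply/seteqP; split => w /=; first by move=> [].
  by move=> kX; split => //; exists k.
rewrite (_ : A `&` _ = set0) ?measure0 ?mule0 ?mul0r ?mulr0//.
apply/seteqP; split => // w /= -[[k' k'lo /= k'X] kX].
by move: k'X k'lo; rewrite kX => -[->] /=; rewrite leqNgt lok.
Qed.

Variable c : R.
Hypothesis c_gt0 : 0 < c.
Hypothesis X_moment : forall n, (1 <= n)%N ->
  (expect_on P (X n 1%N) (fun x => x ^+ 2)%R [set k | (2 <= k)%N]
   <= c%:E * expect_on P (X n 1%N) (fun x => x) [set k | (2 <= k)%N]
      * cond_expect P (X n 1%N) (fun x => x) [set k | (1 <= k)%N])%E.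

Section Generation.
Variable n : nat.
Let w := f n.+1.
Let w0 := @environment_ge0 n.

Let mean_cvg := @environment_mean_cvg n.

Let pos_cvg : wcvg w (fun k => 1 ^+ k * (0 < k)%N%:R).
Proof.
apply: (wcvg_dom w0 mean_cvg) => k; rewrite expr1n !mul1r ler0n /=.
by rewrite ler_nat; case: k.
Qed.

Let tail1_cvg : wcvg w (fun k => 1 ^+ k * ((1 < k)%N%:R * k%:R)).
Proof.
apply: (wcvg_dom w0 mean_cvg) => k; rewrite expr1n !mul1r mulr_ge0//=.
by rewrite ler_piMl// lern1 leq_b1.
Qed.

Let pos_gt0 : 0 < dpos w 1.
Proof.
rewrite lt_neqAle; apply/andP; split; last first.
  by apply: (wsums_ge0 w0 (wcvgP pos_cvg)) => k; rewrite expr1n mul1r.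
apply/eqP => p0; have := @environment_mean n; rewrite lt_neqAle => /andP[/eqP + _]; apply.
have wk0 k : w k.+1 = 0.
  apply/eqP; rewrite eq_le w0 andbT -[leLHS]mulr1 p0.
  apply: (wsums_le w0 (wsums_pick w 1 k.+1) (wcvgP pos_cvg)) => i.
  by rewrite expr1n !mul1r; case: eqP => [->|_] //=; rewrite ler0n.
apply: esym; apply: wsumsE; apply: cvg_near_cst; apply: nearW => N.
rewrite /series /=; apply: big1 => -[|k] _; first by rewrite !mulr0.
by rewrite -/w wk0 mul0r.
Qed.

(** Stated for the extended series: the right side is finite, so the moment condition itself
    provides the finite second moment. *)
Let moment_bound :
  (\sum_(0 <= k <oo) (w k * ((1 < k)%N%:R * k%:R ^+ 2))%:E <=
   (c * dtail1 w 1 * (dmean w 1 / dpos w 1))%:E)%E.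
Proof.
have := X_moment (ltn0Sn n); rewrite /cond_expect.
rewrite (@expect_onE n (fun x => x ^+ 2) 2); last by move=> k; exact: sqr_ge0.
rewrite (@expect_onE n (fun x => x) 2)// (@expect_onE n (fun x => x) 1)//.
have -> : P (event_in (X n.+1 1%N) [set k | (1 <= k)%N]) = (dpos w 1)%:E.
  have := @expect_onE n (fun=> 1) 1 (fun=> ler01).
  rewrite /expect_on integral_cst; last exact: measurable_preimage.
  rewrite mul1e => ->; rewrite -(wsums_eseries (wcvgP pos_cvg)).
  by apply: eq_eseriesr => k _; rewrite expr1n mul1r mulr1.
have -> : (\sum_(0 <= k <oo) (f n.+1 k * ((1 < k)%N%:R * k%:R))%:E = (dtail1 w 1)%:E)%E.
  rewrite -(wsums_eseries (wcvgP tail1_cvg)).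
  by apply: eq_eseriesr => k _; rewrite expr1n mul1r.
have -> : (\sum_(0 <= k <oo) (f n.+1 k * ((0 < k)%N%:R * k%:R))%:E = (dmean w 1)%:E)%E.
  rewrite -(wsums_eseries (wcvgP mean_cvg)).
  by apply: eq_eseriesr => -[|k] _; rewrite expr1n !mul1r ?mulr0.
by rewrite inver gt_eqF.
Qed.

Let tail2_wcvg : wcvg w (fun k => (1 < k)%N%:R * k%:R ^+ 2).
Proof.
apply: eseries_wcvg => //.
by apply: (le_lt_trans moment_bound); exact: ltry.
Qed.

Lemma environment_sq : wcvg w (fun k => (k%:R + 1) ^+ 2).
Proof.
(* The dominating function is 1 + 3 k, plus k^2 for k >= 2; the coefficient 3 is forced by (k + 1)^2
   = 4 at k = 1. *)
have h := wsumsD (wsumsD (wcvgP (@environment_mass_cvg n)) (wsumsZ 3 (wcvgP mean_cvg)))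
  (wcvgP tail2_wcvg).
apply: (wcvg_dom w0 (wsums_wcvg h)) => k; rewrite expr1n mul1r sqr_ge0/=.
case: k => [|[|k]] /=; rewrite ?mul0r ?mulr0 ?mul1r ?mulr1n; [lra|lra|].
have : 0 <= k.+2%:R :> R by [].
by move: k.+2%:R => x; lra.
Qed.

Lemma environment_tail : tail2 w * dpos w 1 <= c * dtail1 w 1 * dmean w 1.
Proof.
rewrite -ler_pdivlMr// -mulrA -lee_fin.
by rewrite -(wsums_eseries (wcvgP tail2_wcvg)) mulrA; have := moment_bound; rewrite mulrA.
Qed.

End Generation.
End Moments.

(** * Absorption time and survival *)

Section Absorption.
Context (d : measure_display) (T : measurableType d) (R : realType).
Variables (P : probability T R) (X : nat -> nat -> {RV P >-> NDelta}).

Lemma hitting_time_infty (Z : nat -> T -> NDelta) x w :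
  hitting_time R Z x w = +oo%E <-> forall n, (1 <= n)%N -> Z n w <> x.
Proof.
rewrite /hitting_time; split=> [h n n1 Zn|h].
  have : (+oo <= (n%:R : R)%:E)%E.
    by rewrite -h; apply: ereal_inf_lbound; exists n.
  by rewrite leNgt ltry.
rewrite (_ : [set _ | _ in _] = set0) ?ereal_inf0//.
by apply/seteqP; split => // y [n [n1 Zn] _]; exact: (h n n1 Zn).
Qed.

(** Hitting times start at n = 1 and [survival] at n = 0; the two agree because the initial state 1
    is neither 0 nor Delta. *)
Lemma absorption_time_infty w :
  absorption_time R (GW X) w = +oo%E <-> survival X w.
Proof.
rewrite /absorption_time; set h0 := hitting_time _ _ _ _; set hD := hitting_time _ _ _ _.
have -> : Order.min h0 hD = +oo%E <-> h0 = +oo%E /\ hD = +oo%E.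
  split=> [h|[-> ->]]; last by rewrite minxx.
  have : (+oo <= Order.min h0 hD)%E by rewrite h.
  by rewrite le_min => /andP[]; rewrite !leye_eq => /eqP -> /eqP ->.
rewrite !hitting_time_infty; split.
  move=> [h1 h2]; split; last first.
    by move=> [[|n] _ /=]; [|exact: (h1 n.+1 isT)].
  by move=> [|n] _ /=; [|exact: (h2 n.+1 isT)].
move=> [hD' hE]; split => n _ Zn; first by apply: hE; exists n.
exact: (hD' n I Zn).
Qed.

End Absorption.

(** * Conclusion *)

Section UnitIntervalIntegrals.
Context (d : measure_display) (T : measurableType d) (R : realType).
Variables (P : probability T R) (S : set T).
Hypothesis mS : measurable S.

Lemma integral_onem (L : T -> R) : measurable_fun setT L ->
  (forall w, 0 <= L w <= 1) ->
  (\int[P]_(w in S) (1 - L w)%:E = P S - \int[P]_(w in S) (L w)%:E)%E.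
Proof.
move=> mL LI; have i1 : P.-integrable S (EFin \o cst (1 : R)).
  by apply: (@integrable_bounded _ _ _ P S (cst 1) 1) => // w /=; rewrite normr1.
have iL : P.-integrable S (EFin \o L).
  apply: (@integrable_bounded _ _ _ P S L 1) => // w.
  by rewrite ger0_norm; case/andP: (LI w).
rewrite (_ : P S = \int[P]_(w in S) 1%:E)%E; last by rewrite integral_cst// mul1e.
exact: (integralB_EFin mS i1 iL).
Qed.

Lemma integral_eq0_ae (L : T -> R) : measurable_fun setT L ->
  (forall w, 0 <= L w) -> (\int[P]_(w in S) (L w)%:E = 0)%E ->
  {ae P, forall w, S w -> L w = 0}.
Proof.
move=> mL L0 h; have mLE : measurable_fun S (EFin \o L).
  by apply/measurable_EFinP; exact: measurable_funS mL.
have : ae_eq P S (EFin \o L) (cst 0%E).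
  apply/(ae_eq_integral_abs P mS mLE); rewrite -[RHS]h.
  by apply: eq_integral => w _ /=; rewrite ger0_norm.
by apply: filterS => w h' Sw; have [] := h' Sw.
Qed.

(** Where every L_i equals 1, each integral is at least the probability of that set, and the
    integrals tend to 0. *)
Lemma integral_small_ae (L : nat -> T -> R) (K : R) :
  (forall i, measurable_fun setT (L i)) -> (forall i w, 0 <= L i w <= 1) ->
  (forall i, (\int[P]_(w in S) (L i w)%:E = (K / i.+2%:R)%:E)%E) ->
  {ae P, forall w, S w -> exists i, L i w < 1}.
Proof.
move=> mL LI intL.
pose N := S `&` \bigcap_i (L i @^-1` [set 1]).
have mN : measurable N.
  apply: measurableI => //; apply: bigcapT_measurable => i.
  by rewrite -[_ @^-1` _]setTI; exact: mL.
have PN i : (P N <= (K / i.+2%:R)%:E)%E.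
  rewrite -(intL i); apply: (@le_trans _ _ (\int[P]_(w in N) (L i w)%:E)%E).
    rewrite (eq_integral (cst 1%E)); last by move=> w /set_mem[_ /(_ i I) /= ->].
    by rewrite integral_cst// mul1e.
  apply: ge0_subset_integral => //.
  - by apply/measurable_EFinP; exact: measurable_funS (mL i).
  - by move=> w _; rewrite lee_fin; case/andP: (LI i w).
  - by move=> w [].
have K0 : 0 <= K.
  have := le_trans (measure_ge0 P N) (PN 0); rewrite lee_fin.
  by rewrite pmulr_lge0// invr_gt0.
have N0 : P N = 0%E.
  apply/eqP; rewrite eq_le measure_ge0 andbT.
  apply/lee_addgt0Pr => e e0; rewrite add0e.
  pose i := Num.truncn (K / e).
  apply: (le_trans (PN i)); rewrite lee_fin ler_pdivrMr// mulrC -ler_pdivrMr//.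
  by apply: (le_trans (ltW (truncnS_gt _))); rewrite ler_nat.
apply: (@negligibleS _ _ _ P N); last exact/negligibleP.
move=> w /= /not_implyP[Sw nex]; split => // i _ /=.
have /andP[_ L1] := LI i w; apply/eqP; rewrite eq_le L1/= leNgt.
by apply/negP => Li; apply: nex; exists i.
Qed.

End UnitIntervalIntegrals.

Section Main.
Context (d : measure_display) (T : measurableType d) (R : realType).
Variables (P : probability T R) (f : nat -> nat -> R).
Variable X : nat -> nat -> {RV P >-> NDelta}.
Hypothesis f_env : varying_environment f.
Hypothesis X_family : offspring_family f X.
Variable c : R.
Hypothesis c_gt0 : 0 < c.
Hypothesis X_moment : forall n, (1 <= n)%N ->
  (expect_on P (X n 1%N) (fun x => x ^+ 2)%R [set k | (2 <= k)%N]
   <= c%:E * expect_on P (X n 1%N) (fun x => x) [set k | (2 <= k)%N]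
      * cond_expect P (X n 1%N) (fun x => x) [set k | (1 <= k)%N])%E.
Hypothesis survival_gt0 : (0 < P (survival X))%E.

Let f_ge0 := environment_ge0 f_env.
Let f_mass := environment_mass f_env.
Let f_mean := environment_mean f_env.
Let f_sq n : wcvg (f n.+1) (fun k => (k%:R + 1) ^+ 2).
Proof. exact: environment_sq X_moment n. Qed.
Let f_tail n : tail2 (f n.+1) * dpos (f n.+1) 1 <=
  c * dtail1 (f n.+1) 1 * dmean (f n.+1) 1.
Proof. exact: environment_tail X_moment n. Qed.

Let a := upper_orbit f.
Let b := lower_orbit f.
Let mS := measurable_survival X.
Let PS := survival_prob f_ge0 f_sq f_mass X_family.

Let ba : b 0 < a 0.
Proof. by move: survival_gt0; rewrite PS lte_fin subr_gt0. Qed.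

Let bI n : 0 <= b n <= 1.
Proof.
rewrite lower_orbit_ge0//=.
apply: (limr_le (@lower_orbit_cvg _ _ f_ge0 f_sq f_mass n)).
by apply: nearW => k; case/andP: (pgf_iterI f_ge0 f_sq f_mass n k (t := 0) ltac:(by rewrite lexx ler01)).
Qed.

Let aI n : 0 <= a n <= 1.
Proof.
rewrite upper_orbit_le1// andbT.
apply: (limr_ge (@upper_orbit_cvg _ _ f_ge0 f_sq f_mass n)).
by apply: nearW => k; case/andP: (pgf_iterI f_ge0 f_sq f_mass n k (t := 1) ltac:(by rewrite lexx ler01)).
Qed.

(** For the orbit a itself the integral of L over survival is a_0 - b_0, the full survival
    probability, so 1 - L has integral 0 there. *)
Let upper_ae : {ae P, forall w, survival X w ->
  (fun n => pow_state (a n) (GW X n w)) @ \oo --> (1 : R)}.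
Proof.
have [L [mL LI cL intL]] := orbit_limit f_ge0 f_sq f_mass X_family aI
  (upper_orbitS f_ge0 f_sq f_mean f_mass).
have h : {ae P, forall w, survival X w -> 1 - L w = 0}.
  apply: integral_eq0_ae => //.
  - exact: measurable_funB.
  - by move=> w; rewrite subr_ge0; case/andP: (LI w).
  - rewrite integral_onem// [X in (_ - X)%E]intL PS -EFinB.
    by rewrite /a subrr.
apply: filterS2 cL h => w cw hw Sw.
by rewrite (_ : 1 = L w)//; have := hw Sw; lra.
Qed.

Let lower_ae : {ae P, forall w, survival X w ->
  (fun n => pow_state (b n) (GW X n w)) @ \oo --> (0 : R)}.
Proof.
have [L [mL LI cL intL]] := orbit_limit f_ge0 f_sq f_mass X_family bI
  (lower_orbitS f_ge0 f_sq f_mean f_mass).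
have h : {ae P, forall w, survival X w -> L w = 0}.
  apply: integral_eq0_ae => //.
  - by move=> w; case/andP: (LI w).
  - by rewrite intL /b subrr.
by apply: filterS2 cL h => w cw hw Sw; rewrite -(hw Sw).
Qed.

(** Orbit, limit and rate are packed into one witness so that [choice] can select them for countably
    many starting points. *)
Let orbit_rate v : b 0 < v < a 0 -> exists p : (nat -> R) * (T -> R) * R,
  [/\ forall n, b n < p.1.1 n < a n,
      0 < p.2 /\ (fun n => mu f n * - ln (p.1.1 n / a n)) @ \oo --> p.2,
      measurable_fun setT p.1.2 /\ (forall w, 0 <= p.1.2 w <= 1),
      {ae P, forall w, (fun n => pow_state (p.1.1 n) (GW X n w)) @ \oo --> p.1.2 w} &
      (\int[P]_(w in survival X) (p.1.2 w)%:E = (v - b 0)%:E)%E].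
Proof.
move=> bva; have [s [s0 hs]] := orbit_exists f_ge0 f_sq f_mean f_mass bva.
have bs n : b n < s n by case: (hs n).
have sa n : s n < a n by case: (hs n).
have s_orbit n : pgf (f n.+1) (s n.+1) = s n by case: (hs n).
have sI n : 0 <= s n <= 1.
  have /andP[b0 _] := bI n; have /andP[_ a1] := aI n.
  by rewrite (le_trans b0 (ltW (bs n))) (le_trans (ltW (sa n)) a1).
have [L [mL LI cL intL]] := orbit_limit f_ge0 f_sq f_mass X_family sI s_orbit.
(* One sample path with these limits provides the population sizes z_n required
   by the deterministic statement. *)
have [w [Sw [sw [aw [bw Lw]]]]] : exists w, survival X w /\
    (fun n => pow_state (s n) (GW X n w)) @ \oo --> L w /\
    (fun n => pow_state (a n) (GW X n w)) @ \oo --> (1 : R) /\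
    (fun n => pow_state (b n) (GW X n w)) @ \oo --> (0 : R) /\ 0 < L w.
  (* Without such a path L would vanish almost everywhere on survival, against its integral v - b_0
     > 0. *)
  apply: contrapT => nex.
  have : (\int[P]_(w in survival X) (L w)%:E = 0)%E.
    rewrite (ae_eq_integral (cst 0%E))//; first by rewrite integral0.
      by apply/measurable_EFinP; exact: measurable_funS mL.
    apply: filterS3 cL upper_ae lower_ae => w sw aw bw Sw /=.
    congr EFin; apply/eqP; rewrite eq_le andbC; have /andP[-> _] /= := LI w.
    rewrite leNgt; apply/negP => Lw; apply: nex; exists w; split => //.
    by split => //; split; [exact: aw|split => //; exact: bw].
  rewrite intL => -[] /eqP; rewrite subr_eq0 s0 => /eqP vb.
  by move: bva; rewrite vb ltxx.
have [z hz] := survivalP Sw.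
have powE (t : nat -> R) : (fun n => pow_state (t n) (GW X n w)) =
    (fun n => t n ^+ z n).
  by apply/funext => n; have [_ ->] := hz n.
rewrite powE in sw; rewrite powE in aw; rewrite powE in bw.
have [th th0 hth] := orbit_log_mean_cvg f_ge0 f_sq f_mean f_mass c_gt0 f_tail
  (fun n => (andP (bI n)).1) bs sa (fun n => (andP (aI n)).2)
  (upper_orbitS f_ge0 f_sq f_mean f_mass) (lower_orbitS f_ge0 f_sq f_mean f_mass)
  s_orbit (fun n => (hz n).1) Lw aw bw sw.
exists (s, L, th); split => //=.
- by move=> n; rewrite bs sa.
- split => //; rewrite (_ : (fun n => _) =
    fun n => \prod_(i < n) dmean (f i.+1) 1 * - ln (s n / a n))//.
  by apply/funext => n; rewrite mu_prod.
- by rewrite intL s0.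
Qed.

Let mu_gt0 n : 0 < mu f n.
Proof. by rewrite mu_prod//; apply: prodr_gt0 => i _; exact: f_mean. Qed.

(** The limit superior gives a measurable function on all of T; [fine] and the cut at 0 make it real
    and non-negative even where there is no convergence. *)
Let W (w : T) : R :=
  Num.max 0 (fine (limn_esup (fun n => (real_of R (GW X n w) / mu f n)%:E))).

Let mW : measurable_fun setT W.
Proof.
apply: measurable_maxr => //; apply: measurableT_comp => //.
apply: (@measurable_fun_limn_esup _ _ _ setT
  (fun n w => (real_of R (GW X n w) / mu f n)%:E)) => n.
apply/measurable_EFinP.
apply: (@measurable_comp_state _ _ _ (GW X n) _ setT (fun x => real_of R x / mu f n)).
by move=> B; exact: measurable_GW.
Qed.

Let W_lim w (l : R) : 0 <= l -> (fun n => real_of R (GW X n w) / mu f n) @ \oo --> l ->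
  W w = l.
Proof.
move=> l0 hl; have ce : (fun n => (real_of R (GW X n w) / mu f n)%:E) @ \oo --> l%:E.
  by apply: cvg_EFin; [exact: nearW|exact: hl].
rewrite /W is_cvg_limn_esupE; last by apply/cvg_ex; eexists; exact: ce.
by rewrite (cvg_lim _ ce)//= (max_idPr l0).
Qed.

Lemma scaled_process_cvg : exists V : {RV P >-> R}, (forall w, 0 <= V w) /\
  {ae P, forall w, survival X w ->
    (fun n => real_of R (GW X n w) / mu f n) @ \oo --> V w /\ 0 < V w}.
Proof.
pose K := a 0 - b 0; have K0 : 0 < K by rewrite subr_gt0.
(* The denominator i + 2 keeps both kinds of starting points strictly between b_0 and a_0; over
   survival, 1 - L for the upper ones and L for the lower ones integrate to K / (i + 2). *)
have KI i : 0 < K / i.+2%:R < K.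
  by rewrite divr_gt0//= ltr_pdivrMr// ltr_pMr// ltr1n.
have hi i : b 0 < a 0 - K / i.+2%:R < a 0.
  have := KI i; move: (K / i.+2%:R) => x; rewrite /K => /andP[x0 xK].
  by apply/andP; split; lra.
have lo i : b 0 < b 0 + K / i.+2%:R < a 0.
  have := KI i; move: (K / i.+2%:R) => x; rewrite /K => /andP[x0 xK].
  by apply/andP; split; lra.
have [pu Hu] := choice (fun i => orbit_rate (hi i)).
have [pl Hl] := choice (fun i => orbit_rate (lo i)).
have cu : {ae P, forall w i,
    (fun n => pow_state ((pu i).1.1 n) (GW X n w)) @ \oo --> (pu i).1.2 w}.
  by apply: ae_foralln => i; case: (Hu i).
have cl : {ae P, forall w i,
    (fun n => pow_state ((pl i).1.1 n) (GW X n w)) @ \oo --> (pl i).1.2 w}.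
  by apply: ae_foralln => i; case: (Hl i).
have pos : {ae P, forall w, survival X w -> exists i, 1 - (pu i).1.2 w < 1}.
  apply: (@integral_small_ae _ _ _ _ _ mS (fun i w => 1 - (pu i).1.2 w) K) => i.
  - by have [_ _ [mL _] _ _] := Hu i; exact: measurable_funB.
  - move=> w; have [_ _ [_ /(_ w)/andP[L0 L1]] _ _] := Hu i.
    by apply/andP; split; lra.
  - have [_ _ [mL LI] _ intL] := Hu i.
    rewrite integral_onem// [X in (_ - X)%E]intL PS -EFinB; congr EFin.
    by rewrite /K /a /b; ring.
have lt1 : {ae P, forall w, survival X w -> exists i, (pl i).1.2 w < 1}.
  apply: (@integral_small_ae _ _ _ _ _ mS (fun i w => (pl i).1.2 w) K) => i.
  - by have [_ _ [mL _] _ _] := Hl i.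
  - by have [_ _ [_ LI] _ _] := Hl i.
  - have [_ _ _ _ intL] := Hl i.
    by rewrite intL; congr EFin; rewrite addrC addKr.
exists (mfun_Sub (mem_set mW)); split; first by move=> w; rewrite /= /W le_max lexx.
apply: filterS3 (filterI cu cl) (filterI pos lt1) upper_ae => w [cuw clw] [posw lt1w] aw Sw.
have [i Li] := posw Sw; have [j Lj] := lt1w Sw; have {}aw := aw Sw.
have {cuw} ci := cuw i; have {clw} cj := clw j.
have [z hz] := survivalP Sw.
have powE (t : nat -> R) : (fun n => pow_state (t n) (GW X n w)) =
    (fun n => t n ^+ z n).
  by apply/funext => n; have [_ ->] := hz n.
rewrite powE in aw; rewrite powE in ci; rewrite powE in cj.
have ZE n : real_of R (GW X n w) = (z n)%:R by have [_ ->] := hz n.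
have {}Li : 0 < (pu i).1.2 w by lra.
have [su [thu0 cthu] _ _ _] := Hu i; have [sl [thl0 cthl] _ _ _] := Hl j.
(* Z_n / mu_n is the quotient of - ln (s_n^z_n / a_n^z_n) by mu_n times - ln (s_n / a_n), and
   a_n^z_n tends to 1. *)
pose l := - ln ((pu i).1.2 w) / (pu i).2.
have logE (s : nat -> R) n : b n < s n < a n ->
    (z n)%:R * - ln (s n / a n) = - ln (s n ^+ z n / a n ^+ z n).
  move=> /andP[bs sa]; have b0 := (andP (bI n)).1.
  have s0 : 0 < s n by exact: le_lt_trans bs.
  have a0 : 0 < a n by exact: lt_trans sa.
  by rewrite -expr_div_n lnXn ?divr_gt0// mulrN mulr_natl.
have cZ : (fun n => real_of R (GW X n w) / mu f n) @ \oo --> l.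
  have lg n : - ln ((pu i).1.1 n / a n) != 0.
    have /andP[bs sa] := su n; have b0 := (andP (bI n)).1.
    have s0 : 0 < (pu i).1.1 n by exact: le_lt_trans bs.
    have a0 : 0 < a n by exact: lt_trans sa.
    rewrite gt_eqF// oppr_gt0 ln_lt0// divr_gt0//=.
    by rewrite ltr_pdivrMr// mul1r.
  rewrite (_ : (fun n => _) = fun n => - ln ((pu i).1.1 n ^+ z n / a n ^+ z n) /
      (mu f n * - ln ((pu i).1.1 n / a n))); last first.
    apply/funext => n; rewrite -logE// ZE.
    by rewrite -mulf_div divff ?mulr1.
  apply: cvgM; last by apply: cvgV => //; rewrite gt_eqF.
  have cr : (fun n => (pu i).1.1 n ^+ z n / a n ^+ z n) @ \oo --> (pu i).1.2 w.
    by rewrite -[(pu i).1.2 w]divr1; apply: cvgM => //; exact: cvgV.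
  by apply: cvgN; apply: (cvg_comp _ _ cr); exact: continuous_ln.
have l0 : 0 <= l.
  rewrite divr_ge0 ?(ltW thu0)// oppr_ge0 ln_le0//.
  by have [_ _ [_ /(_ w)/andP[_ ->]] _ _] := Hu i.
rewrite /= (W_lim l0 cZ); split => //.
(* If the limit were 0, the ratio s_n^z_n / a_n^z_n of the lower orbit would tend to exp 0 = 1,
   whereas its limit is below 1. *)
rewrite lt_neqAle l0 andbT; apply/eqP => l00.
have c0 : (fun n => - (real_of R (GW X n w) / mu f n *
    (mu f n * - ln ((pl j).1.1 n / a n)))) @ \oo --> - (l * (pl j).2).
  by apply: cvgN; exact: cvgM.
have := cvg_comp _ _ c0 (@continuous_expR R _).
rewrite -l00 mul0r oppr0 expR0.
rewrite (_ : expR \o _ = fun n => (pl j).1.1 n ^+ z n / a n ^+ z n); last first.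
  apply/funext => n /=; have /andP[bs sa] := sl n; have b0 := (andP (bI n)).1.
  have s0 : 0 < (pl j).1.1 n by exact: le_lt_trans bs.
  have a0 : 0 < a n by exact: lt_trans sa.
  rewrite mulrA divfK ?gt_eqF// ZE logE// opprK lnK// posrE.
  by rewrite divr_gt0// exprn_gt0.
have cj1 : (fun n => (pl j).1.1 n ^+ z n / a n ^+ z n) @ \oo --> (pl j).1.2 w.
  by rewrite -[(pl j).1.2 w]divr1; apply: cvgM => //; exact: cvgV.
move=> c1; have := cvg_unique _ c1 cj1; move=> /(_ (@Rhausdorff R)) e1.
by move: Lj; rewrite -e1 ltxx.
Qed.

End Main.

Theorem corollary1 (R : realType) (d : measure_display) (T : measurableType d)
    (P : probability T R) (f : nat -> nat -> R)
    (X : nat -> nat -> {RV P >-> NDelta}) :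
  varying_environment f ->
  offspring_family f X ->
  (exists c : R, 0 < c /\
    forall n, (1 <= n)%N ->
      (expect_on P (X n 1%N) (fun x => x ^+ 2)%R [set k | (2 <= k)%N]
       <= c%:E * expect_on P (X n 1%N) (fun x => x) [set k | (2 <= k)%N]
          * cond_expect P (X n 1%N) (fun x => x) [set k | (1 <= k)%N])%E) ->
  (0 < P [set w | absorption_time R (GW X) w = +oo%E])%E ->
  exists W : {RV P >-> R},
    (forall w, 0 <= W w) /\
    {ae P, forall w, absorption_time R (GW X) w = +oo%E ->
      (fun n => real_of R (GW X n w) / mu f n) @ \oo --> W w /\ 0 < W w}.
Proof.
move=> f_env X_family [c [c_gt0 X_moment]].
rewrite (_ : [set w | _] = survival X); last first.
  by apply/seteqP; split => w /absorption_time_infty.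
move=> /(scaled_process_cvg f_env X_family c_gt0 X_moment)[W [W_ge0 W_lim]].
by exists W; split => //; apply: filterS W_lim => w h /absorption_time_infty.
Qed.
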